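(* Let $m\ge2$. If $f\in\Phi(\mathbb{R}^m)$, then for any complex $\alpha$ and $\beta$, $$(I_2^\alpha\tilde R_T I_2^\beta R_T f)(x)=(2\pi)^{m-1}(I_2^{\alpha+\beta+m-1}f)(x),\qquad x\in\mathbb{R}^m.$$
   Context: Points of $\mathbb{R}^m$ are written $x=(x',x_m)$, $x'\in\mathbb{R}^{m-1}$; $\tilde{\mathbb{R}}^m=\mathbb{R}^{m-1}\times\mathbb{R}$ is a second copy of $\mathbb{R}^m$ with points $(a,b)$. The transversal Radon transform is $$(R_T f)(a,b)=\int_{\mathbb{R}^{m-1}} f(x',a\cdot x'+b)\,dx',\qquad (a,b)\in\tilde{\mathbb{R}}^m.$$ The backprojection operator $\tilde R_T$ sends functions on $\tilde{\mathbb{R}}^m$ to functions on $\mathbb{R}^m$: $$(\tilde R_T g)(x)=\int_{\mathbb{R}^{m-1}}g(a,\,-x'\cdot a+x_m)\,da=(R_T g)(-x',x_m).$$ The Fourier transform is $(\mathcal{F}f)(y)=\int_{\mathbb{R}^m}f(x)e^{ix\cdot y}\,dx$. $\Psi(\mathbb{R}^m)$ is the subspace of Schwartz functions $\psi$ on $\mathbb{R}^m$ vanishing together with all derivatives $\partial_m^k\psi$, $k=0,1,2,\ldots$ (in the last variable) on the hyperplane $x_m=0$; $\Phi(\mathbb{R}^m)=\mathcal{F}[\Psi(\mathbb{R}^m)]$; $\Phi(\tilde{\mathbb{R}}^m)$ has the same meaning on $\tilde{\mathbb{R}}^m$ (and $R_T$ maps $\Phi(\mathbb{R}^m)$ into $\Phi(\tilde{\mathbb{R}}^m)$).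 The partial Riesz potential $I_2^\alpha$ in the last variable is defined on $\Phi$ for every $\alpha\in\mathbb{C}$ by $\mathcal{F}[I_2^\alpha f](y)=|y_m|^{-\alpha}\mathcal{F}[f](y)$; for $\operatorname{Re}\alpha>0$, $\alpha\ne1,3,5,\ldots$ it equals $$(I_2^\alpha f)(x)=\frac{1}{\gamma_1(\alpha)}\int_{\mathbb{R}}\frac{f(x',y_m)\,dy_m}{|x_m-y_m|^{1-\alpha}},\qquad \gamma_1(\alpha)=\frac{2^\alpha\pi^{1/2}\Gamma(\alpha/2)}{\Gamma((1-\alpha)/2)}.$$ *)

(* Defs.v *)
From HB Require Import structures.
From mathcomp Require Import all_boot all_order all_algebra.
From mathcomp Require Import complex.
From mathcomp Require Import all_classical all_reals all_analysis.

Set Implicit Arguments.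
Unset Strict Implicit.
Unset Printing Implicit Defensive.

Import Order.TTheory GRing.Theory Num.Theory.
Import numFieldNormedType.Exports.

Local Open Scope classical_set_scope.
Local Open Scope ring_scope.
Local Open Scope complex_scope.

(* Throughout, a point x = (x', x_m) of R^m is a pair in 'rV[R]_n * R with
   n = m - 1, and complex-valued functions take their values in R[i]. *)

Section LebesgueMeasure.
Context {R : realType}.

Definition cons_pair n (p : measurableTypeR R * n.-tuple (measurableTypeR R)) :
  n.+1.-tuple (measurableTypeR R) := [tuple of p.1 :: p.2].

(* The Borel sigma-algebra on n-tuples is the one generated by the
   coordinates; the Lebesgue measure on R^n.+1 is the image of the product
   of the Lebesgue measures on R and R^n under (t, v) |-> t :: v. *)
Fixpoint lebesgue_tuple (n : nat) :
    set (n.-tuple (measurableTypeR R)) -> \bar R :=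
  match n with
  | 0 => \d_ [tuple]
  | k.+1 => pushforward (lebesgue_measure \x^ @lebesgue_tuple k)%E (@cons_pair k)
  end.

Let measurable_cons_pair n : measurable_fun setT (@cons_pair n).
Proof. exact: measurable_cons. Qed.

Arguments lebesgue_tuple : clear implicits.

Let lebesgue_tuple_measure n :
  {mu : {measure set (n.-tuple (measurableTypeR R)) -> \bar R} |
    mu = lebesgue_tuple n :> (set _ -> \bar R)}.
Proof.
elim: n => [|n [mu mu_eq]]; first by exists \d_ [tuple].
pose nu := (lebesgue_measure \x^ mu)%E.
unshelve eexists (pushforward nu (@cons_pair n)).
  exact: measurable_cons_pair.
by rewrite /= /nu mu_eq.
Qed.

Let lebesgue_tuple0 n : lebesgue_tuple n set0 = 0%E.
Proof. by case: (lebesgue_tuple_measure n) => mu <-; exact: measure0. Qed.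

Let lebesgue_tuple_ge0 n A : (0 <= lebesgue_tuple n A)%E.
Proof. by case: (lebesgue_tuple_measure n) => mu <-; exact: measure_ge0. Qed.

Let lebesgue_tuple_sigma_additive n : semi_sigma_additive (lebesgue_tuple n).
Proof.
case: (lebesgue_tuple_measure n) => mu <-.
exact: measure_semi_sigma_additive.
Qed.

HB.instance Definition _ n := isMeasure.Build _ _ _ (lebesgue_tuple n)
  (lebesgue_tuple0 n) (@lebesgue_tuple_ge0 n)
  (@lebesgue_tuple_sigma_additive n).

End LebesgueMeasure.

Arguments lebesgue_tuple {R} n.

Section Integrals.
Context {R : realType}.

Definition complex_integral d (T : measurableType d)
    (mu : {measure set T -> \bar R}) (f : T -> R[i]) : R[i] :=
  (\int[mu]_t complex.Re (f t)) +i* (\int[mu]_t complex.Im (f t)).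

Definition rV_of_tuple n (t : n.-tuple R) : 'rV[R]_n := \row_i tnth t i.

Definition integral_rV n (f : 'rV[R]_n -> R[i]) : R[i] :=
  complex_integral (lebesgue_tuple n) (fun t => f (rV_of_tuple t)).

Definition integral_space n (f : 'rV[R]_n * R -> R[i]) : R[i] :=
  complex_integral (lebesgue_tuple n \x lebesgue_measure)%E
    (fun p => f (rV_of_tuple p.1, p.2)).

End Integrals.

Section Functions.
Context {R : realType}.

Definition expi (t : R) : R[i] := cos t +i* sin t.

(* t to the power z for t > 0.  At t = 0 the library value ln 0 = 0 makes
   this 1; that value is only ever multiplied by 0 on the space Phi. *)
Definition cpowR (t : R) (z : R[i]) : R[i] :=
  (expR (complex.Re z * ln t))%:C * expi (complex.Im z * ln t).

Definition dotv n (u v : 'rV[R]_n) : R := \sum_i u 0 i * v 0 i.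

Definition dot n (x y : 'rV[R]_n * R) : R := dotv x.1 y.1 + x.2 * y.2.

Definition fourier n (f : 'rV[R]_n * R -> R[i]) (y : 'rV[R]_n * R) : R[i] :=
  integral_space (fun x => f x * expi (dot x y)).

(* Coordinate directions of R^m: None is the last one. *)
Definition basis n (o : option 'I_n) : 'rV[R]_n * R :=
  if o is Some i then (delta_mx 0 i, 0) else (0, 1).

Definition partial n (o : option 'I_n) (f : 'rV[R]_n * R -> R[i])
    (x : 'rV[R]_n * R) : R[i] :=
  ('D_(basis o) (fun z => complex.Re (f z)) x) +i*
  ('D_(basis o) (fun z => complex.Im (f z)) x).

Definition partials n (s : seq (option 'I_n)) (f : 'rV[R]_n * R -> R[i]) :
  'rV[R]_n * R -> R[i] := foldr (@partial n) f s.

Definition smooth n (f : 'rV[R]_n * R -> R[i]) : Prop :=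
  forall s : seq (option 'I_n),
    let re x := complex.Re (partials s f x) in
    let im x := complex.Im (partials s f x) in
    [/\ continuous re, continuous im,
        forall o x, derivable re x (basis o) &
        forall o x, derivable im x (basis o)].

Definition schwartz n (f : 'rV[R]_n * R -> R[i]) : Prop :=
  smooth f /\
  forall (k : nat) (s : seq (option 'I_n)), exists C : R,
    forall x, (1 + `|x|) ^+ k * Normc.normc (partials s f x) <= C.

Definition Psi n : set ('rV[R]_n * R -> R[i]) :=
  [set psi | schwartz psi /\
    forall (k : nat) (x' : 'rV[R]_n), partials (nseq k None) psi (x', 0) = 0].

Definition Phi n : set ('rV[R]_n * R -> R[i]) := @fourier n @` @Psi n.

Definition radon_T n (f : 'rV[R]_n * R -> R[i]) (p : 'rV[R]_n * R) : R[i] :=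
  integral_rV (fun x' => f (x', dotv p.1 x' + p.2)).

Definition backproj_T n (g : 'rV[R]_n * R -> R[i]) (x : 'rV[R]_n * R) : R[i] :=
  integral_rV (fun a => g (a, - dotv x.1 a + x.2)).

(* The operator I_2^alpha on Phi is defined through its Fourier transform:
   I_2^alpha f is the element g of Phi with F[g](y) = |y_m|^(-alpha) F[f](y). *)
Definition riesz2 n (alpha : R[i]) (f : 'rV[R]_n * R -> R[i]) :
    'rV[R]_n * R -> R[i] :=
  xget (fun=> 0) [set g | Phi g /\
    forall y, fourier g y = cpowR `|y.2| (- alpha) * fourier f y].

End Functions.

(* Main.v *)
(* Write f = F psi with psi in Psi, and let P and Q be the Fourier transforms
   in the last variable and in the first n = m - 1 variables, so that
   F = P Q = Q P.  Fubini and Fourier inversion in x' give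
     R_T f = (2 pi)^n P D psi,   where (D psi)(a, s) = psi(-s a, s).
   Elements of Psi are flat on s = 0, hence stay in Psi after division by s;
   this is why D and the multiplications by |s|^z preserve Psi.  As
   Q Q = (2 pi)^n (x' |-> -x'), the function (2 pi)^n D psi is Q chi for
   chi = (2 pi)^(-n) Q Q Q D psi, so that R_T f = F chi lies in Phi.  The
   backprojection is R_T at (-x', x_m), and the substitution v |-> -s v gives
   chi (s x', s) = |s|^(-n) (Q psi)(x', s), whence
     R~_T I_2^beta R_T f = (2 pi)^n F (|s|^(-beta - n) psi),
   and the theorem follows since I_2^alpha acts on the symbol as
   multiplication by |s|^(-alpha). *)
From Pilot Require Import Defs.
From HB Require Import structures.
From mathcomp Require Import all_boot all_order all_algebra.
From mathcomp Require Import complex ring.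
From mathcomp Require Import all_classical all_reals all_analysis.
From mathcomp Require Import measurable_realfun.
Import Order.TTheory GRing.Theory Num.Theory.
Import numFieldNormedType.Exports.
(* Again, because the analysis library shadows [basis]. *)
Import Pilot.Defs.
Local Open Scope classical_set_scope.
Local Open Scope ring_scope.
Local Open Scope complex_scope.

Set Implicit Arguments.
Unset Strict Implicit.
Unset Printing Implicit Defensive.

(** * Complex-valued derivatives and integrals *)

(** Flatness on s = 0 is what keeps every operator inside one class. Multiplying psi(- s a, s) by
    a_i, or differentiating it in s, produces a factor a_i, which for fixed x' = - s a blows up as s
    tends to 0; it amounts to a division by s, harmless on Psi. Psi is defined by pure derivatives
    in s, whereas these divisions are applied to derivatives in x' as well, so mixed partial
    derivatives must be known to commute; this is read off from the Fourier transform in s, which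
    turns one of the two derivatives into a multiplication.

    [riesz2] chooses a function through its Fourier transform, so computing it requires F to be
    injective on Phi; this comes from F F, which is a constant times the reflection.

    Fourier inversion needs a regularization only on the line; higher dimensions are reached by
    peeling off coordinates. Every use of Fubini rests on domination by a product of one-variable
    weights, which the same peeling respects. *)

Section ComplexBasics.
Context {R : realType}.
Implicit Types (z w : R[i]) (t : R).
Local Notation Re := complex.Re.
Local Notation Im := complex.Im.
Local Notation normc := Normc.normc.

Lemma complex_ext z w : Re z = Re w -> Im z = Im w -> z = w.
Proof. by case: z w => [a b] [c d] /= -> ->. Qed.

Lemma ReD z w : Re (z + w) = Re z + Re w. Proof. by case: z w => [??] []. Qed.
Lemma ImD z w : Im (z + w) = Im z + Im w. Proof. by case: z w => [??] []. Qed.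
Lemma ReN z : Re (- z) = - Re z. Proof. by case: z. Qed.
Lemma ImN z : Im (- z) = - Im z. Proof. by case: z. Qed.
Lemma ReM z w : Re (z * w) = Re z * Re w - Im z * Im w.
Proof. by case: z w => [??] []. Qed.
Lemma ImM z w : Im (z * w) = Re z * Im w + Im z * Re w.
Proof. by case: z w => [??] []. Qed.

Definition reimE := (ReD, ImD, ReN, ImN, ReM, ImM).

Lemma normcE z : normc z = Num.sqrt (Re z ^+ 2 + Im z ^+ 2).
Proof. by case: z. Qed.

Lemma normc_ge0 z : 0 <= normc z.
Proof. by rewrite normcE sqrtr_ge0. Qed.

Lemma normc_Re z : `|Re z| <= normc z.
Proof.
by rewrite normcE -sqrtr_sqr ler_wsqrtr// lerDl sqr_ge0.
Qed.

Lemma normc_Im z : `|Im z| <= normc z.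
Proof.
by rewrite normcE -sqrtr_sqr ler_wsqrtr// lerDr sqr_ge0.
Qed.

Lemma normc_real t : normc t%:C = `|t|.
Proof. by rewrite normcE/= expr0n/= addr0 sqrtr_sqr. Qed.

Lemma normc_le z : normc z <= `|Re z| + `|Im z|.
Proof.
rewrite normcE -[leRHS]ger0_norm ?addr_ge0// -sqrtr_sqr ler_wsqrtr//.
by rewrite sqrrD !real_normK ?num_real// addrAC lerDl mulrn_wge0.
Qed.

Lemma normc_expi t : normc (expi t) = 1.
Proof. by rewrite normcE/= cos2Dsin2 sqrtr1. Qed.

Lemma expiD s t : expi (s + t) = expi s * expi t.
Proof.
by apply: complex_ext; rewrite reimE/= ?cosD ?sinD; ring.
Qed.

Lemma expi0 : expi 0 = 1 :> R[i].
Proof. by rewrite /expi cos0 sin0. Qed.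

End ComplexBasics.

Section HasDerivative.
Context {R : realType}.
Local Notation Re := complex.Re.
Local Notation Im := complex.Im.
Local Notation normc := Normc.normc.

(** Relational form of the componentwise [partial]: it records existence and value together, so that
    product and chain rules compose without separate derivability goals. *)
Definition hasd {V : normedModType R} (v : V) (f : V -> R[i]) (x : V) (l : R[i]) :=
  is_derive x v (fun z => Re (f z)) (Re l) /\
  is_derive x v (fun z => Im (f z)) (Im l).

Context {V : normedModType R}.
Implicit Types (f g : V -> R[i]) (x v : V).

Lemma hasd_cst v (c : R[i]) x : hasd v (cst c) x 0.
Proof. by split; exact: is_derive_cst. Qed.

Lemma hasdD v f g x a b : hasd v f x a -> hasd v g x b ->
  hasd v (fun z => f z + g z) x (a + b).
Proof.
move=> [f1 f2] [g1 g2]; split.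
  rewrite ReD (_ : (fun z => _) = (fun z => Re (f z)) + (fun z => Re (g z))).
    exact: is_deriveD.
  by apply/funext => z /=; rewrite ReD.
rewrite ImD (_ : (fun z => _) = (fun z => Im (f z)) + (fun z => Im (g z))).
  exact: is_deriveD.
by apply/funext => z /=; rewrite ImD.
Qed.

Lemma hasdM v f g x a b : hasd v f x a -> hasd v g x b ->
  hasd v (fun z => f z * g z) x (a * g x + f x * b).
Proof.
move=> [f1 f2] [g1 g2]; split.
  rewrite (_ : (fun z => _) = (fun z => Re (f z)) * (fun z => Re (g z))
     - (fun z => Im (f z)) * (fun z => Im (g z))); last first.
    by apply/funext => z /=; rewrite ReM.
  apply: is_derive_eq; rewrite ReD !ReM /GRing.scale/=; ring.
rewrite (_ : (fun z => _) = (fun z => Re (f z)) * (fun z => Im (g z))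
     + (fun z => Im (f z)) * (fun z => Re (g z))); last first.
  by apply/funext => z /=; rewrite ImM.
apply: is_derive_eq; rewrite ImD !ImM /GRing.scale/=; ring.
Qed.

Lemma hasdZ v f x a (c : R[i]) : hasd v f x a ->
  hasd v (fun z => c * f z) x (c * a).
Proof. by move=> /(hasdM (hasd_cst v c x)); rewrite mul0r add0r. Qed.

Lemma hasd_real v (f : V -> R) x (a : R) : is_derive x v f a ->
  hasd v (fun z => (f z)%:C) x a%:C.
Proof. by move=> fa; split => //; exact: is_derive_cst. Qed.

(** Both sides have the same difference quotient in h. This reduces directional derivatives to
    one-variable calculus. *)
Lemma is_derive_line (U : normedModType R) v (f : V -> U) x t a :
  is_derive (t : R^o) 1 (fun s : R => f (x + s *: v)) a <->
  is_derive (x + t *: v) v f a.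
Proof.
have E : (fun h : R => h^-1 *: (((fun s : R => f (x + s *: v)) \o
             shift (t : R^o)) (h *: (1 : R^o)) - f (x + t *: v))) =
         (fun h : R => h^-1 *: ((f \o shift (x + t *: v)) (h *: v) - f (x + t *: v))).
  apply/funext => h /=; congr (_ *: (f _ - _)).
  by rewrite [h *: 1]mulr1 scalerDl addrCA.
by split=> -[d1 d2]; split; move: d1 d2; rewrite /derivable /derive E.
Qed.

Lemma hasd_line v f x t a :
  hasd (1 : R^o) (fun s : R => f (x + s *: v)) t a <-> hasd v f (x + t *: v) a.
Proof.
by split=> -[d1 d2]; split;
  [exact/(is_derive_line _ (fun z => Re (f z)))
  |exact/(is_derive_line _ (fun z => Im (f z)))
  |exact/(is_derive_line _ (fun z => Re (f z)))
  |exact/(is_derive_line _ (fun z => Im (f z)))].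
Qed.

Lemma is_derive1_comp (h : V -> R) (phi : R -> R) x v a b :
  is_derive x v h a -> is_derive (h x) 1 phi b ->
  is_derive x v (fun z => phi (h z)) (a * b).
Proof.
move=> ha hb; have x0 : x + 0 *: v = x by rewrite scale0r addr0.
rewrite -x0; apply/is_derive_line; rewrite mulrC.
apply: (@is_derive1_comp R phi (fun s : R => h (x + s *: v))).
  by rewrite /= x0.
by apply/is_derive_line; rewrite x0.
Qed.

Lemma hasd_expi v (h : V -> R) x a : is_derive x v h a ->
  hasd v (fun z => expi (h z)) x ('i * a%:C * expi (h x)).
Proof.
move=> ha; split.
  apply: (is_derive_eq (is_derive1_comp ha (is_derive_cos _))).
  by rewrite !reimE/=; ring.
apply: (is_derive_eq (is_derive1_comp ha (is_derive_sin _))).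
by rewrite !reimE/=; ring.
Qed.

End HasDerivative.

Section ComplexIntegral.
Context {R : realType} d (T : measurableType d) (mu : {measure set T -> \bar R}).
Local Notation Re := complex.Re.
Local Notation Im := complex.Im.
Local Notation normc := Normc.normc.
Implicit Types (f g : T -> R[i]).

Definition cmeasurable f :=
  measurable_fun setT (fun x => Re (f x)) /\ measurable_fun setT (fun x => Im (f x)).

Definition cintegrable f :=
  mu.-integrable setT (EFin \o (fun x => Re (f x))) /\
  mu.-integrable setT (EFin \o (fun x => Im (f x))).

Lemma cintegrable_dominated f (g : T -> R) : cmeasurable f ->
  mu.-integrable setT (EFin \o g) -> (forall x, normc (f x) <= g x) ->
  cintegrable f.
Proof.
move=> [mf1 mf2] ig fg; split; apply: le_integrable ig => //=.
- exact/measurable_EFinP.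
- by move=> x _; rewrite lee_fin (le_trans (normc_Re _))// (le_trans (fg x))// ler_norm.
- exact/measurable_EFinP.
- by move=> x _; rewrite lee_fin (le_trans (normc_Im _))// (le_trans (fg x))// ler_norm.
Qed.

Lemma eq_cint f g : f =1 g -> complex_integral mu f = complex_integral mu g.
Proof. by move=> /funext ->. Qed.

Lemma cintD f g : cintegrable f -> cintegrable g ->
  complex_integral mu (fun x => f x + g x) = complex_integral mu f + complex_integral mu g.
Proof.
move=> [f1 f2] [g1 g2]; apply: complex_ext; rewrite reimE/= -RintegralD//.
  by apply: eq_Rintegral => x _; rewrite ReD.
by apply: eq_Rintegral => x _; rewrite ImD.
Qed.

Lemma cintZ (c : R[i]) f : cintegrable f ->
  complex_integral mu (fun x => c * f x) = c * complex_integral mu f.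
Proof.
move=> [f1 f2].
have iZ (k : R) (h : T -> R) : mu.-integrable setT (EFin \o h) ->
    mu.-integrable setT (EFin \o (fun x => k * h x)).
  by move=> ih; have := integrableZl measurableT k ih; apply: eq_integrable.
apply: complex_ext; rewrite reimE/= -!RintegralZl//.
  rewrite -RintegralB//; [|exact: iZ..].
  by apply: eq_Rintegral => x _; rewrite ReM.
rewrite -RintegralD//; [|exact: iZ..].
by apply: eq_Rintegral => x _; rewrite ImM.
Qed.

(** Real and imaginary parts are estimated separately, whence the factor 2; later only boundedness
    matters. *)
Lemma normc_cint_le f (g : T -> R) : cintegrable f ->
  mu.-integrable setT (EFin \o g) -> (forall x, normc (f x) <= g x) ->
  normc (complex_integral mu f) <= 2 * \int[mu]_x g x.
Proof.
move=> [f1 f2] ig fg; apply: (le_trans (normc_le _)).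
rewrite mulr_natl mulr2n lerD//= (le_trans (le_normr_Rintegral _ _))//;
  apply: le_Rintegral => //.
- exact: integrable_norm.
- by move=> x _; rewrite (le_trans (normc_Re _)).
- exact: integrable_norm.
- by move=> x _; rewrite (le_trans (normc_Im _)).
Qed.

Lemma cint_dominated_cvg (f_ : nat -> T -> R[i]) f (g : T -> R) :
  (forall n, cmeasurable (f_ n)) -> cmeasurable f ->
  mu.-integrable setT (EFin \o g) ->
  (forall n x, normc (f_ n x) <= g x) ->
  (forall x, Re (f_ n x) @[n --> \oo] --> Re (f x)) ->
  (forall x, Im (f_ n x) @[n --> \oo] --> Im (f x)) ->
  Re (complex_integral mu (f_ n)) @[n --> \oo] --> Re (complex_integral mu f) /\
  Im (complex_integral mu (f_ n)) @[n --> \oo] --> Im (complex_integral mu f).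
Proof.
move=> mf_ mf ig fg cRe cIm; split => /=.
- have [|||||if_ _ cv] := @dominated_convergence _ _ _ mu setT measurableT
    (fun n x => (Re (f_ n x))%:E) (fun x => (Re (f x))%:E) (EFin \o g).
  + by move=> n; apply/measurable_EFinP; case: (mf_ n).
  + by apply/measurable_EFinP; case: mf.
  + by apply: aeW => x _; apply: cvg_EFin; [exact: nearW|exact: cRe].
  + by [].
  + by apply: aeW => x n _; rewrite lee_fin (le_trans (normc_Re _)).
  + apply: fine_cvg; rewrite fineK//; exact: integrable_fin_num.
- have [|||||if_ _ cv] := @dominated_convergence _ _ _ mu setT measurableT
    (fun n x => (Im (f_ n x))%:E) (fun x => (Im (f x))%:E) (EFin \o g).
  + by move=> n; apply/measurable_EFinP; case: (mf_ n).
  + by apply/measurable_EFinP; case: mf.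
  + by apply: aeW => x _; apply: cvg_EFin; [exact: nearW|exact: cIm].
  + by [].
  + by apply: aeW => x n _; rewrite lee_fin (le_trans (normc_Im _)).
  + apply: fine_cvg; rewrite fineK//; exact: integrable_fin_num.
Qed.

Lemma is_derive_Rintegral (f f' : R -> T -> R) (g : T -> R) (a : R) :
  (forall u, mu.-integrable setT (EFin \o f u)) ->
  mu.-integrable setT (EFin \o g) ->
  (forall (u : R) x, is_derive u 1 (f ^~ x) (f' u x)) ->
  (forall u x, `|f' u x| <= g x) ->
  is_derive a 1 (fun u => \int[mu]_x f u x) (\int[mu]_x f' a x).
Proof.
move=> fi gi fd fg.
have E u x : partial1of2 f u x = f' u x.
  by rewrite partial1of2E; apply: derive_val.
(* The bounds hold for all u, so any interval around a serves. *)
have aI : a \in `](a - 1), (a + 1)[ by rewrite in_itv/= ltrBlDr !ltrDl ltr01.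
have g0 x : 0 <= g x by apply: le_trans (fg a x).
have D := @derivable_under_integral _ _ _ mu f setT measurableT a (a - 1) (a + 1) aI
  (fun u _ => fi u) (fun u x _ _ => @ex_derive _ _ _ _ _ _ _ (fd u x)) g g0 gi.
have D' := @differentiation_under_integral _ _ _ mu f setT measurableT a (a - 1) (a + 1) aI
  (fun u _ => fi u) (fun u x _ _ => @ex_derive _ _ _ _ _ _ _ (fd u x)) g g0 gi.
split; first by apply: D => u x _ _; rewrite E.
rewrite -derive1E D'; last by move=> u x _ _; rewrite E.
by apply: eq_Rintegral => x _; rewrite E.
Qed.

Lemma hasd_cint (f f' : R -> T -> R[i]) (g : T -> R) (a : R) :
  (forall u, cintegrable (f u)) ->
  mu.-integrable setT (EFin \o g) ->
  (forall u x, hasd (1 : R^o) (f ^~ x) u (f' u x)) ->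
  (forall u x, normc (f' u x) <= g x) ->
  hasd (1 : R^o) (fun u => complex_integral mu (f u)) a (complex_integral mu (f' a)).
Proof.
move=> fi gi fd fg; split => /=.
  apply: (@is_derive_Rintegral (fun u x => Re (f u x)) (fun u x => Re (f' u x)) g) => //.
  - by move=> u; case: (fi u).
  - by move=> u x; case: (fd u x).
  - by move=> u x; rewrite (le_trans (normc_Re _)).
apply: (@is_derive_Rintegral (fun u x => Im (f u x)) (fun u x => Im (f' u x)) g) => //.
- by move=> u; case: (fi u).
- by move=> u x; case: (fd u x).
- by move=> u x; rewrite (le_trans (normc_Im _)).
Qed.

End ComplexIntegral.

(** * Fubini's theorem for complex integrands *)

Section ComplexFubini.
Context {R : realType} d1 d2 (T1 : measurableType d1) (T2 : measurableType d2).
Variable m1 : {sigma_finite_measure set T1 -> \bar R}.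
Variable m2 : {sigma_finite_measure set T2 -> \bar R}.
Local Open Scope ereal_scope.
Local Notation Re := complex.Re.
Local Notation Im := complex.Im.

(** The inner real integral is [fine] of the extended one, which is finite for almost every x; the
    two iterated integrals therefore agree through an almost-everywhere equality. *)
Lemma Rintegral_fubini1 (f : T1 * T2 -> R) :
  (m1 \x m2).-integrable setT (EFin \o f) ->
  (\int[m1 \x m2]_z f z = \int[m1]_x (\int[m2]_y f (x, y)))%R.
Proof.
move=> fi; rewrite /Rintegral -integral12_prod_meas1//; congr fine.
have mF := measurable_fubini_F fi.
apply: ae_eq_integral => //; first exact/measurable_EFinP/measurableT_comp.
apply: filterS (ae_integrable1 fi) => x /= ix _.
by rewrite fineK//; exact: integrable_fin_num.
Qed.

Lemma Rintegral_fubini2 (f : T1 * T2 -> R) :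
  (m1 \x m2).-integrable setT (EFin \o f) ->
  (\int[m1 \x m2]_z f z = \int[m2]_y (\int[m1]_x f (x, y)))%R.
Proof.
move=> fi; rewrite /Rintegral -integral21_prod_meas1//; congr fine.
have mF := measurable_fubini_G fi.
apply: ae_eq_integral => //; first exact/measurable_EFinP/measurableT_comp.
apply: filterS (ae_integrable2 fi) => x /= ix _.
by rewrite fineK//; exact: integrable_fin_num.
Qed.

Lemma cint_fubini1 (f : T1 * T2 -> R[i]) : cintegrable (m1 \x m2) f ->
  complex_integral (m1 \x m2) f =
  complex_integral m1 (fun x => complex_integral m2 (fun y => f (x, y))).
Proof.
by move=> [f1 f2]; rewrite /complex_integral/= !Rintegral_fubini1.
Qed.

Lemma cint_fubini2 (f : T1 * T2 -> R[i]) : cintegrable (m1 \x m2) f ->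
  complex_integral (m1 \x m2) f =
  complex_integral m2 (fun y => complex_integral m1 (fun x => f (x, y))).
Proof.
by move=> [f1 f2]; rewrite /complex_integral/= !Rintegral_fubini2.
Qed.

Lemma cmeasurable_fubini2 (f : T1 * T2 -> R[i]) : cintegrable (m1 \x m2) f ->
  cmeasurable (fun y => complex_integral m1 (fun x => f (x, y))).
Proof.
by move=> [f1 f2]; split;
  [apply: (measurableT_comp _ (measurable_fubini_G f1))
  |apply: (measurableT_comp _ (measurable_fubini_G f2))].
Qed.

End ComplexFubini.

(** * Measurability and integration on tuples *)

(** Rounding t down to a multiple of 1/(k+1) gives functions [h k] that converge pointwise to f by
    continuity in t. Each is measurable because on each of the countably many cells it depends on x
    alone. *)
Lemma measurable_fun_caratheodory d (T : measurableType d) (R : realType)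
    (f : T * measurableTypeR R -> R) :
  (forall t, measurable_fun setT (fun x => f (x, t))) ->
  (forall x, continuous (fun t : R => f (x, t))) ->
  measurable_fun setT f.
Proof.
move=> mf cf.
pose h (k : nat) (p : T * measurableTypeR R) : R :=
  f (p.1, (Num.floor (k.+1%:R * (p.2 : R)))%:~R / k.+1%:R).
apply: (@measurable_fun_cvg _ _ _ _ h).
- move=> k _ B mB; rewrite setTI.
  have -> : h k @^-1` B = \bigcup_(j : int)
      (((fun x => f (x, j%:~R / k.+1%:R)) @^-1` B) `*`
       [set` `[j%:~R / k.+1%:R, (j + 1)%:~R / k.+1%:R[ ]).
    apply/seteqP; split=> [[x t] /= Bh|[x t] [j _ [/= Bf]]].
      exists (Num.floor (k.+1%:R * (t : R))) => //=; split => //=.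
      rewrite in_itv/= ler_pdivrMr// ltr_pdivlMr// mulrC.
      by rewrite floor_le mulrC floorD1_gt.
    rewrite in_itv/= ler_pdivrMr// ltr_pdivlMr// => /andP[t1 t2].
    rewrite /h/= (@floor_def _ _ j)//.
    by rewrite mulrC t1.
  apply: countable_bigcupT_measurable => // j.
  apply: measurableX => //; rewrite -[X in measurable X]setTI.
  exact: mf.
- move=> [x t] _; rewrite /h/=.
  apply: (@cvg_comp _ _ _ (fun k : nat => (Num.floor (k.+1%:R * (t : R)))%:~R / k.+1%:R)
     (fun t : R => f (x, t)) _ (nbhs (t : R))); last exact: cf.
  apply: (@squeeze_cvgr _ _ _ _ (fun k : nat => (t : R) - k.+1%:R^-1) (fun=> (t : R))).
  + near=> k; rewrite ler_pdivrMr// [X in _ && (_ <= X)]mulrC floor_le andbT.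
    rewrite ler_pdivlMr// mulrBl mulVf// lerBlDr mulrC ltW//.
    by have := floorD1_gt (k.+1%:R * (t : R)); rewrite intrD.
  + rewrite -[X in _ --> X]subr0; apply: cvgB; first exact: cvg_cst.
    exact: cvg_harmonic.
  + exact: cvg_cst.
Unshelve. all: by end_near. Qed.

Lemma continuous_pairT (T U V : topologicalType) (f : T -> U) (g : T -> V) :
  continuous f -> continuous g -> continuous (fun x => (f x, g x)).
Proof.
by move=> cf cg x; apply: (@cvg_pair _ _ _ _ (nbhs (f x)) (nbhs (g x)));
  [exact: cf|exact: cg].
Qed.

Section Consrow.
Context {R : realType}.

Definition consrow n (t : R) (v : 'rV[R]_n) : 'rV[R]_n.+1 :=
  \row_i (if unlift ord0 i is Some j then v 0 j else t).

Lemma consrow0 n t (v : 'rV[R]_n) : consrow t v 0 ord0 = t.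
Proof. by rewrite mxE unlift_none. Qed.

Lemma consrow_lift n t (v : 'rV[R]_n) j : consrow t v 0 (lift ord0 j) = v 0 j.
Proof. by rewrite mxE liftK. Qed.

Lemma rV_of_tuple_cons n (p : measurableTypeR R * n.-tuple (measurableTypeR R)) :
  rV_of_tuple (cons_pair p) = consrow p.1 (rV_of_tuple p.2).
Proof.
apply/rowP => i; case: (unliftP ord0 i) => [j|] ->.
  by rewrite consrow_lift !mxE tnthS.
by rewrite consrow0 mxE tnth0.
Qed.

Lemma consrow_rV n (x : 'rV[R]_n.+1) :
  x = consrow (x 0 ord0) (\row_j x 0 (lift ord0 j)).
Proof.
apply/rowP => i; case: (unliftP ord0 i) => [j|] ->.
  by rewrite consrow_lift mxE.
by rewrite consrow0.
Qed.

Lemma dotv_consrow n s t (u v : 'rV[R]_n) :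
  dotv (consrow s u) (consrow t v) = s * t + dotv u v.
Proof.
rewrite /dotv big_ord_recl !consrow0; congr (_ + _).
by apply: eq_bigr => i _; rewrite !consrow_lift.
Qed.

Lemma row_continuous (T : topologicalType) n (f : T -> 'rV[R]_n) :
  (forall i, continuous (fun x => f x 0 i)) -> continuous f.
Proof.
move=> cf x; apply/cvg_ballP => e e0.
have : \forall y \near x, forall i, ball (f x 0 i) e (f y 0 i).
  by apply: filter_forall => i; move/cvg_ballP: (cf i x); exact.
by apply: filterS => y fy; split=> // i j; rewrite ord1.
Qed.

Lemma consrow_continuous n :
  continuous (fun p : 'rV[R]_n * R => consrow p.2 p.1).
Proof.
apply: row_continuous => i; case: (unliftP ord0 i) => [j|] ->.
  under eq_fun do rewrite consrow_lift.
  move=> p; apply: (@continuous_comp _ _ _ fst (fun v : 'rV_n => v 0 j)).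
    exact: cvg_fst.
  exact: coord_continuous.
under eq_fun do rewrite consrow0.
by move=> p; exact: cvg_snd.
Qed.

End Consrow.

Section TupleMeasurable.
Context {R : realType}.

(* Peels off one coordinate at a time, since the sigma-algebra on tuples is
   generated by the coordinates and not by the open sets of 'rV[R]_n. *)
Lemma measurable_continuous_rV n (f : 'rV[R]_n * R -> R) : continuous f ->
  measurable_fun setT (fun p : n.-tuple (measurableTypeR R) * measurableTypeR R =>
    f (rV_of_tuple p.1, p.2)).
Proof.
elim: n f => [|n ih] f cf; apply: measurable_fun_caratheodory => [t|x] //=.
- rewrite (_ : (fun x => _) = cst (f (rV_of_tuple [tuple], t))).
    exact: measurable_cst.
  by apply/funext => x /=; rewrite (tuple0 x).
- move=> t; apply: continuous_comp; last exact: cf.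
  by apply: continuous_pairT => //; [by move=> ?; exact: cvg_cst|by move=> ?; exact: cvg_id].
- pose g (p : 'rV[R]_n * R) := f (consrow p.2 p.1, t).
  have cg : continuous g.
    move=> p; apply: continuous_comp; last exact: cf.
    by apply: continuous_pairT => //; [exact: consrow_continuous|by move=> ?; exact: cvg_cst].
  have := ih g cg; set G := (G in measurable_fun _ G) => mG.
  rewrite (_ : (fun x => _) = G \o
      (fun x : n.+1.-tuple (measurableTypeR R) => ([tuple of behead x], thead x))).
    apply: measurableT_comp => //.
    apply/measurable_fun_pairP; split => /=; first exact: measurable_behead.
    exact: measurable_tnth.
  apply/funext => x /=; rewrite /G/g/=; congr (f (_, _)).
  have -> : x = cons_pair (thead x, [tuple of behead x]) by rewrite {1}[x]tuple_eta.
  rewrite rV_of_tuple_cons/=; congr (consrow _ (rV_of_tuple _)).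
  by apply: val_inj.
- move=> t; apply: continuous_comp; last exact: cf.
  by apply: continuous_pairT => //; [by move=> ?; exact: cvg_cst|by move=> ?; exact: cvg_id].
Qed.

End TupleMeasurable.

(** * Sigma-finiteness of Lebesgue measure on tuples *)

Lemma sigma_finite_product d1 d2 (T1 : measurableType d1) (T2 : measurableType d2)
    (R : realType) (m1 : {sigma_finite_measure set T1 -> \bar R})
    (m2 : {sigma_finite_measure set T2 -> \bar R}) :
  sigma_finite setT (m1 \x m2)%E.
Proof.
have /sigma_finiteP[F [TF ndF Foo]] := sigma_finiteT m1.
have /sigma_finiteP[G [TG ndG Goo]] := sigma_finiteT m2.
exists (fun n => F n `*` G n) => [|k].
  rewrite -setXTT TF TG; apply/seteqP; split => -[x y] /=; last first.
    by move=> [n _ []/= ? ?]; split; exists n.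
  (* Both exhaustions increase, so the larger index works for both coordinates. *)
  move=> [[n _ Fnx] [k _ Gky]]; exists (maxn n k) => //; split.
    by move: x Fnx; exact/subsetPset/ndF/leq_maxl.
  by move: y Gky; exact/subsetPset/ndG/leq_maxr.
have [? ?] := Foo k; have [? ?] := Goo k; split; first exact: measurableX.
by rewrite product_measure1E// lte_mul_pinfty// ge0_fin_numE.
Qed.

Section SigmaFiniteTuple.
Context {R : realType}.

Lemma measurable_cons_pair n : measurable_fun setT (@cons_pair R n).
Proof. exact: measurable_cons. Qed.

Definition uncons_pair n (x : n.+1.-tuple (measurableTypeR R)) :
  measurableTypeR R * n.-tuple (measurableTypeR R) := (thead x, [tuple of behead x]).

Lemma measurable_uncons_pair n : measurable_fun setT (@uncons_pair n).
Proof.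
apply/measurable_fun_pairP; split => /=; first exact: measurable_tnth.
exact: measurable_behead.
Qed.

Lemma cons_pairK n : cancel (@cons_pair R n) (@uncons_pair n).
Proof. by move=> [t v]; rewrite /uncons_pair/= theadE; congr pair; apply: val_inj. Qed.

(** Existential, because the induction must hand a sigma-finite structure in dimension n to the
    product measure that defines dimension n + 1. *)
Lemma sigma_finite_lebesgue_tuple n :
  exists mu : {sigma_finite_measure set (n.-tuple (measurableTypeR R)) -> \bar R},
    mu = lebesgue_tuple n :> (set _ -> \bar R).
Proof.
elim: n => [|n [mu muE]]; first by exists (\d_ [tuple] : {sigma_finite_measure set _ -> \bar R}).
have [G GT Gfin] := sigma_finite_product (@lebesgue_measure R) mu.
(* [lebesgue_tuple] is built from [\x^], the other iterated form of the product; uniqueness of the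
   product measure identifies it with [\x]. *)
have E X : measurable X -> (lebesgue_measure \x mu)%E X = (lebesgue_measure \x^ mu)%E X.
  move=> mX; apply: product_measure_unique => //= A B mA mB.
  by rewrite product_measure2E.
have sf : sigma_finite setT (lebesgue_tuple n.+1 : set (n.+1.-tuple (measurableTypeR R)) -> \bar R).
  exists (fun k => @uncons_pair n @^-1` G k).
    by rewrite -preimage_bigcup -GT preimage_setT.
  move=> k; have [mG Gk] := Gfin k; split.
    by rewrite -[X in measurable X]setTI; exact: measurable_uncons_pair.
  rewrite /= /pushforward -comp_preimage.
  rewrite (_ : uncons_pair (n:=n) \o cons_pair (n:=n) = id); last first.
    by apply/funext => x /=; rewrite cons_pairK.
  by rewrite preimage_id -muE -E.
pose M := @Measure_isSigmaFinite.Build _ _ _ (lebesgue_tuple n.+1) sf.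
pose nu : {sigma_finite_measure set _ -> \bar R} := HB.pack (lebesgue_tuple n.+1) M.
by exists nu.
Qed.

HB.instance Definition _ n := @Measure_isSigmaFinite.Build _ _ _ (@lebesgue_tuple R n)
  (let: ex_intro mu e := sigma_finite_lebesgue_tuple n in
   eq_ind _ (fun m => sigma_finite setT m) (@sigma_finiteT _ _ _ mu) _ e).

End SigmaFiniteTuple.

Section TupleIntegral.
Context {R : realType}.
Local Open Scope ereal_scope.

(** Change of variables for the image measure, followed by replacing [\x^] with [\x], the form to
    which Fubini is applied. *)
Lemma ge0_integral_tuple_cons n (f : n.+1.-tuple (measurableTypeR R) -> \bar R) :
  measurable_fun setT f -> (forall x, 0 <= f x) ->
  \int[lebesgue_tuple n.+1]_x f x =
  \int[lebesgue_measure \x lebesgue_tuple n]_p f (cons_pair p).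
Proof.
move=> mf f0.
transitivity (\int[lebesgue_measure \x^ lebesgue_tuple n]_p f (cons_pair p)).
  have := @ge0_integral_pushforward _ _ _ _ _ _ (@measurable_cons_pair R n)
    (lebesgue_measure \x^ lebesgue_tuple n) setT f measurableT mf (fun x _ => f0 x).
  rewrite preimage_setT => <-.
  by [].
apply: eq_measure_integral => A mA _; apply/esym.
apply: product_measure_unique => //= X Y mX mY.
by rewrite product_measure2E.
Qed.

Lemma integral_tuple_cons n (f : n.+1.-tuple (measurableTypeR R) -> \bar R) :
  measurable_fun setT f ->
  \int[lebesgue_tuple n.+1]_x f x =
  \int[lebesgue_measure \x lebesgue_tuple n]_p f (cons_pair p).
Proof.
move=> mf; rewrite [LHS]integralE [RHS]integralE; congr (_ - _).
  rewrite ge0_integral_tuple_cons//; last exact: measurable_funepos.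
  congr integral; apply: funext => p.
  exact: (esym (congr1 (@^~ p) (funepos_comp f (@cons_pair R n)))).
rewrite ge0_integral_tuple_cons//; last exact: measurable_funeneg.
congr integral; apply: funext => p.
exact: (esym (congr1 (@^~ p) (funeneg_comp f (@cons_pair R n)))).
Qed.

Lemma integrable_tuple_cons n (f : n.+1.-tuple (measurableTypeR R) -> \bar R) :
  measurable_fun setT f ->
  (lebesgue_measure \x lebesgue_tuple n).-integrable setT (f \o @cons_pair R n) ->
  (lebesgue_tuple n.+1).-integrable setT f.
Proof.
move=> mf /integrableP[_ foo]; apply/integrableP; split => //.
by rewrite ge0_integral_tuple_cons//; exact: measurableT_comp.
Qed.

(** By Tonelli the integral of the absolute value factors. *)
Lemma integrable_prodM d1 d2 (T1 : measurableType d1) (T2 : measurableType d2)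
    (m1 : {sigma_finite_measure set T1 -> \bar R})
    (m2 : {sigma_finite_measure set T2 -> \bar R}) (g1 : T1 -> R) (g2 : T2 -> R) :
  m1.-integrable setT (EFin \o g1) -> m2.-integrable setT (EFin \o g2) ->
  (m1 \x m2).-integrable setT (EFin \o (fun p => g1 p.1 * g2 p.2)%R).
Proof.
move=> /[dup] i1 /integrableP[/measurable_EFinP mg1 g1oo].
move=> /[dup] i2 /integrableP[/measurable_EFinP mg2 g2oo].
apply/integrable12ltyP => /=.
  by apply/measurable_EFinP; apply: measurable_funM; exact: measurableT_comp.
under eq_integral => x _.
  under eq_integral => y _ do rewrite normrM EFinM.
  rewrite ge0_integralZl//=; last exact/measurable_EFinP/measurableT_comp.
  over.
rewrite ge0_integralZr//=.
- by rewrite lte_mul_pinfty ?integral_ge0// ge0_fin_numE ?integral_ge0.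
- exact/measurable_EFinP/measurableT_comp.
- by apply: integral_ge0.
Qed.

End TupleIntegral.

(** * Integrable weights used for domination *)

Section Weights.
Context {R : realType}.

(** Dominating function in each real variable, of total mass pi; twice it is the Poisson kernel with
    parameter 1. *)
Definition weight (t : R) : R := (oneDsqr t)^-1.

Lemma weight_gt0 t : 0 < weight t.
Proof. by rewrite invr_gt0 (lt_le_trans ltr01 (oneDsqr_ge1 t)). Qed.

Lemma weight_le1 t : weight t <= 1.
Proof. exact: oneDsqrV_le1. Qed.

Lemma weight_continuous : continuous weight.
Proof. exact: continuous_oneDsqrV. Qed.

Lemma integral_weight :
  (\int[@lebesgue_measure R]_t (weight t)%:E = pi%:E)%E.
Proof.
rewrite (@ge0_symfun_integralT R weight).
- rewrite -set_itvcy integral0y_oneDsqr -EFinM; congr (_ %:E); by field.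
- by move=> x; exact/ltW/weight_gt0.
- exact: weight_continuous.
- by move=> x; rewrite /= /weight /oneDsqr sqrrN.
Qed.

Lemma integrable_weight : (@lebesgue_measure R).-integrable setT (EFin \o weight).
Proof.
apply/integrableP; split.
  by apply/measurable_EFinP; apply: continuous_measurable_fun; exact: weight_continuous.
under eq_integral do rewrite /= ger0_norm ?(ltW (weight_gt0 _))//.
by rewrite integral_weight ltry.
Qed.

(** A product over the coordinates, not a function of the norm, so that peeling off one coordinate
    splits it. *)
Definition rweight n (v : 'rV[R]_n) : R := \prod_i weight (v 0 i).

Lemma rweight_gt0 n (v : 'rV[R]_n) : 0 < rweight v.
Proof. by apply: prodr_gt0 => i _; exact: weight_gt0. Qed.

Lemma rweight_consrow n t (v : 'rV[R]_n) :
  rweight (consrow t v) = weight t * rweight v.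
Proof.
rewrite /rweight big_ord_recl consrow0; congr (_ * _).
by apply: eq_bigr => i _; rewrite consrow_lift.
Qed.

Lemma rweight_continuous n : continuous (@rweight n).
Proof.
move=> v; rewrite /rweight.
apply: (@cvg_big _ _ _ _ _ (@mul_continuous R) _ (nbhs v) _ _ _ (nbhs_filter v)) => i _.
apply: (@continuous_comp _ _ _ (fun v : 'rV_n => v 0 i) weight).
  exact: coord_continuous.
exact: weight_continuous.
Qed.

Lemma measurable_rV_slice n (f : 'rV[R]_n -> R) : continuous f ->
  measurable_fun setT (fun v : n.-tuple (measurableTypeR R) => f (rV_of_tuple v)).
Proof.
move=> cf.
have c1 : continuous (fun p : 'rV[R]_n * R => f p.1).
  by move=> p; apply: (@continuous_comp _ _ _ fst f); [exact: cvg_fst|exact: cf].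
have := measurable_continuous_rV c1; set G := (G in measurable_fun _ G) => mG.
rewrite (_ : (fun v => _) = G \o (fun v => (v, 0 : measurableTypeR R)))//.
by apply: measurableT_comp.
Qed.

Lemma integrable_rweight n :
  (lebesgue_tuple n).-integrable setT (EFin \o (fun v => rweight (rV_of_tuple v))).
Proof.
elim: n => [|n ih].
  rewrite (_ : _ \o _ = cst 1%:E); last first.
    by apply/funext => v /=; rewrite /rweight big_ord0.
  apply/integrableP; split => //=.
  by rewrite integral_cst//= normr1 mul1e diracT ltry.
apply: integrable_tuple_cons.
  by apply/measurable_EFinP; apply: measurable_rV_slice; exact: rweight_continuous.
have := integrable_prodM integrable_weight ih.
apply: eq_integrable => //= -[t v] _ /=.
by rewrite rV_of_tuple_cons rweight_consrow.
Qed.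

End Weights.

(** * Affine change of variable on the line *)

Section Affine.
Context {R : realType}.
Local Notation leb := (@lebesgue_measure R).
Variables (c d : R).
Hypothesis c0 : c != 0.

Let phi : measurableTypeR R -> measurableTypeR R := fun t => c * t + d.

Let mphi : measurable_fun setT phi.
Proof.
apply: (@continuous_measurable_fun R phi) => t.
by apply: cvgD; [apply: cvgM; [exact: cvg_cst|exact: cvg_id]|exact: cvg_cst].
Qed.

Let nrmc : {nonneg R} := NngNum (normr_ge0 c).

Let pushforward_phi : exists nu : {measure set (measurableTypeR R) -> \bar R},
  nu = pushforward leb phi :> (set _ -> \bar R).
Proof. by unshelve eexists (pushforward leb phi); first exact: mphi. Qed.

(** Lebesgue measure is determined by its values on the intervals ]a, b], whose preimages are again
    intervals, with length divided by |c|. *)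
Let affine_measure (A : set (measurableTypeR R)) : measurable A ->
  (leb A = `|c|%:E * pushforward leb phi A)%E.
Proof.
have [nu nuE] := pushforward_phi.
rewrite -nuE -[X in X%:E]/(nrmc%:num) -[RHS]/(mscale nrmc nu A).
apply: lebesgue_measure_unique.
move=> _ [[a b]] _ <-; transitivity (`|c|%:E * pushforward leb phi `]a, b])%E; last by rewrite -nuE.
rewrite /pushforward.
have [cgt0|cle0] := ltrP 0 c.
- have -> : phi @^-1` `]a, b] = `](a - d) / c, (b - d) / c]%classic.
    apply/seteqP; split=> t /=; rewrite !in_itv/= ltr_pdivrMr// ler_pdivlMr//;
      by rewrite ltrBlDr lerBrDr [t * c]mulrC.
  rewrite !lebesgue_measure_itv/= !lte_fin ltr_pM2r ?invr_gt0// ltrD2r.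
  case: ifP => _; last by rewrite mule0.
  by rewrite -!EFinD -EFinM gtr0_norm//; congr (_ %:E); field.
(* Orientation is reversed: the preimage contains its left endpoint instead of its right one, which
   does not affect its length. *)
- have {cle0} clt0 : c < 0 by rewrite lt_neqAle c0.
  have -> : phi @^-1` `]a, b] = `[(b - d) / c, (a - d) / c[%classic.
    apply/seteqP; split=> t /=; rewrite !in_itv/= ler_ndivrMr// ltr_ndivlMr//;
      by rewrite ltrBlDr lerBrDr [t * c]mulrC andbC.
  rewrite !lebesgue_measure_itv/= !lte_fin ltr_nM2r ?invr_lt0// ltrD2r.
  case: ifP => _; last by rewrite mule0.
  by rewrite -!EFinD -EFinM ltr0_norm//; congr (_ %:E); field.
Qed.

Lemma ge0_integral_affine (f : R -> \bar R) : measurable_fun setT f ->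
  (forall x, 0 <= f x)%E ->
  (\int[leb]_t f t = `|c|%:E * \int[leb]_t f (c * t + d)%R)%E.
Proof.
move=> mf f0; have [nu nuE] := pushforward_phi.
transitivity (\int[mscale nrmc nu]_t f t)%E.
  apply: eq_measure_integral => A mA _; have := affine_measure mA.
  by rewrite -nuE => H; exact: H.
rewrite ge0_integral_mscale//; congr (_ * _)%E; rewrite nuE.
by rewrite (ge0_integral_pushforward mphi)//.
Qed.

Lemma integrable_affine (f : R -> R) : leb.-integrable setT (EFin \o f) ->
  leb.-integrable setT (EFin \o (fun t => f (c * t + d))).
Proof.
move=> /integrableP[mf foo].
have mfp : measurable_fun setT (EFin \o (fun t => f (c * t + d))).
  exact: (measurableT_comp mf mphi).
apply/integrableP; split => //.
have mabs : measurable_fun setT (abse \o (EFin \o f)) by exact: measurableT_comp.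
move: foo; rewrite (ge0_integral_affine mabs)//= => foo.
rewrite ltNge; apply/negP; rewrite leye_eq => /eqP fy.
by move: foo; rewrite fy gt0_muley ?lte_fin ?normr_gt0.
Qed.

Lemma Rintegral_affine (f : R -> R) : leb.-integrable setT (EFin \o f) ->
  \int[leb]_t f t = `|c| * \int[leb]_t f (c * t + d).
Proof.
move=> fi; have fi' := integrable_affine fi; have mf := measurable_int _ fi.
rewrite {1}/Rintegral integralE.
rewrite (ge0_integral_affine (measurable_funepos mf))//.
rewrite (ge0_integral_affine (measurable_funeneg mf))//.
rewrite /Rintegral [in RHS]integralE.
set g := EFin \o (fun t => f (c * t + d)).
have -> : (g^\+)%E = fun t => ((EFin \o f)^\+ (c * t + d)%R)%E.
  exact: (funepos_comp (EFin \o f) (fun t => c * t + d)).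
have -> : (g^\-)%E = fun t => ((EFin \o f)^\- (c * t + d)%R)%E.
  exact: (funeneg_comp (EFin \o f) (fun t => c * t + d)).
have A := integrable_pos_fin_num measurableT fi'.
have B := integrable_neg_fin_num measurableT fi'.
have A' : (\int[leb]_t ((EFin \o f)^\+ (c * t + d)%R))%E \is a fin_num.
  move: A; rewrite -/g; congr (_ \is a fin_num).
  by congr integral; exact: (funepos_comp (EFin \o f) (fun t => c * t + d)).
have B' : (\int[leb]_t ((EFin \o f)^\- (c * t + d)%R))%E \is a fin_num.
  move: B; rewrite -/g; congr (_ \is a fin_num).
  by congr integral; exact: (funeneg_comp (EFin \o f) (fun t => c * t + d)).
by rewrite -(fineK A') -(fineK B') -!EFinM -!EFinB /= mulrBr.
Qed.

End Affine.

Section ComplexAffine.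
Context {R : realType}.
Local Notation leb := (@lebesgue_measure R).

Lemma cint_affine (c d : R) (f : R -> R[i]) : c != 0 -> cintegrable leb f ->
  complex_integral leb f = `|c|%:C * complex_integral leb (fun t => f (c * t + d)).
Proof.
move=> c0 [f1 f2]; apply: complex_ext; rewrite reimE/= mul0r ?subr0 ?addr0.
  exact: Rintegral_affine.
exact: Rintegral_affine.
Qed.

End ComplexAffine.

(** * Continuous functions dominated by the weights *)

Section Tame.
Context {R : realType}.
Local Notation Re := complex.Re.
Local Notation Im := complex.Im.
Local Notation normc := Normc.normc.
Local Notation leb := (@lebesgue_measure R).

Definition ccontinuous (T : topologicalType) (f : T -> R[i]) :=
  continuous (fun x => Re (f x)) /\ continuous (fun x => Im (f x)).

Lemma ccontinuous_comp (T U : topologicalType) (g : T -> U) (f : U -> R[i]) :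
  continuous g -> ccontinuous f -> ccontinuous (fun x => f (g x)).
Proof.
move=> cg [f1 f2]; split=> x.
  by apply: (@continuous_comp _ _ _ g (fun y => Re (f y))); [exact: cg|exact: f1].
by apply: (@continuous_comp _ _ _ g (fun y => Im (f y))); [exact: cg|exact: f2].
Qed.

Lemma ccontinuousM (T : topologicalType) (f g : T -> R[i]) :
  ccontinuous f -> ccontinuous g -> ccontinuous (fun x => f x * g x).
Proof.
move=> [f1 f2] [g1 g2]; split.
  rewrite (_ : (fun x => _) = fun x => Re (f x) * Re (g x) - Im (f x) * Im (g x)).
    by move=> x; apply: cvgB; apply: cvgM; [exact: f1|exact: g1|exact: f2|exact: g2].
  by apply/funext => x; rewrite ReM.
rewrite (_ : (fun x => _) = fun x => Re (f x) * Im (g x) + Im (f x) * Re (g x)).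
  by move=> x; apply: cvgD; apply: cvgM; [exact: f1|exact: g2|exact: f2|exact: g1].
by apply/funext => x; rewrite ImM.
Qed.

Lemma ccontinuous_expi (T : topologicalType) (h : T -> R) :
  continuous h -> ccontinuous (fun x => expi (h x)).
Proof.
move=> ch; split=> x.
  by apply: (@continuous_comp _ _ _ h cos); [exact: ch|exact: continuous_cos].
by apply: (@continuous_comp _ _ _ h sin); [exact: ch|exact: continuous_sin].
Qed.

Variable n : nat.
Implicit Types f : 'rV[R]_n * R -> R[i].

(** Enough for Fubini in both orders and for integrability of all slices, and stable under any
    continuous phase, such as the quadratic one arising from the Radon transform. *)
Definition tame f := ccontinuous f /\
  exists C : R, forall x, normc (f x) <= C * (rweight x.1 * weight x.2).

Lemma tame_expi f (h : 'rV[R]_n * R -> R) : continuous h -> tame f ->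
  tame (fun x => f x * expi (h x)).
Proof.
move=> ch [cf [C fC]]; split.
  by apply: ccontinuousM => //; exact: ccontinuous_expi.
by exists C => x; rewrite Normc.normcM normc_expi mulr1.
Qed.

Lemma cmeasurable_space f : ccontinuous f ->
  cmeasurable (fun p : n.-tuple (measurableTypeR R) * measurableTypeR R =>
    f (rV_of_tuple p.1, p.2)).
Proof.
move=> [f1 f2]; split.
  exact: (@measurable_continuous_rV _ _ (fun x => Re (f x))).
exact: (@measurable_continuous_rV _ _ (fun x => Im (f x))).
Qed.

Lemma cmeasurable_rV (g : 'rV[R]_n -> R[i]) : ccontinuous g ->
  cmeasurable (fun v : n.-tuple (measurableTypeR R) => g (rV_of_tuple v)).
Proof.
move=> [f1 f2]; split.
  exact: (@measurable_rV_slice _ _ (fun x => Re (g x))).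
exact: (@measurable_rV_slice _ _ (fun x => Im (g x))).
Qed.

Lemma cmeasurable_R (g : R -> R[i]) : ccontinuous g ->
  cmeasurable (g : measurableTypeR R -> R[i]).
Proof. by move=> [f1 f2]; split; exact: continuous_measurable_fun. Qed.

Lemma integrable_weightZ (C : R) :
  leb.-integrable setT (EFin \o (fun t => C * weight t)).
Proof.
by have := integrableZl measurableT C (@integrable_weight R); apply: eq_integrable.
Qed.

Lemma integrable_rweightZ (C : R) : (lebesgue_tuple n).-integrable setT
  (EFin \o (fun v => C * rweight (rV_of_tuple v))).
Proof.
by have := integrableZl measurableT C (@integrable_rweight R n); apply: eq_integrable.
Qed.

Lemma tame_integrable_space f : tame f ->
  cintegrable (lebesgue_tuple n \x leb)%E (fun p => f (rV_of_tuple p.1, p.2)).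
Proof.
move=> [cf [C fC]].
apply: (@cintegrable_dominated _ _ _ _ _
  (fun p : n.-tuple (measurableTypeR R) * measurableTypeR R =>
    C * (rweight (rV_of_tuple p.1) * weight p.2))) => //.
- exact: cmeasurable_space.
- have := integrableZl measurableT C
    (integrable_prodM (integrable_rweight n) (@integrable_weight R)).
  exact: eq_integrable.
Qed.

Lemma slice_continuous1 (s : R) : continuous (fun v : 'rV[R]_n => (v, s)).
Proof. by apply: continuous_pairT; [move=> v; exact: cvg_id|exact: cst_continuous]. Qed.

Lemma slice_continuous2 (v : 'rV[R]_n) : continuous (fun s : R => (v, s)).
Proof. by apply: continuous_pairT; [exact: cst_continuous|move=> t; exact: cvg_id]. Qed.

Lemma rweight_le1 (v : 'rV[R]_n) : rweight v <= 1.
Proof.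
apply: prodr_ile1 => i _; rewrite weight_le1 andbT; exact/ltW/weight_gt0.
Qed.

Lemma tame_bound f : tame f -> exists2 C : R, 0 <= C &
  forall x, [/\ normc (f x) <= C * (rweight x.1 * weight x.2),
    normc (f x) <= C * rweight x.1 & normc (f x) <= C * weight x.2].
Proof.
move=> [_ [C fC]]; have C0 : 0 <= C.
  have := le_trans (normc_ge0 _) (fC (0, 0)).
  by rewrite pmulr_lge0// mulr_gt0 ?rweight_gt0 ?weight_gt0.
exists C => // x; split=> //; apply: (le_trans (fC _)); apply: ler_wpM2l => //.
  by rewrite ler_piMr ?weight_le1// ltW// rweight_gt0.
by rewrite ler_piMl ?rweight_le1// ltW// weight_gt0.
Qed.

Lemma tame_integrable_rV f s : tame f ->
  cintegrable (lebesgue_tuple n) (fun v => f (rV_of_tuple v, s)).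
Proof.
move=> /[dup] tf [cf _]; have [C _ fC] := tame_bound tf.
apply: (@cintegrable_dominated _ _ _ _ _
  (fun v : n.-tuple (measurableTypeR R) => C * rweight (rV_of_tuple v))).
- exact: (cmeasurable_rV (ccontinuous_comp (@slice_continuous1 s) cf)).
- exact: integrable_rweightZ.
- by move=> v; have [] := fC (rV_of_tuple v, s).
Qed.

Lemma tame_integrable_R f v : tame f -> cintegrable leb (fun s => f (v, s)).
Proof.
move=> /[dup] tf [cf _]; have [C _ fC] := tame_bound tf.
apply: (@cintegrable_dominated _ _ _ _ _ (fun t : measurableTypeR R => C * weight t)).
- exact: (cmeasurable_R (ccontinuous_comp (@slice_continuous2 v) cf)).
- exact: integrable_weightZ.
- by move=> s; have [] := fC (v, s).
Qed.

Lemma tame_marginal_bound f : tame f -> exists C : R, forall s,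
  normc (integral_rV (fun v => f (v, s))) <= C * weight s.
Proof.
move=> tf; have [C _ fC] := tame_bound tf.
exists (2 * (C * \int[lebesgue_tuple n]_v rweight (rV_of_tuple v))) => s.
rewrite -mulrA mulrAC -RintegralZl//; last exact: integrable_rweight.
apply: normc_cint_le; first exact: tame_integrable_rV.
  by have := integrable_rweightZ (C * weight s).
by move=> v; have [+ _ _] := fC (rV_of_tuple v, s); rewrite -mulrA [weight _ * _]mulrC.
Qed.

Lemma tame_marginal_integrable f : tame f ->
  cintegrable leb (fun s => integral_rV (fun v => f (v, s))).
Proof.
move=> tf; have [C fC] := tame_marginal_bound tf.
apply: (@cintegrable_dominated _ _ _ _ _ (fun t : measurableTypeR R => C * weight t)) => //.
  exact: (cmeasurable_fubini2 (tame_integrable_space tf)).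
exact: integrable_weightZ.
Qed.

Lemma integral_space_rV f : tame f ->
  integral_space f = integral_rV (fun v => complex_integral leb (fun s => f (v, s))).
Proof. by move=> tf; exact: cint_fubini1 (tame_integrable_space tf). Qed.

Lemma integral_space_R f : tame f ->
  integral_space f = complex_integral leb (fun s => integral_rV (fun v => f (v, s))).
Proof. by move=> tf; exact: cint_fubini2 (tame_integrable_space tf). Qed.

End Tame.

Section TameCons.
Context {R : realType}.
Local Notation normc := Normc.normc.
Local Notation leb := (@lebesgue_measure R).

Lemma tame_consrow n (f : 'rV[R]_n.+1 * R -> R[i]) s : tame f ->
  tame (fun p : 'rV[R]_n * R => f (consrow p.2 p.1, s)).
Proof.
move=> /[dup] tf [cf _]; have [C C0 fC] := tame_bound tf; split.
  apply: (ccontinuous_comp (g := fun p : 'rV[R]_n * R => (consrow p.2 p.1, s))) => //.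
  by apply: continuous_pairT; [exact: consrow_continuous|move=> ?; exact: cvg_cst].
exists C => x; have [_ + _] := fC (consrow x.2 x.1, s).
by rewrite /= rweight_consrow [weight _ * _]mulrC.
Qed.

(** Reads an integral over R^(n+1) as one over R^n x R, the step of the later inductions on the
    dimension. Tuples put the new coordinate first and [integral_space] puts it last, hence Fubini
    on both sides. *)
Lemma integral_rV_cons n (f : 'rV[R]_n.+1 * R -> R[i]) s : tame f ->
  integral_rV (fun v => f (v, s)) =
  integral_space (fun p : 'rV[R]_n * R => f (consrow p.2 p.1, s)).
Proof.
move=> tf; have tf' := tame_consrow s tf; rewrite integral_space_R//.
have [cf _] := tf.
have [m1 m2] := cmeasurable_rV (ccontinuous_comp (@slice_continuous1 _ _ s) cf).
have -> : integral_rV (fun v => f (v, s)) =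
    complex_integral (leb \x lebesgue_tuple n)%E
      (fun p => f (consrow p.1 (rV_of_tuple p.2), s)).
  apply: complex_ext => /=; rewrite /Rintegral integral_tuple_cons; try exact/measurable_EFinP;
    by congr fine; apply: eq_integral => p _; rewrite rV_of_tuple_cons.
rewrite cint_fubini1//.
have [C _ fC] := tame_bound tf.
apply: (@cintegrable_dominated _ _ _ _ _
  (fun p : measurableTypeR R * n.-tuple (measurableTypeR R) =>
    C * (weight p.1 * rweight (rV_of_tuple p.2)))) => //.
- have [h1 h2] := cmeasurable_space tf'.1.
  have mswap : measurable_fun setT
      (fun q : measurableTypeR R * n.-tuple (measurableTypeR R) => (q.2, q.1)).
    by apply/measurable_fun_pairP; split; [exact: measurable_snd|exact: measurable_fst].
  split.
    exact: (measurableT_comp h1 mswap).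
  exact: (measurableT_comp h2 mswap).
- have := integrableZl measurableT C
    (integrable_prodM (@integrable_weight R) (integrable_rweight n)).
  exact: eq_integrable.
- by move=> p; have [_ + _] := fC (consrow p.1 (rV_of_tuple p.2), s); rewrite rweight_consrow.
Qed.

(** Makes [tame] stable under dilations. After clearing denominators the gap between the two sides
    is c^-2 + c^2 t^2. *)
Lemma weight_scale (c t : R) : c != 0 -> weight (c * t) <= (1 + c ^- 2) * weight t.
Proof.
move=> c0; rewrite /weight /oneDsqr exprMn.
have c2 : 0 < c ^+ 2 by rewrite exprn_even_gt0.
have t2 : 0 <= t ^+ 2 by rewrite sqr_ge0.
have A : 0 < 1 + t ^+ 2 by rewrite ltr_wpDr.
have B : 0 < 1 + c ^+ 2 * t ^+ 2 by rewrite ltr_wpDr// mulr_ge0// ltW.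
rewrite ler_pdivlMr// mulrC ler_pdivrMr// -subr_ge0.
have -> : (1 + c ^- 2) * (1 + c ^+ 2 * t ^+ 2) - (1 + t ^+ 2) =
    c ^- 2 + c ^+ 2 * t ^+ 2 by field.
apply: addr_ge0; first by rewrite invr_ge0 ltW.
by apply: mulr_ge0; rewrite ?(ltW c2).
Qed.

Lemma tame_scale n (f : 'rV[R]_n * R -> R[i]) c : c != 0 -> tame f ->
  tame (fun p => f (c *: p.1, p.2)).
Proof.
move=> c0 /[dup] tf [cf _]; have [C C0 fC] := tame_bound tf; split.
  apply: (ccontinuous_comp (g := fun p : 'rV[R]_n * R => (c *: p.1, p.2))) => //.
  apply: continuous_pairT => p; last exact: cvg_snd.
  by apply: cvgZr; exact: cvg_fst.
exists (C * (1 + c ^- 2) ^+ n) => x.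
have [+ _ _] := fC (c *: x.1, x.2) => /le_trans; apply.
rewrite -!mulrA ler_wpM2l//= mulrA ler_wpM2r ?(ltW (weight_gt0 _))//.
have -> : (1 + c ^- 2) ^+ n = \prod_(i < n) (1 + c ^- 2) by rewrite prodr_const card_ord.
rewrite /rweight -big_split/=.
apply: ler_prod => i _; rewrite (ltW (weight_gt0 _))/= mxE.
exact: weight_scale.
Qed.

(** Induction on the dimension: the peeled coordinate contributes one factor |c| by the affine
    substitution, the slice contributes the remaining |c|^n. *)
Lemma integral_rV_scale n (f : 'rV[R]_n * R -> R[i]) c s : c != 0 -> tame f ->
  integral_rV (fun v => f (v, s)) =
  (`|c| ^+ n)%:C * integral_rV (fun v => f (c *: v, s)).
Proof.
elim: n f s => [|n ih] f s c0 tf.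
  rewrite expr0 mul1r; apply: eq_cint => v; congr (f (_, _)).
  by apply/rowP => -[].
rewrite integral_rV_cons// (integral_rV_cons _ (tame_scale c0 tf)).
have tf1 := tame_consrow s tf.
have tf2 := tame_consrow s (tame_scale c0 tf).
rewrite (integral_space_R tf1) (integral_space_R tf2).
rewrite (cint_affine 0 c0 (tame_marginal_integrable tf1)).
rewrite exprS rmorphM/= -mulrA -(cintZ _ (tame_marginal_integrable tf2)).
congr (_ * _); apply: eq_cint => t; rewrite addr0.
rewrite (ih _ (c * t) c0 tf1); congr (_ * _); apply: eq_cint => v /=.
congr (f (_, _)); apply/rowP => i; case: (unliftP ord0 i) => [j|] ->.
  by rewrite [RHS]mxE !consrow_lift mxE.
by rewrite [RHS]mxE !consrow0.
Qed.

End TameCons.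

(** * The Schwartz class *)

Section MeanValue.
Context {R : realType}.

Lemma MVT_line (h dh : R -> R) (a b : R) :
  (forall t : R, is_derive t 1 h (dh t)) ->
  exists2 c, `|c - a| <= `|b - a| & h b - h a = dh c * (b - a).
Proof.
move=> hd.
have ch x y : {within `[x, y], continuous h}.
  by apply: derivable_within_continuous => t _; exact: ex_derive.
have [ab|ba|<-] := ltgtP a b.
- have [c /[!in_itv]/= /andP[ac cb] ->] := @MVT _ h dh a b ab (fun t _ => hd t) (ch _ _).
  by exists c => //; rewrite !ger0_norm ?subr_ge0 ?lerD2r ltW.
- have [c /[!in_itv]/= /andP[ac cb] E] := @MVT _ h dh b a ba (fun t _ => hd t) (ch _ _).
  exists c; last by rewrite -opprB E; ring.
  by rewrite !ler0_norm ?subr_le0 ?lerN2 ?lerD2r ltW.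
- by exists a => //; rewrite !subrr mulr0.
Qed.

Lemma MVT_line_bound (h dh : R -> R) (C a b : R) :
  (forall t : R, is_derive t 1 h (dh t)) -> (forall t, `|dh t| <= C) ->
  `|h b - h a| <= C * `|b - a|.
Proof.
move=> hd hC; have [c _ ->] := MVT_line a b hd.
by rewrite normrM ler_wpM2r.
Qed.

End MeanValue.

Section RealContinuity.
Context {R : realType} (T : topologicalType).

Lemma continuousZr (c : R) (f : T -> R) : continuous f -> continuous (fun x => c * f x).
Proof. by move=> cf x; apply: cvgM; [exact: cvg_cst|exact: cf]. Qed.

Lemma continuous_normB (c : R) (f : T -> R) :
  continuous f -> continuous (fun x => `|f x - c|).
Proof.
by move=> cf x; apply: cvg_norm; apply: cvgB; [exact: cf|exact: cvg_cst].
Qed.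

Lemma continuous_bigsum (I : Type) (r : seq I) (F : I -> T -> R) :
  (forall i, continuous (F i)) -> continuous (fun x => \sum_(i <- r) F i x).
Proof.
move=> cF; elim: r => [|i r ih].
  by under eq_fun do rewrite big_nil; exact: cst_continuous.
rewrite (_ : (fun x => _) = fun x => F i x + \sum_(i <- r) F i x).
  by move=> x; apply: cvgD; [exact: cF|exact: ih].
by apply/funext => x; rewrite big_cons.
Qed.

End RealContinuity.

Section Coordinates.
Context {R : realType}.
Variable n : nat.
Local Notation E := ('rV[R]_n * R)%type.

Definition crd (o : option 'I_n) (x : E) : R :=
  if o is Some i then x.1 0 i else x.2.

Lemma crdD o x y : crd o (x + y) = crd o x + crd o y.
Proof. by case: o => [i|] //=; rewrite mxE. Qed.

Lemma crdZ o t x : crd o (t *: x) = t * crd o x.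
Proof. by case: o => [i|] //=; rewrite mxE. Qed.

Lemma crd_basis o o' : crd o (basis o') = (o == o')%:R.
Proof. by case: o o' => [i|] [j|] //=; rewrite mxE//. Qed.

Lemma crd_continuous o : continuous (crd o).
Proof.
case: o => [i|] x; last exact: cvg_snd.
apply: (@continuous_comp _ _ _ fst (fun v : 'rV[R]_n => v 0 i)).
  exact: cvg_fst.
exact: coord_continuous.
Qed.

Lemma crd_sum (x : E) : x = \sum_o crd o x *: basis o.
Proof.
have crd_inj (y z : E) : (forall o, crd o y = crd o z) -> y = z.
  move: y z => [y1 y2] [z1 z2] yz; congr pair; last exact: (yz None).
  by apply/rowP => i; exact: (yz (Some i)).
have crd_big o (F : option 'I_n -> E) : crd o (\sum_o' F o') = \sum_o' crd o (F o').
  apply: (big_morph (crd o)) => [y z|]; first exact: crdD.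
  by case: o => //= i; rewrite mxE.
apply: crd_inj => o; rewrite crd_big (bigD1 o)//= big1 ?addr0.
  by rewrite crdZ crd_basis eqxx mulr1.
by move=> o' /negPf oo'; rewrite crdZ crd_basis eq_sym oo' mulr0.
Qed.

Lemma norm_crd o (x : E) : `|crd o x| <= `|x|.
Proof.
rewrite prod_normE le_max; case: o => [i|] /=; last by rewrite lexx orbT.
by rewrite [X in _ <= X]mx_normrE (le_trans _ (le_bigmax _ _ (0, i)))//.
Qed.

Lemma norm_basis o : `|basis o : E| <= 1.
Proof.
rewrite prod_normE ge_max; case: o => [i|] /=; last by rewrite normr0 normr1 ler01 lexx.
rewrite normr0 ler01 andbT [X in X <= _]mx_normrE; apply: bigmax_le => // -[a j] _ /=.
by rewrite mxE; case: (_ && _); rewrite ?normr1 ?normr0.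
Qed.

Lemma norm_le_sum_crd (x : E) : `|x| <= \sum_o `|crd o x|.
Proof.
rewrite {1}[x]crd_sum (le_trans (ler_norm_sum _ _ _))//.
by apply: ler_sum => o _; rewrite normrZ ler_piMr ?norm_basis.
Qed.

Lemma is_derive_crd o o' x : is_derive x (basis o') (crd o) (o == o')%:R.
Proof.
rewrite -[x]addr0 -(scale0r (basis o')); apply/is_derive_line.
rewrite (_ : (fun s => _) = fun s : R => crd o x + s * (o == o')%:R); last first.
  by apply/funext => s; rewrite crdD crdZ crd_basis.
apply: is_derive_eq; rewrite /GRing.scale/=; ring.
Qed.

(** Moving from x to y one coordinate direction at a time, with the mean value bound for each move,
    gives a Lipschitz estimate in the sum of the coordinate differences. *)
Lemma continuous_bounded_partials (g : E -> R) (dg : option 'I_n -> E -> R) (C : R) :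
  (forall o x, is_derive x (basis o) g (dg o x)) ->
  (forall o x, `|dg o x| <= C) -> continuous g.
Proof.
move=> gd gC.
have lip1 o x t : `|g (x + t *: basis o) - g x| <= C * `|t|.
  have := @MVT_line_bound R (fun s => g (x + s *: basis o))
    (fun s => dg o (x + s *: basis o)) C 0 t.
  by rewrite scale0r addr0 subr0; apply => // s; exact/is_derive_line.
have lip (r : seq (option 'I_n)) (c : option 'I_n -> R) x :
    `|g (x + \sum_(o <- r) c o *: basis o) - g x| <= C * \sum_(o <- r) `|c o|.
  elim: r x => [|o r ih] x; first by rewrite !big_nil addr0 subrr normr0 mulr0.
  rewrite !big_cons addrA.
  rewrite (le_trans (ler_distD (g (x + c o *: basis o)) _ _))// [X in X <= _]addrC mulrDr.
  by rewrite lerD.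
move=> x; apply/cvgrPdist_le => e e0.
have C0 : 0 <= C by exact: le_trans (gC None x).
have cs : continuous (fun y : E => C * \sum_o `|crd o y - crd o x|).
  apply: continuousZr; apply: continuous_bigsum => o; apply: continuous_normB.
  exact: crd_continuous.
have /cvgrPdist_le/(_ _ e0) := cs x; apply: filterS => y.
rewrite [in X in `|X - _|]big1 ?mulr0; last by move=> o _; rewrite subrr normr0.
rewrite sub0r normrN distrC => /(le_trans (ler_norm _)); apply: le_trans.
have := lip (index_enum _) (fun o => crd o (y - x)) x.
rewrite -crd_sum [x + _]addrC subrK => /le_trans; apply.
by rewrite ler_wpM2l// ler_sum// => o _; rewrite crdD -scaleN1r crdZ mulN1r.
Qed.

End Coordinates.

Section SchwartzClass.
Context {R : realType}.
Variable n : nat.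
Local Notation E := ('rV[R]_n * R)%type.
Local Notation Re := complex.Re.
Local Notation Im := complex.Im.
Local Notation normc := Normc.normc.
Implicit Types (f g : E -> R[i]) (b : bool) (o : option 'I_n).

(* Psi (b = true) and the Schwartz space (b = false) are the largest sets of
   bounded functions that have all partial derivatives, are stable under these
   and under multiplication by the coordinates, and, for Psi, consist of
   functions vanishing on the last coordinate hyperplane.  Membership is thus
   proved by exhibiting an invariant set; continuity comes for free, bounded
   partial derivatives making a function Lipschitz. *)
Definition invariant b (K : set (E -> R[i])) := forall f, K f ->
  [/\ exists C : R, forall x, normc (f x) <= C,
      forall o, exists2 g, K g & forall x, hasd (basis o) f x (g x),
      forall o, K (fun x => (crd o x)%:C * f x) &
      b -> forall v, f (v, 0) = 0].

Definition sclass b f := exists2 K, invariant b K & K f.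

Lemma hasd_partial o f x l : hasd (basis o) f x l -> partial o f x = l.
Proof.
by move=> [h1 h2]; apply: complex_ext; rewrite /partial; apply: derive_val.
Qed.

Lemma sclass_invariant b : invariant b (sclass b).
Proof.
move=> f [K Kinv Kf]; have [h1 h2 h3 h4] := Kinv f Kf; split => //.
- by move=> o; have [g Kg gf] := h2 o; exists g => //; exists K.
- by move=> o; exists K => //; exact: h3.
Qed.

Lemma sclass_bounded b f : sclass b f -> exists C : R, forall x, normc (f x) <= C.
Proof. by move=> /sclass_invariant[]. Qed.

Lemma sclass_hasd b f o x : sclass b f -> hasd (basis o) f x (partial o f x).
Proof.
move=> /sclass_invariant[_ /(_ o)[g _ fg] _ _].
by rewrite (hasd_partial (fg x)).
Qed.

Lemma sclass_partial b f o : sclass b f -> sclass b (partial o f).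
Proof.
move=> /sclass_invariant[_ /(_ o)[g Sg fg] _ _].
by rewrite (_ : partial o f = g)//; apply/funext => x; exact: hasd_partial.
Qed.

Lemma sclass_crd b f o : sclass b f -> sclass b (fun x => (crd o x)%:C * f x).
Proof. by move=> /sclass_invariant[]. Qed.

Lemma sclass_vanish f v : sclass true f -> f (v, 0) = 0.
Proof. by move=> /sclass_invariant[_ _ _ ->]. Qed.

Lemma sclassW f b : sclass b f -> sclass false f.
Proof.
move=> [K Kinv Kf]; exists K => // g Kg.
by have [] := Kinv g Kg.
Qed.

Lemma sclass_comb b f g (c : R[i]) : sclass b f -> sclass b g ->
  sclass b (fun x => c * f x + g x).
Proof.
move=> Sf Sg; exists [set h | exists f g,
  [/\ sclass b f, sclass b g & h = fun x => c * f x + g x]]; last by exists f, g.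
move=> _ {f g Sf Sg}[f [g [Sf Sg ->]]]; split.
- have [C fC] := sclass_bounded Sf; have [D gD] := sclass_bounded Sg.
  exists (normc c * C + D) => x; rewrite (le_trans (le_normcD _ _))// lerD//.
  by rewrite Normc.normcM ler_wpM2l// normc_ge0.
- move=> o; exists (fun x => c * partial o f x + partial o g x).
    by exists (partial o f), (partial o g); split => //; exact: sclass_partial.
  move=> x; apply: hasdD; last exact: (sclass_hasd o x Sg).
  by apply: hasdZ; exact: (sclass_hasd o x Sf).
- move=> o; exists (fun x => (crd o x)%:C * f x), (fun x => (crd o x)%:C * g x).
  split; [exact: sclass_crd|exact: sclass_crd|].
  by apply/funext => x; rewrite mulrDr mulrCA.
- move=> bT v; move: Sf Sg; rewrite {}bT => Sf Sg.
  by rewrite !sclass_vanish// mulr0 addr0.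
Qed.

Lemma sclass0 b : sclass b (fun=> 0).
Proof.
exists [set (fun=> 0)] => // _ ->; split => //.
- by exists 0 => x; rewrite Normc.normc0.
- by move=> o; exists (fun=> 0) => // x; exact: hasd_cst.
- by move=> o; apply/funext => x; rewrite mulr0.
Qed.

Lemma sclassZ b f (c : R[i]) : sclass b f -> sclass b (fun x => c * f x).
Proof.
move=> Sf; rewrite (_ : (fun x => _) = fun x => c * f x + 0).
  by apply: sclass_comb => //; exact: sclass0.
by apply/funext => x; rewrite addr0.
Qed.

Lemma sclassD b f g : sclass b f -> sclass b g -> sclass b (fun x => f x + g x).
Proof.
move=> Sf Sg; rewrite (_ : (fun x => _) = fun x => 1 * f x + g x).
  exact: sclass_comb.
by apply/funext => x; rewrite mul1r.
Qed.

Lemma sclass_sum b (I : Type) (r : seq I) (f : I -> E -> R[i]) :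
  (forall i, sclass b (f i)) -> sclass b (fun x => \sum_(i <- r) f i x).
Proof.
move=> Sf; elim: r => [|i r ih].
  rewrite (_ : (fun x => _) = fun=> 0); first exact: sclass0.
  by apply/funext => x; rewrite big_nil.
rewrite (_ : (fun x => _) = fun x => f i x + \sum_(i <- r) f i x).
  exact: sclassD.
by apply/funext => x; rewrite big_cons.
Qed.

Lemma sclass_continuous b f : sclass b f -> ccontinuous f.
Proof.
move=> Sf.
have /choice[C fC] o : exists C : R, forall x, normc (partial o f x) <= C.
  exact: sclass_bounded (sclass_partial o Sf).
split.
  apply: (@continuous_bounded_partials _ _ _ (fun o x => Re (partial o f x))
            (\sum_o `|C o|)) => o x; first by case: (sclass_hasd o x Sf).
  rewrite (le_trans (normc_Re _))// (le_trans (fC _ _))//.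
  by rewrite (le_trans (ler_norm _))// (bigD1 o)//= lerDl sumr_ge0.
apply: (@continuous_bounded_partials _ _ _ (fun o x => Im (partial o f x))
          (\sum_o `|C o|)) => o x; first by case: (sclass_hasd o x Sf).
rewrite (le_trans (normc_Im _))// (le_trans (fC _ _))//.
by rewrite (le_trans (ler_norm _))// (bigD1 o)//= lerDl sumr_ge0.
Qed.

(** The product of f with all the factors 1 + x_o^2 stays in the class, hence is bounded; this bound
    is the required decay. *)
Lemma sclass_tame b f : sclass b f -> tame f.
Proof.
move=> Sf; split; first exact: sclass_continuous Sf.
have S1 o g : sclass b g -> sclass b (fun x => (oneDsqr (crd o x))%:C * g x).
  move=> Sg; rewrite (_ : (fun x => _) =
      fun x => g x + (crd o x)%:C * ((crd o x)%:C * g x)).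
    by apply: sclassD => //; do 2 apply: sclass_crd.
  by apply/funext => x; rewrite /oneDsqr rmorphD rmorph1 expr2 rmorphM; ring.
have S2 (r : seq (option 'I_n)) :
    sclass b (fun x => (\prod_(o <- r) oneDsqr (crd o x))%:C * f x).
  elim: r => [|o r ih].
    rewrite (_ : (fun x => _) = f)//.
    by apply/funext => x; rewrite big_nil mul1r.
  rewrite (_ : (fun x => _) = fun x => (oneDsqr (crd o x))%:C *
      ((\prod_(o <- r) oneDsqr (crd o x))%:C * f x)); first exact: S1.
  by apply/funext => x; rewrite big_cons rmorphM mulrA.
have [C fC] := sclass_bounded (S2 (None :: map some (enum 'I_n))).
exists C => x.
have := fC x; rewrite Normc.normcM normc_real big_cons big_map big_enum/=.
have -> : rweight x.1 * weight x.2 =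
    (oneDsqr x.2 * \prod_i oneDsqr (x.1 0 i))^-1.
  by rewrite invfM mulrC /rweight /weight prodfV.
have P : 0 < oneDsqr x.2 * \prod_i oneDsqr (x.1 0 i).
  have o1 t : 0 < oneDsqr t :> R by rewrite (lt_le_trans ltr01).
  by rewrite mulr_gt0// prodr_gt0.
by rewrite (gtr0_norm P) ler_pdivlMr// mulrC.
Qed.

(** For the decay, induction on k for all g at once: 1 + |x| is at most 1 plus the sum of the |x_o|,
    and each x_o g is again in the class. *)
Lemma sclass_schwartz b f : sclass b f -> schwartz f.
Proof.
move=> Sf; have Sp s : sclass b (partials s f).
  by elim: s => //= o s; exact: sclass_partial.
split=> [s re im|k s].
  have [c1 c2] := sclass_continuous (Sp s).
  split=> // o x; have [h1 h2] := sclass_hasd o x (Sp s); exact: ex_derive.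
have {Sp} := Sp s; move: (partials s f) => g; elim: k g => [|k ih] g Sg.
  by have [C gC] := sclass_bounded Sg; exists C => x; rewrite mul1r.
have [C gC] := ih g Sg.
have /choice[D gD] o : exists D : R, forall x,
    (1 + `|x|) ^+ k * normc ((crd o x)%:C * g x) <= D.
  exact: ih (sclass_crd o Sg).
exists (C + \sum_o D o) => x; rewrite exprS mulrAC -mulrA mulrDl mul1r lerD//.
  by rewrite mulrC gC.
apply: (@le_trans _ _ (\sum_o `|crd o x| * (normc (g x) * (1 + `|x|) ^+ k))).
  by rewrite -mulr_suml ler_wpM2r ?norm_le_sum_crd// mulr_ge0 ?normc_ge0//.
apply: ler_sum => o _; apply: le_trans (gD o x).
by rewrite Normc.normcM normc_real mulrA [leLHS]mulrC.
Qed.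

Section SchwartzGen.
Variable f : E -> R[i].
Hypothesis Sf : schwartz f.

(* The smallest set containing f that is stable under the operations of
   [invariant]. *)
Inductive schwartz_gen : (E -> R[i]) -> Prop :=
| Gen_partials s : schwartz_gen (partials s f)
| Gen_crd o g : schwartz_gen g -> schwartz_gen (fun x => (crd o x)%:C * g x)
| Gen_comb c g h : schwartz_gen g -> schwartz_gen h ->
    schwartz_gen (fun x => c * g x + h x).

Lemma schwartz_gen_decay g k : schwartz_gen g ->
  exists C : R, forall x, (1 + `|x|) ^+ k * normc (g x) <= C.
Proof.
have p0 j (x : E) : 0 <= (1 + `|x|) ^+ j by rewrite exprn_ge0// addr_ge0.
move=> Gg; elim: Gg k => {g} [s k|o g _ ih k|c g h _ ihg _ ihh k].
- exact: (Sf.2 k s).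
(* A coordinate factor costs one power of 1 + |x|. *)
- have [C gC] := ih k.+1; exists C => x; apply: le_trans (gC x).
  rewrite Normc.normcM normc_real mulrA exprSr ler_wpM2r ?normc_ge0//.
  by rewrite ler_wpM2l// (le_trans (norm_crd o x))// lerDr.
- have [C gC] := ihg k; have [D hD] := ihh k.
  exists (normc c * C + D) => x.
  rewrite (@le_trans _ _ ((1 + `|x|) ^+ k * (normc c * normc (g x) + normc (h x))))//.
    by rewrite ler_wpM2l// (le_trans (le_normcD _ _))// Normc.normcM.
  by rewrite mulrDr lerD// mulrCA ler_wpM2l// normc_ge0.
Qed.

Lemma schwartz_gen_hasd g o : schwartz_gen g ->
  exists2 g', schwartz_gen g' & forall x, hasd (basis o) g x (g' x).
Proof.
elim=> [s|o' {}g Gg [g' Gg' gg']|c {}g h Gg [g' Gg' gg'] Gh [h' Gh' hh']].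
- exists (partials (o :: s) f); first exact: Gen_partials.
  have [_ _ d1 d2] := Sf.1 s; move=> x.
  by split; exact: derivableP.
- exists (fun x => (o' == o)%:R * g x + (crd o' x)%:C * g' x).
    by apply: Gen_comb => //; exact: Gen_crd.
  move=> x; have := hasdM (hasd_real (is_derive_crd o' o x)) (gg' x).
  by rewrite rmorph_nat.
- exists (fun x => c * g' x + h' x); first exact: Gen_comb.
  by move=> x; apply: hasdD => //; exact: hasdZ.
Qed.

Lemma schwartz_sclass : sclass false f.
Proof.
exists schwartz_gen; last exact: (Gen_partials [::]).
move=> g Gg; split => //.
- have [C gC] := schwartz_gen_decay 0 Gg.
  by exists C => x; have := gC x; rewrite expr0 mul1r.
- by move=> o; exact: schwartz_gen_hasd.
- by move=> o; exact: Gen_crd.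
Qed.

End SchwartzGen.

End SchwartzClass.

(** * Integrals of derivatives *)

Section IntegralDerivative.
Context {R : realType}.
Local Notation leb := (@lebesgue_measure R).
Local Notation normc := Normc.normc.

(** Fundamental theorem of calculus on intervals exhausting A, then dominated convergence. A is the
    whole line for integration by parts and a half-line for the Poisson kernel. *)
Lemma Rintegral_derive_cvg (A : set R) (lo hi : nat -> R) (h dh : R -> R) :
  measurable A ->
  (forall n, lo n < hi n) ->
  (forall n, `[lo n, hi n]%classic `<=` A) ->
  (forall t, A t -> \forall n \near \oo, t \in `[lo n, hi n]) ->
  (forall t, is_derive (t : R) 1 h (dh t)) -> continuous dh ->
  leb.-integrable A (EFin \o dh) ->
  h (hi n) - h (lo n) @[n --> \oo] --> \int[leb]_(t in A) dh t.
Proof.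
move=> mA lohi subA nearA hd cdh dhi.
have E n : h (hi n) - h (lo n) = \int[leb]_(t in A) (dh \_ `[lo n, hi n]) t.
  rewrite -Rintegral_mkcondr (setIidr (subA n)) /Rintegral.
  rewrite (@continuous_FTC2 _ dh h)//.
  - exact: continuous_subspaceT.
  - split; first by move=> t _; exact: ex_derive.
    + by apply: cvg_at_right_filter; apply: differentiable_continuous;
        apply/derivable1_diffP; exact: ex_derive.
    + by apply: cvg_at_left_filter; apply: differentiable_continuous;
        apply/derivable1_diffP; exact: ex_derive.
  - by move=> t _; rewrite derive1E; exact: derive_val.
under eq_fun do rewrite E.
have mdh : measurable_fun A dh by apply: measurable_funTS; exact: continuous_measurable_fun.
have [|||||_ _] := @dominated_convergence _ _ _ leb A mA
  (fun n t => ((dh \_ `[lo n, hi n]) t)%:E) (EFin \o dh) (abse \o (EFin \o dh)).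
- move=> n; apply/measurable_EFinP; apply/measurable_restrict => //.
  exact: measurable_funS mdh.
- exact/measurable_EFinP.
- apply: aeW => t At; apply: cvg_near_cst.
  by apply: filterS (nearA t At) => n tn /=; rewrite patchE mem_set.
- exact: integrable_abse.
- apply: aeW => t n At /=; rewrite lee_fin patchE; case: ifP => //.
  by rewrite normr0.
move=> cv; apply: fine_cvg; rewrite fineK//; exact: integrable_fin_num.
Qed.

Lemma weight_cvg0 (C : R) (u : nat -> R) :
  (forall n, `|u n| <= C * weight n.+1%:R) -> u n @[n --> \oo] --> 0.
Proof.
move=> uC.
have wto0 : C * n.+1%:R^-1 @[n --> \oo] --> (0 : R).
  rewrite -[X in _ --> X](mulr0 C); apply: cvgM; first exact: cvg_cst.
  exact: cvg_harmonic.
have C0 : 0 <= C.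
  by have := le_trans (normr_ge0 _) (uC 0); rewrite pmulr_lge0 ?weight_gt0.
apply: norm_cvg0; apply: (@squeeze_cvgr _ _ _ _ (cst 0)) wto0; last exact: cvg_cst.
apply: nearW => n; rewrite normr_ge0/= (le_trans (uC n))// ler_wpM2l//.
rewrite lef_pV2 ?posrE// /oneDsqr (@le_trans _ _ (n.+1%:R ^+ 2)) ?lerDr//.
by rewrite expr2 ler_peMl// ler1n.
Qed.

(** The boundary terms at -(n+1) and n+1 tend to 0 because h is dominated by [weight]. *)
Lemma cint_derive0 (h dh : R -> R[i]) (C : R) :
  (forall t, hasd (1 : R^o) h t (dh t)) -> ccontinuous dh ->
  (forall t, normc (dh t) <= C * weight t) ->
  (forall t, normc (h t) <= C * weight t) ->
  complex_integral leb dh = 0.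
Proof.
move=> hd cdh dhC hC.
have [i1 i2] : cintegrable leb dh.
  apply: (@cintegrable_dominated _ _ _ _ _ (fun t : measurableTypeR R => C * weight t)) => //.
    exact: cmeasurable_R.
  exact: integrable_weightZ.
have C0 : 0 <= C.
  by have := le_trans (normc_ge0 _) (hC 0); rewrite pmulr_lge0 ?weight_gt0.
have to0 (k dk : R -> R) : (forall t, is_derive (t : R) 1 k (dk t)) -> continuous dk ->
    leb.-integrable setT (EFin \o dk) -> (forall t, `|k t| <= C * weight t) ->
    \int[leb]_t dk t = 0.
  move=> kd cdk dki kC.
  have := @Rintegral_derive_cvg setT (fun n => - n.+1%:R) (fun n => n.+1%:R) k dk measurableT.
  have -> : \int[leb]_t dk t = \int[leb]_(t in setT) dk t by [].
  move=> cv; apply: (cvg_unique _ (cv _ _ _ _ _ _)) => //.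
  - by move=> n; rewrite gtrN.
  - move=> t _; near=> n; rewrite in_itv/= -ler_norml.
    rewrite (@le_trans _ _ n%:R) ?ler_nat//.
    near: n; exact: nbhs_infty_ger.
  - apply: (@weight_cvg0 (2 * C)) => n.
    rewrite (le_trans (ler_normB _ _))// -mulrA mulr_natl mulr2n lerD//.
    by rewrite (le_trans (kC _))// /weight /oneDsqr sqrrN.
apply: complex_ext => /=.
- apply: (to0 (fun t => complex.Re (h t)) (fun t => complex.Re (dh t))) => //.
  + by move=> t; case: (hd t).
  + exact: cdh.1.
  + by move=> t; exact: le_trans (normc_Re _) (hC t).
- apply: (to0 (fun t => complex.Im (h t)) (fun t => complex.Im (dh t))) => //.
  + by move=> t; case: (hd t).
  + exact: cdh.2.
  + by move=> t; exact: le_trans (normc_Im _) (hC t).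
Unshelve. all: by end_near. Qed.

End IntegralDerivative.

Section Transfer.
Context {R : realType}.

(** A directional derivative sees only the restriction to a line, so it passes between functions,
    even on different spaces, that agree along lines. *)
Lemma hasd_transfer (V W : normedModType R) (f : V -> R[i]) (g : W -> R[i])
    (v x : V) (w y : W) l :
  (forall s : R, f (x + s *: v) = g (y + s *: w)) -> hasd w g y l -> hasd v f x l.
Proof.
move=> fg; rewrite -{1}[y]addr0 -{1}(scale0r w) => /hasd_line h.
rewrite -[x]addr0 -(scale0r v); apply/hasd_line.
by rewrite (_ : (fun s => _) = fun s : R => g (y + s *: w))//; apply/funext.
Qed.

Lemma is_derive_affine (V : normedModType R) (h : V -> R) (v x : V) (a : R) :
  (forall s : R, h (x + s *: v) = h x + s * a) -> is_derive x v h a.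
Proof.
move=> ha; rewrite -[x]addr0 -(scale0r v); apply/is_derive_line.
rewrite (_ : (fun s => _) = fun s : R => h x + s * a); last exact/funext.
by apply: is_derive_eq; rewrite /GRing.scale/=; ring.
Qed.

End Transfer.

Section SchwartzOperations.
Context {R : realType}.
Local Notation normc := Normc.normc.

Lemma dotvDr n (u v w : 'rV[R]_n) : dotv u (v + w) = dotv u v + dotv u w.
Proof. by rewrite /dotv -big_split; apply: eq_bigr => i _; rewrite mxE mulrDr. Qed.

Lemma dotvZr n c (u v : 'rV[R]_n) : dotv u (c *: v) = c * dotv u v.
Proof. by rewrite /dotv mulr_sumr; apply: eq_bigr => i _; rewrite mxE mulrCA. Qed.

Lemma dotvC n (u v : 'rV[R]_n) : dotv u v = dotv v u.
Proof. by apply: eq_bigr => i _; rewrite mulrC. Qed.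

Lemma dotv_delta n (u : 'rV[R]_n) i : dotv u (delta_mx 0 i) = u 0 i.
Proof.
rewrite /dotv (bigD1 i)//= big1 ?addr0; first by rewrite mxE !eqxx mulr1.
by move=> j /negPf ji; rewrite mxE ji andbF mulr0.
Qed.

Lemma dotC n (x y : 'rV[R]_n * R) : dot x y = dot y x.
Proof. by rewrite /dot dotvC mulrC. Qed.

Lemma dotDZ n (c x y : 'rV[R]_n * R) s : dot c (x + s *: y) = dot c x + s * dot c y.
Proof.
by rewrite /dot /= dotvDr dotvZr /GRing.scale/=; ring.
Qed.

Lemma dotv0 n (u : 'rV[R]_n) : dotv u 0 = 0.
Proof. by rewrite /dotv big1// => i _; rewrite mxE mulr0. Qed.

Lemma dot0 n (c : 'rV[R]_n * R) : dot c 0 = 0.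
Proof. by rewrite /dot/= dotv0 mulr0 addr0. Qed.

Lemma dot_basis n (c : 'rV[R]_n * R) o : dot c (basis o) = crd o c.
Proof.
case: o => [i|]; rewrite /dot/= ?dotv_delta ?mulr0 ?addr0// mulr1.
by rewrite dotv0 add0r.
Qed.

Lemma dot_continuous n (c : 'rV[R]_n * R) : continuous (dot c).
Proof.
have -> : dot c = fun x => \sum_o crd o c * crd o x.
  apply/funext => x; rewrite {1}[x]crd_sum.
  rewrite (big_morph (dot c) (id1 := 0) (op1 := +%R)); last exact: dot0.
    by apply: eq_bigr => o _; rewrite -[_ *: _]add0r dotDZ dot_basis dot0 add0r mulrC.
  by move=> y z; rewrite -[z]scale1r dotDZ scale1r mul1r.
by apply: continuous_bigsum => o; apply: continuousZr; exact: crd_continuous.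
Qed.

(** Differentiating the phase brings down the constant i c_o, so the modulated functions form an
    invariant set. *)
Lemma sclass_mod n b (f : 'rV[R]_n * R -> R[i]) c :
  sclass b f -> sclass b (fun x => f x * expi (dot c x)).
Proof.
move=> Sf; exists [set g | exists2 f, sclass b f & g = fun x => f x * expi (dot c x)];
  last by exists f.
move=> _ {f Sf} [f Sf ->]; split.
- have [C fC] := sclass_bounded Sf; exists C => x.
  by rewrite Normc.normcM normc_expi mulr1.
- move=> o; exists (fun x => ('i * (crd o c)%:C * f x + partial o f x) * expi (dot c x)).
    exists (fun x => 'i * (crd o c)%:C * f x + partial o f x) => //.
    by apply: sclass_comb => //; exact: sclass_partial.
  move=> x; have D : is_derive x (basis o) (dot c) (crd o c).
    by apply: is_derive_affine => s; rewrite dotDZ dot_basis.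
  have := hasdM (sclass_hasd o x Sf) (hasd_expi D).
  by congr (hasd _ _ _ _); ring.
- move=> o; exists (fun x => (crd o x)%:C * f x); first exact: sclass_crd.
  by apply/funext => x; rewrite mulrA.
- by move=> bT v; rewrite {}bT in Sf; rewrite sclass_vanish ?mul0r.
Qed.

Lemma consrowDZ n t s u w (v : 'rV[R]_n) :
  consrow (t + s * u) (v + s *: w) = consrow t v + s *: consrow u w.
Proof.
apply/rowP => i; case: (unliftP ord0 i) => [j|] ->.
  by rewrite consrow_lift !mxE liftK.
by rewrite consrow0 !mxE unlift_none.
Qed.

Lemma hasd_slice n (f : 'rV[R]_n.+1 * R -> R[i]) s (p : 'rV[R]_n * R) o l :
  hasd (basis (Some (if o is Some j then lift ord0 j else ord0))) f (consrow p.2 p.1, s) l ->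
  hasd (basis o) (fun p : 'rV[R]_n * R => f (consrow p.2 p.1, s)) p l.
Proof.
apply: hasd_transfer => t; case: p => v u /=.
congr (f (_, _)); last by case: o => [j|]; rewrite /= scaler0 addr0.
rewrite consrowDZ; congr (_ + _ *: _).
apply/rowP => i; case: o => [j|]; case: (unliftP ord0 i) => [k|] -> /=;
  rewrite ?consrow_lift ?consrow0 !mxE//=.
Qed.

Lemma sclass_slice n (f : 'rV[R]_n.+1 * R -> R[i]) s : sclass false f ->
  sclass false (fun p : 'rV[R]_n * R => f (consrow p.2 p.1, s)).
Proof.
move=> Sf; exists [set g | exists2 f, sclass false f &
  g = fun p : 'rV[R]_n * R => f (consrow p.2 p.1, s)]; last by exists f.
move=> _ {f Sf} [f Sf ->]; split => //.
- by have [C fC] := sclass_bounded Sf; exists C.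
- move=> o; pose o' : option 'I_n.+1 := Some (if o is Some j then lift ord0 j else ord0).
  exists (fun p => partial o' f (consrow p.2 p.1, s)).
    by exists (partial o' f) => //; exact: sclass_partial.
  by move=> p; apply: hasd_slice; exact: sclass_hasd Sf.
- move=> o; pose o' : option 'I_n.+1 := Some (if o is Some j then lift ord0 j else ord0).
  exists (fun x => (crd o' x)%:C * f x); first exact: sclass_crd.
  apply/funext => -[v t]; congr (_%:C * _); rewrite /o'.
  by case: o {o'} => [j|] /=; rewrite ?consrow_lift ?consrow0.
Qed.

Lemma partial_slice n (f : 'rV[R]_n.+1 * R -> R[i]) s o : sclass false f ->
  partial o (fun p : 'rV[R]_n * R => f (consrow p.2 p.1, s)) =
  fun p => partial (Some (if o is Some j then lift ord0 j else ord0)) f (consrow p.2 p.1, s).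
Proof.
move=> Sf; apply/funext => p; apply: hasd_partial; apply: hasd_slice.
exact: sclass_hasd Sf.
Qed.

Lemma cint_partial_last n (f : 'rV[R]_n * R -> R[i]) v : sclass false f ->
  complex_integral lebesgue_measure (fun t => partial None f (v, t)) = 0.
Proof.
move=> Sf; have Sg := sclass_partial None Sf.
have [C C0 fC] := tame_bound (sclass_tame Sf).
have [D D0 gD] := tame_bound (sclass_tame Sg).
apply: (@cint_derive0 R (fun t => f (v, t)) _ (C + D)).
- move=> t; apply: hasd_transfer (sclass_hasd None (v, t) Sf) => s /=.
  by congr (f _); apply: (congr2 pair); rewrite /= ?scaler0 ?addr0.
- exact: (ccontinuous_comp (@slice_continuous2 _ _ v) (sclass_continuous Sg)).
- move=> t; have [_ _ h] := gD (v, t); rewrite (le_trans h)//.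
  by rewrite ler_wpM2r ?lerDr ?(ltW (weight_gt0 _)).
- move=> t; have [_ _ h] := fC (v, t); rewrite (le_trans h)//.
  by rewrite ler_wpM2r ?lerDl ?(ltW (weight_gt0 _)).
Qed.

Lemma cint0 d (T : measurableType d) (mu : {measure set T -> \bar R}) :
  complex_integral mu (fun=> 0) = 0.
Proof. by rewrite /complex_integral/= /Rintegral integral0. Qed.

(** Induction on the dimension. If the peeled coordinate is the differentiated one, it is integrated
    first and the inner integral vanishes; otherwise it is integrated last and the induction
    hypothesis applies to the slice. *)
Lemma integral_rV_partial n (f : 'rV[R]_n * R -> R[i]) s i : sclass false f ->
  integral_rV (fun v => partial (Some i) f (v, s)) = 0.
Proof.
elim: n f s i => [f s []//|n ih f s i Sf].
have Sg := sclass_slice s Sf.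
rewrite (integral_rV_cons _ (sclass_tame (sclass_partial (Some i) Sf))).
case: (unliftP ord0 i) => [j|] ->.
  rewrite -[X in integral_space X](partial_slice s (Some j) Sf).
  rewrite (integral_space_R (sclass_tame (sclass_partial (Some j) Sg))).
  rewrite -[RHS](@cint0 _ _ lebesgue_measure); apply: eq_cint => t; exact: ih.
rewrite -[X in integral_space X](partial_slice s None Sf).
rewrite (integral_space_rV (sclass_tame (sclass_partial None Sg))).
rewrite -[RHS](@cint0 _ _ (lebesgue_tuple n)); apply: eq_cint => v.
exact: cint_partial_last.
Qed.

End SchwartzOperations.

(** * Partial Fourier transforms and their inversion *)

Section PartialFourier.
Context {R : realType} (n : nat) d (T : measurableType d) (mu : {measure set T -> \bar R}).
Local Notation E := ('rV[R]_n * R)%type.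
Local Notation normc := Normc.normc.
(* P and Q are both of the form int f(rho(t, x)) exp(i theta(t, x)) dt; [act o]
   says that coordinate [o] is integrated out. *)
Variables (rho : T -> E -> E) (theta : T -> E -> R) (act : option 'I_n -> bool).
Variable W : T -> R.
Hypothesis Wint : mu.-integrable setT (EFin \o W).
Hypothesis rho_measurable : forall f x, sclass false f ->
  cmeasurable (fun t => f (rho t x) * expi (theta t x)).
Hypothesis rho_bound : forall f, sclass false f ->
  exists C : R, forall t x, normc (f (rho t x)) <= C * W t.
Hypothesis rho_act : forall o t x u, act o -> rho t (x + u *: basis o) = rho t x.
Hypothesis theta_act : forall o t x (u : R), act o ->
  theta t (x + u *: basis o) = theta t x + u * crd o (rho t x).
Hypothesis rho_pas : forall o t x u, ~~ act o ->
  rho t (x + u *: basis o) = rho t x + u *: basis o.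
Hypothesis theta_pas : forall o t x (u : R), ~~ act o ->
  theta t (x + u *: basis o) = theta t x.
Hypothesis crd_pas : forall o t x, ~~ act o -> crd o (rho t x) = crd o x.

Definition pfourier (f : E -> R[i]) (x : E) : R[i] :=
  complex_integral mu (fun t => f (rho t x) * expi (theta t x)).

Hypothesis pfourier_by_parts : forall f o x, sclass false f -> act o ->
  pfourier (partial o f) x = - ('i * (crd o x)%:C * pfourier f x).

Lemma pfourier_dominated f : sclass false f -> exists C : R,
  mu.-integrable setT (EFin \o (fun t => C * W t)) /\
  forall t x, normc (f (rho t x) * expi (theta t x)) <= C * W t.
Proof.
move=> Sf; have [C fC] := rho_bound Sf; exists C; split.
  by have := integrableZl measurableT C Wint; apply: eq_integrable.
by move=> t x; rewrite Normc.normcM normc_expi mulr1.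
Qed.

Lemma pfourier_integrable f x : sclass false f ->
  cintegrable mu (fun t => f (rho t x) * expi (theta t x)).
Proof.
move=> Sf; have [C [Ci Cle]] := pfourier_dominated Sf.
by apply: (cintegrable_dominated _ Ci) => //; exact: rho_measurable.
Qed.

Lemma pfourierZ f c x : sclass false f ->
  pfourier (fun y => c * f y) x = c * pfourier f x.
Proof.
move=> Sf; rewrite /pfourier -cintZ; last exact: pfourier_integrable.
by apply: eq_cint => t; rewrite mulrA.
Qed.

(** For an active coordinate the derivative falls on the phase and brings down i x_o; for a passive
    one it falls on f. Domination by [W] allows differentiation under the integral. *)
Lemma hasd_pfourier f o x : sclass false f ->
  hasd (basis o) (pfourier f) x
    (pfourier (if act o then fun y => 'i * ((crd o y)%:C * f y) else partial o f) x).
Proof.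
move=> Sf; set g := if act o then _ else _.
have Sg : sclass false g.
  rewrite /g; case: ifP => _; last exact: sclass_partial.
  exact/sclassZ/sclass_crd.
have [C [Ci Cle]] := pfourier_dominated Sg.
have x0 : x + 0 *: basis o = x by rewrite scale0r addr0.
suff : hasd (1 : R^o) (fun u => pfourier f (x + u *: basis o)) 0
    (pfourier g (x + 0 *: basis o)) by move=> /hasd_line; rewrite x0.
apply: (@hasd_cint _ _ _ _ (fun u t => f (rho t (x + u *: basis o)) *
  expi (theta t (x + u *: basis o))) (fun u t => g (rho t (x + u *: basis o)) *
  expi (theta t (x + u *: basis o))) (fun t => C * W t)) => //.
  by move=> u; exact: pfourier_integrable.
move=> u t; apply/(hasd_line (basis o) (fun z => f (rho t z) * expi (theta t z)) x).
rewrite /g; have [ao|po] := boolP (act o).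
- have D : is_derive (x + u *: basis o) (basis o) (theta t) (crd o (rho t x)).
    by apply: is_derive_affine => s; rewrite !theta_act// rho_act.
  have F : hasd (basis o) (fun z => f (rho t z)) (x + u *: basis o) 0.
    apply: (hasd_transfer (w := basis o) (y := x + u *: basis o)) (hasd_cst _ (f (rho t x)) _) => s.
    by rewrite !rho_act.
  have := hasdM F (hasd_expi D); congr (hasd _ _ _ _).
  by rewrite !rho_act//; ring.
- have F : hasd (basis o) (fun z => f (rho t z)) (x + u *: basis o)
      (partial o f (rho t (x + u *: basis o))).
    apply: hasd_transfer (sclass_hasd o _ Sf) => s.
    by rewrite !rho_pas.
  have D : is_derive (x + u *: basis o) (basis o) (theta t) 0.
    by apply: is_derive_affine => s; rewrite !theta_pas// mulr0 addr0.
  have := hasdM F (hasd_expi D); congr (hasd _ _ _ _).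
  by ring.
Qed.

Lemma crd_pfourier f o x : sclass false f ->
  (crd o x)%:C * pfourier f x =
  pfourier (if act o then fun y => 'i * partial o f y else fun y => (crd o y)%:C * f y) x.
Proof.
move=> Sf; have [ao|po] := boolP (act o).
  rewrite pfourierZ; last exact: sclass_partial.
  rewrite pfourier_by_parts//.
  have -> (z w : R[i]) : 'i * - ('i * z * w) = - ('i ^+ 2) * (z * w) by ring.
  by rewrite sqr_i opprK mul1r.
rewrite -pfourierZ//; apply: eq_cint => t.
by rewrite crd_pas.
Qed.

Lemma partial_pfourier f o : sclass false f -> partial o (pfourier f) =
  pfourier (if act o then fun y => 'i * ((crd o y)%:C * f y) else partial o f).
Proof. by move=> Sf; apply/funext => x; apply: hasd_partial; exact: hasd_pfourier. Qed.

(** The transforms of the class form an invariant set: in active directions derivatives and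
    coordinates are exchanged, in passive ones both commute with the transform. Vanishing on the
    hyperplane is kept when the last coordinate is passive. *)
Lemma sclass_pfourier (b : bool) (f : E -> R[i]) :
  (b -> ~~ act None) -> sclass b f -> sclass b (pfourier f).
Proof.
move=> bact Sf; exists [set g | exists2 f, sclass b f & g = pfourier f]; last by exists f.
move=> _ {f Sf} [f Sf ->]; have Sf0 := sclassW Sf; split.
- have [C [Ci Cle]] := pfourier_dominated Sf0.
  exists (2 * \int[mu]_t (C * W t)) => x; apply: normc_cint_le => //.
  exact: pfourier_integrable.
- move=> o; exists (pfourier (if act o then fun y => 'i * ((crd o y)%:C * f y) else partial o f)).
    exists (if act o then fun y => 'i * ((crd o y)%:C * f y) else partial o f) => //.
    by case: ifP => _; [exact/sclassZ/sclass_crd|exact: sclass_partial].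
  by move=> x; exact: hasd_pfourier.
- move=> o; exists (if act o then fun y => 'i * partial o f y else fun y => (crd o y)%:C * f y).
    by case: ifP => _; [exact/sclassZ/sclass_partial|exact: sclass_crd].
  by apply/funext => x; exact: crd_pfourier.
- move=> bT v; rewrite -[RHS](@cint0 _ _ _ mu); apply: eq_cint => t.
  have := crd_pas t (v, 0) (bact bT); case: (rho t (v, 0)) => w s /= ->.
  by rewrite bT in Sf; rewrite sclass_vanish ?mul0r.
Qed.

End PartialFourier.

Section FourierRowLast.
Context {R : realType} (n : nat).
Local Notation E := ('rV[R]_n * R)%type.
Local Notation normc := Normc.normc.
Local Notation leb := (@lebesgue_measure R).
Implicit Types (f : E -> R[i]).

(** [fourier_row] is Q and [fourier_last] is P; the variable that is not transformed is carried
    along as a parameter. *)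
Definition fourier_row f (x : E) : R[i] :=
  integral_rV (fun v => f (v, x.2) * expi (dotv v x.1)).

Definition fourier_last f (x : E) : R[i] :=
  complex_integral leb (fun t => f (x.1, t) * expi (t * x.2)).

Definition row_act (o : option 'I_n) := o != None.
Definition last_act (o : option 'I_n) := o == None.

Lemma sclass_mod_row f c : sclass false f ->
  sclass false (fun x => f x * expi (dotv x.1 c)).
Proof.
move=> /(sclass_mod (c, 0)); congr (sclass _ _); apply/funext => x.
by rewrite /dot/= mul0r addr0 dotvC.
Qed.

Lemma sclass_mod_last f c : sclass false f ->
  sclass false (fun x => f x * expi (x.2 * c)).
Proof.
move=> /(sclass_mod (0, c)); congr (sclass _ _); apply/funext => x.
by rewrite /dot/= dotvC dotv0 add0r [c * _]mulrC.
Qed.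

(** The derivative of f times the phase has integral 0, and the product rule splits it into the two
    terms. *)
Lemma fourier_row_by_parts f i x : sclass false f ->
  fourier_row (partial (Some i) f) x = - ('i * (crd (Some i) x)%:C * fourier_row f x).
Proof.
move=> Sf; pose g := fun y => f y * expi (dotv y.1 x.1).
have Sg : sclass false g by exact: sclass_mod_row.
have pg y : partial (Some i) g y =
    partial (Some i) f y * expi (dotv y.1 x.1) + 'i * (x.1 0 i)%:C * g y.
  apply: hasd_partial.
  have D : is_derive y (basis (Some i)) (fun z => dotv z.1 x.1) (x.1 0 i).
    apply: is_derive_affine => s.
    by rewrite /= dotvC dotvDr dotvZr dotv_delta dotvC.
  have := hasdM (sclass_hasd (Some i) y Sf) (hasd_expi D).
  by congr (hasd _ _ _ _); rewrite /g; ring.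
have := integral_rV_partial x.2 i Sg.
rewrite (_ : integral_rV _ = fourier_row (partial (Some i) f) x +
  'i * (x.1 0 i)%:C * fourier_row f x); first by move/eqP; rewrite addr_eq0 => /eqP.
have t1 := tame_integrable_rV x.2 (sclass_tame (sclass_mod_row x.1 (sclass_partial (Some i) Sf))).
have t2 := tame_integrable_rV x.2 (sclass_tame Sg).
rewrite /fourier_row /integral_rV -cintZ// -cintD//; last first.
  exact: (tame_integrable_rV x.2 (sclass_tame (sclassZ ('i * (x.1 0 i)%:C) Sg))).
by apply: eq_cint => v; rewrite pg.
Qed.

Lemma fourier_last_by_parts f x : sclass false f ->
  fourier_last (partial None f) x = - ('i * (x.2)%:C * fourier_last f x).
Proof.
move=> Sf; pose g := fun y => f y * expi (y.2 * x.2).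
have Sg : sclass false g by exact: sclass_mod_last.
have pg y : partial None g y =
    partial None f y * expi (y.2 * x.2) + 'i * (x.2)%:C * g y.
  apply: hasd_partial.
  have D : is_derive y (basis None) (fun z => z.2 * x.2) x.2.
    by apply: is_derive_affine => s; rewrite /= /GRing.scale/=; ring.
  have := hasdM (sclass_hasd None y Sf) (hasd_expi D).
  by congr (hasd _ _ _ _); rewrite /g; ring.
have := cint_partial_last x.1 Sg.
rewrite (_ : complex_integral _ _ = fourier_last (partial None f) x +
  'i * (x.2)%:C * fourier_last f x); first by move/eqP; rewrite addr_eq0 => /eqP.
have t1 := tame_integrable_R x.1 (sclass_tame (sclass_mod_last x.2 (sclass_partial None Sf))).
have t2 := tame_integrable_R x.1 (sclass_tame Sg).
rewrite /fourier_last -cintZ// -cintD//; last first.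
  exact: (tame_integrable_R x.1 (sclass_tame (sclassZ ('i * (x.2)%:C) Sg))).
by apply: eq_cint => v; rewrite pg.
Qed.

Let last_measurable f (x : E) : sclass false f ->
  cmeasurable (fun t : measurableTypeR R => f (x.1, t) * expi (t * x.2)).
Proof.
move=> Sf; apply: cmeasurable_R.
apply: (ccontinuous_comp (@slice_continuous2 _ _ x.1)
  (sclass_continuous (sclass_mod_last x.2 Sf))).
Qed.

Let row_measurable f (x : E) : sclass false f ->
  cmeasurable (fun t : n.-tuple (measurableTypeR R) =>
    f (rV_of_tuple t, x.2) * expi (dotv (rV_of_tuple t) x.1)).
Proof.
move=> Sf.
exact: (cmeasurable_rV (ccontinuous_comp (@slice_continuous1 _ _ x.2)
  (sclass_continuous (sclass_mod_row x.1 Sf)))).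
Qed.

Let last_bound f : sclass false f -> exists C : R,
  forall (t : R) (x : E), normc (f (x.1, t)) <= C * weight t.
Proof.
move=> Sf; have [C C0 fC] := tame_bound (sclass_tame Sf); exists C => t x.
by have [] := fC (x.1, t).
Qed.

Let row_bound f : sclass false f -> exists C : R,
  forall (t : n.-tuple (measurableTypeR R)) (x : E),
    normc (f (rV_of_tuple t, x.2)) <= C * rweight (rV_of_tuple t).
Proof.
move=> Sf; have [C C0 fC] := tame_bound (sclass_tame Sf); exists C => t x.
by have [] := fC (rV_of_tuple t, x.2).
Qed.

Let last_rho_act (o : option 'I_n) (t : R) (x : E) (u : R) : last_act o ->
  ((x + u *: basis o).1, t) = (x.1, t).
Proof. by move=> /eqP ->; rewrite /= scaler0 addr0. Qed.

Let last_theta_act (o : option 'I_n) (t : R) (x : E) (u : R) : last_act o ->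
  t * (x + u *: basis o).2 = t * x.2 + u * crd o (x.1, t).
Proof. by move=> /eqP ->; rewrite /= /GRing.scale/=; ring. Qed.

Let last_rho_pas (o : option 'I_n) (t : R) (x : E) (u : R) : ~~ last_act o ->
  ((x + u *: basis o).1, t) = (x.1, t) + u *: basis o.
Proof.
by case: o => // i _; apply: (congr2 pair); rewrite //= /GRing.scale/= mulr0 addr0.
Qed.

Let last_theta_pas (o : option 'I_n) (t : R) (x : E) (u : R) : ~~ last_act o ->
  t * (x + u *: basis o).2 = t * x.2.
Proof. by case: o => // i _; rewrite /= /GRing.scale/= mulr0 addr0. Qed.

Let last_crd_pas (o : option 'I_n) (t : R) (x : E) : ~~ last_act o ->
  crd o (x.1, t) = crd o x.
Proof. by case: o. Qed.

Let last_by_parts f o x : sclass false f -> last_act o ->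
  fourier_last (partial o f) x = - ('i * (crd o x)%:C * fourier_last f x).
Proof. by move=> Sf /eqP ->; exact: fourier_last_by_parts. Qed.

(** Stated without flatness: P integrates out the very variable in which the elements of Psi are
    flat. *)
Lemma sclass_fourier_last f : sclass false f -> sclass false (fourier_last f).
Proof.
by apply: (sclass_pfourier (@integrable_weight R) last_measurable last_bound
  last_rho_act last_theta_act last_rho_pas last_theta_pas last_crd_pas last_by_parts).
Qed.

(** The commutation behind the symmetry of mixed partial derivatives. *)
Lemma partial_fourier_last f i : sclass false f ->
  partial (Some i) (fourier_last f) = fourier_last (partial (Some i) f).
Proof.
exact: (partial_pfourier (@integrable_weight R) last_measurable last_bound
  last_rho_act last_theta_act last_rho_pas last_theta_pas (Some i)).
Qed.

Let row_rho_act (o : option 'I_n) (t : n.-tuple R) (x : E) (u : R) : row_act o ->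
  (rV_of_tuple t, (x + u *: basis o).2) = (rV_of_tuple t, x.2).
Proof. by case: o => // i _; rewrite /= /GRing.scale/= mulr0 addr0. Qed.

Let row_theta_act (o : option 'I_n) (t : n.-tuple R) (x : E) (u : R) : row_act o ->
  dotv (rV_of_tuple t) (x + u *: basis o).1 =
  dotv (rV_of_tuple t) x.1 + u * crd o (rV_of_tuple t, x.2).
Proof. by case: o => // i _; rewrite /= dotvDr dotvZr dotv_delta. Qed.

Let row_rho_pas (o : option 'I_n) (t : n.-tuple R) (x : E) (u : R) : ~~ row_act o ->
  (rV_of_tuple t, (x + u *: basis o).2) = (rV_of_tuple t, x.2) + u *: basis o.
Proof.
by case: o => // _; apply: (congr2 pair); rewrite //= scaler0 addr0.
Qed.

Let row_theta_pas (o : option 'I_n) (t : n.-tuple R) (x : E) (u : R) : ~~ row_act o ->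
  dotv (rV_of_tuple t) (x + u *: basis o).1 = dotv (rV_of_tuple t) x.1.
Proof. by case: o => // _; rewrite /= scaler0 addr0. Qed.

Let row_crd_pas (o : option 'I_n) (t : n.-tuple R) (x : E) : ~~ row_act o ->
  crd o (rV_of_tuple t, x.2) = crd o x.
Proof. by case: o. Qed.

Let row_by_parts f o x : sclass false f -> row_act o ->
  fourier_row (partial o f) x = - ('i * (crd o x)%:C * fourier_row f x).
Proof. by case: o => // i Sf _; exact: fourier_row_by_parts. Qed.

Lemma sclass_fourier_row b f : sclass b f -> sclass b (fourier_row f).
Proof.
by apply: (sclass_pfourier (@integrable_rweight R n) row_measurable row_bound
  row_rho_act row_theta_act row_rho_pas row_theta_pas row_crd_pas row_by_parts).
Qed.

Lemma fourier_last_row f : sclass false f -> fourier f = fourier_last (fourier_row f).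
Proof.
move=> Sf; apply/funext => y.
have Sg := sclass_mod y Sf.
have -> : fourier f y = integral_space (fun x => f x * expi (dot y x)).
  by apply: eq_cint => p; rewrite dotC.
rewrite (integral_space_R (sclass_tame Sg)); apply: eq_cint => t.
rewrite mulrC /fourier_row /integral_rV -cintZ; last first.
  exact: (tame_integrable_rV t (sclass_tame (sclass_mod_row y.1 Sf))).
by apply: eq_cint => v; rewrite /dot/= expiD [dotv y.1 _]dotvC [y.2 * _]mulrC; ring.
Qed.

Lemma fourier_row_last f : sclass false f -> fourier f = fourier_row (fourier_last f).
Proof.
move=> Sf; apply/funext => y.
have Sg := sclass_mod y Sf.
have -> : fourier f y = integral_space (fun x => f x * expi (dot y x)).
  by apply: eq_cint => p; rewrite dotC.
rewrite (integral_space_rV (sclass_tame Sg)); apply: eq_cint => v.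
rewrite mulrC /fourier_last -cintZ; last first.
  exact: (tame_integrable_R _ (sclass_tame (sclass_mod_last y.2 Sf))).
by apply: eq_cint => t; rewrite /dot/= expiD [dotv y.1 _]dotvC [y.2 * _]mulrC; ring.
Qed.

End FourierRowLast.

(** * The Fourier transform of exp(-a |t|) *)

Section PoissonKernel.
Context {R : realType}.
Local Notation leb := (@lebesgue_measure R).
Local Notation normc := Normc.normc.
Variables (a x : R).
Hypothesis a0 : 0 < a.

Definition abs_exp (t : R) : R := expR (- (a * `|t|)).

Lemma abs_exp_continuous : continuous abs_exp.
Proof.
move=> t; apply: (@continuous_comp _ _ _ (fun t : R => - (a * `|t|)) expR);
  last exact: continuous_expR.
by apply: cvgN; apply: cvgM; [exact: cvg_cst|exact: norm_continuous].
Qed.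

Lemma abs_exp_le1 t : abs_exp t <= 1.
Proof. by rewrite -expR0 ler_expR oppr_le0 mulr_ge0// ltW. Qed.

(** With y = a |t|, exp(y) = exp(y/2)^2 >= (1 + y/2)^2 >= 1 + (y/2)^2, and the inverse of the last
    term is [weight] dilated by a/2. *)
Lemma abs_exp_weight t : abs_exp t <= (1 + (a / 2) ^- 2) * weight t.
Proof.
apply: le_trans (weight_scale t _); last by rewrite mulf_neq0 ?invr_neq0 ?gt_eqF.
rewrite /abs_exp expRN /weight lef_pV2 ?posrE ?expR_gt0//.
have y0 : 0 <= a * `|t| / 2 by rewrite !mulr_ge0// ltW.
have -> : a * `|t| = a * `|t| / 2 + a * `|t| / 2 by field.
rewrite expRD -expr2.
apply: (@le_trans _ _ ((1 + a * `|t| / 2) ^+ 2)); last first.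
  by rewrite lerXn2r ?nnegrE ?expR_ge0 ?addr_ge0// expR_ge1Dx.
rewrite /oneDsqr sqrrD expr1n mul1r -addrA lerD2l.
have -> : (a / 2 * t) ^+ 2 = (a * `|t| / 2) ^+ 2.
  by rewrite !exprMn real_normK ?num_real//; ring.
by rewrite lerDr mulrn_wge0.
Qed.

Lemma abs_exp_integrable : leb.-integrable setT (EFin \o abs_exp).
Proof.
apply: le_integrable (integrable_weightZ (1 + (a / 2) ^- 2)) => //.
  by apply/measurable_EFinP; apply: continuous_measurable_fun; exact: abs_exp_continuous.
move=> t _ /=; rewrite lee_fin ger0_norm ?expR_ge0//.
by rewrite (le_trans (abs_exp_weight t))// ler_norm.
Qed.

(** Antiderivative of exp(b t) cos(t x), used at b = - a. *)
Let h (b t : R) : R := expR (b * t) * (x * sin (t * x) + b * cos (t * x)) / (b ^+ 2 + x ^+ 2).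

Let D_gt0 b : b ^+ 2 = a ^+ 2 -> 0 < b ^+ 2 + x ^+ 2.
Proof. by move=> ->; rewrite ltr_pwDl ?sqr_ge0 ?exprn_gt0. Qed.

Let h_derive b (t : R) : b ^+ 2 = a ^+ 2 ->
  is_derive t 1 (h b) (expR (b * t) * cos (t * x)).
Proof.
move=> /D_gt0 D0; rewrite /h.
have d1 : is_derive t 1 (fun t => b * t : R) b.
  by apply: is_derive_affine => s; rewrite /GRing.scale/=; ring.
have d2 : is_derive t 1 (fun t => t * x : R) x.
  by apply: is_derive_affine => s; rewrite /GRing.scale/=; ring.
have e := is_derive1_comp d1 (is_derive_expR (b * t)).
have s := is_derive1_comp d2 (is_derive_sin (t * x)).
have c := is_derive1_comp d2 (is_derive_cos (t * x)).
rewrite (_ : (fun t => _) = (fun t => (b ^+ 2 + x ^+ 2)^-1) *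
  ((fun t => expR (b * t)) * ((fun=> x) * (fun t => sin (t * x)) +
                              (fun=> b) * (fun t => cos (t * x))))); last first.
  by apply/funext => u; rewrite mulrC.
apply: is_derive_eq; rewrite /GRing.scale/=.
by rewrite !fctE; field; rewrite gt_eqF.
Qed.

Let h_bound t : `|h (- a) `|t| | <= (`|x| + a) / (a ^+ 2 + x ^+ 2) * abs_exp t.
Proof.
have D0 := D_gt0 (erefl (a ^+ 2)).
rewrite /h mulNr -/(abs_exp t) sqrrN -mulrA [leRHS]mulrC normrM.
rewrite [`|abs_exp _|]ger0_norm ?expR_ge0// ler_wpM2l ?expR_ge0//.
rewrite normrM normfV (gtr0_norm D0) ler_wpM2r ?invr_ge0 ?(ltW D0)//.
rewrite (le_trans (ler_normD _ _))// lerD// normrM.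
  by rewrite ler_piMr// ler_norml sin_geN1 sin_le1.
rewrite normrN (gtr0_norm a0) ler_piMr ?(ltW a0)//.
by rewrite ler_norml cos_geN1 cos_le1.
Qed.

(** Since [h (- a)] tends to 0 at +infinity, only the endpoint 0 contributes, with - h(-a)(0) = a /
    (a^2 + x^2). *)
Lemma half_integral : \int[leb]_(t in `[0, +oo[) (expR (- a * t) * cos (t * x)) =
  a / (a ^+ 2 + x ^+ 2).
Proof.
have D0 := D_gt0 (sqrrN a).
have cts : continuous (fun t => expR (- a * t) * cos (t * x)).
  move=> t; apply: cvgM.
    apply: (@continuous_comp _ _ _ (fun t : R => - a * t) expR); last exact: continuous_expR.
    by apply: cvgM; [exact: cvg_cst|exact: cvg_id].
  apply: (@continuous_comp _ _ _ (fun t : R => t * x) cos); last exact: continuous_cos.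
  by apply: cvgM; [exact: cvg_id|exact: cvg_cst].
have := @Rintegral_derive_cvg R `[0, +oo[%classic (fun=> 0) (fun n => n.+1%:R) (h (- a))
  (fun t => expR (- a * t) * cos (t * x)).
move=> cv; apply: (cvg_unique _ (cv _ _ _ _ _ _ _)) => //.
- by move=> n t /=; rewrite !in_itv/= => /andP[->].
- move=> t /=; rewrite in_itv/= andbT => t0; near=> n; rewrite in_itv/= t0/=.
  rewrite (@le_trans _ _ n%:R) ?ler_nat//; near: n; exact: nbhs_infty_ger.
- by move=> t; apply: h_derive; rewrite sqrrN.
- have ia : leb.-integrable `[0, +oo[%classic (EFin \o abs_exp).
    by apply: (integrableS measurableT) => //; exact: abs_exp_integrable.
  apply: le_integrable ia => //=.
  + apply/measurable_EFinP; apply: measurable_funTS; apply: continuous_measurable_fun => t.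
    exact: cts.
  + move=> t /=; rewrite in_itv/= andbT => t0; rewrite lee_fin normrM.
    rewrite [`|expR _|]ger0_norm ?expR_ge0// [`|abs_exp _|]ger0_norm ?expR_ge0//.
    rewrite /abs_exp (ger0_norm t0) mulNr.
    by rewrite ler_piMr ?expR_ge0// ler_norml cos_geN1 cos_le1.
- rewrite (_ : a / _ = 0 - h (- a) 0); last first.
    by rewrite /h mulr0 mul0r expR0 sin0 cos0 sqrrN; ring.
  apply: cvgB; last exact: cvg_cst.
  apply: (@weight_cvg0 R ((`|x| + a) / (a ^+ 2 + x ^+ 2) * (1 + (a / 2) ^- 2))) => n.
  have := h_bound n.+1%:R; rewrite [`|n.+1%:R|]ger0_norm// => /le_trans; apply.
  by rewrite -[leRHS]mulrA ler_wpM2l ?abs_exp_weight// divr_ge0 ?addr_ge0 ?sqr_ge0 ?(ltW a0)//.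
Unshelve. all: by end_near. Qed.

Lemma phase_integrable : cintegrable leb (fun t => (abs_exp t)%:C * expi (t * x)).
Proof.
apply: (@cintegrable_dominated _ _ (measurableTypeR R) leb _ abs_exp); last 1 first.
- by move=> t; rewrite Normc.normcM normc_expi mulr1 normc_real ger0_norm// expR_ge0.
- apply: cmeasurable_R; apply: ccontinuousM; last first.
    by apply: ccontinuous_expi => t; apply: cvgM; [exact: cvg_id|exact: cvg_cst].
  by split; [exact: abs_exp_continuous|exact: cst_continuous].
- exact: abs_exp_integrable.
Qed.

Lemma abs_expN t : abs_exp (- t) = abs_exp t.
Proof. by rewrite /abs_exp normrN. Qed.

Lemma Rintegral_opp (g : R -> R) : leb.-integrable setT (EFin \o g) ->
  \int[leb]_t g (- t) = \int[leb]_t g t.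
Proof.
move=> gi; rewrite (@Rintegral_affine _ (-1) 0 _ g gi) ?oppr_eq0 ?oner_eq0//.
rewrite normrN1 mul1r; apply: eq_Rintegral => t _.
by rewrite mulN1r addr0.
Qed.

(** The real part is even, hence twice the half-line integral; the imaginary part is odd, hence
    0. *)
Lemma poisson_kernel : complex_integral leb (fun t => (abs_exp t)%:C * expi (t * x)) =
  (2 * a / (a ^+ 2 + x ^+ 2))%:C.
Proof.
have [i1 i2] := phase_integrable.
apply: complex_ext => /=.
- pose g t := complex.Re ((abs_exp t)%:C * expi (t * x)); have gE t : g t = abs_exp t * cos (t * x).
    by rewrite /g reimE/= mul0r subr0.
  have U : [set: R] = `]-oo, 0[%classic `|` `[0, +oo[%classic.
    by apply/seteqP; split => t //= _; rewrite !in_itv/= andbT; case: (ltP t 0); [left|right].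
  have itvP (A : set R) : measurable A -> leb.-integrable A (EFin \o g).
    by move=> mA; apply: (integrableS measurableT).
  have gpos : \int[leb]_(t in `[0, +oo[) g t = a / (a ^+ 2 + x ^+ 2).
    rewrite -half_integral; apply: eq_Rintegral => t; rewrite inE/= in_itv/= andbT => t0.
    by rewrite gE /abs_exp ger0_norm// mulNr.
  rewrite -[LHS]/(\int[leb]_(t in setT) g t) U Rintegral_setU//; last 2 first.
  + by rewrite -U; exact: itvP.
  + apply/disj_setPS => t /=; rewrite !in_itv/= andbT => -[t0].
    by rewrite leNgt t0.
  rewrite gpos Rintegral_mkcond -Rintegral_opp; last first.
    by rewrite -restrict_EFin; apply/integrable_restrict => //; rewrite setTI; exact: itvP.
  have -> : \int[leb]_t (g \_ `]-oo, 0[) (- t) = \int[leb]_(t in `]0, +oo[) g t.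
    rewrite [RHS]Rintegral_mkcond; apply: eq_Rintegral => t _.
    rewrite !patchE; have -> : (- t \in `]-oo, 0[%classic) = (t \in `]0, +oo[%classic).
      by apply/idP/idP; rewrite !inE/= !in_itv/= andbT oppr_lt0.
    by case: ifP => // _; rewrite !gE abs_expN mulNr cosN.
  by rewrite Rintegral_itv_obnd_cbnd ?gpos; [ring|exact: itvP].
- pose g t := complex.Im ((abs_exp t)%:C * expi (t * x)); have gE t : g t = abs_exp t * sin (t * x).
    by rewrite /g reimE/= mul0r addr0.
  have : \int[leb]_t g (- t) = - \int[leb]_t g t.
    rewrite -mulN1r -RintegralZl//; apply: eq_Rintegral => t _.
    by rewrite !gE abs_expN mulNr sinN mulrN mulN1r.
  rewrite Rintegral_opp// => /eqP; rewrite -subr_eq0 opprK -mulr2n mulrn_eq0/=.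
  by move=> /eqP.
Qed.

End PoissonKernel.

(** * Fourier inversion on the line *)

Section Inversion.
Context {R : realType}.
Local Notation leb := (@lebesgue_measure R).
Local Notation normc := Normc.normc.
Local Notation Re := complex.Re.
Local Notation Im := complex.Im.

Lemma cmeasurable_caratheodory d (T : measurableType d)
    (F : T * measurableTypeR R -> R[i]) :
  (forall t, cmeasurable (fun x => F (x, t))) ->
  (forall x, ccontinuous (fun t : R => F (x, t))) -> cmeasurable F.
Proof.
move=> mF cF; split; apply: measurable_fun_caratheodory => [t|x].
- by case: (mF t).
- by case: (cF x).
- by case: (mF t).
- by case: (cF x).
Qed.

Lemma ccontinuous_real (T : topologicalType) (h : T -> R) :
  continuous h -> ccontinuous (fun x => (h x)%:C).
Proof. by move=> ch; split => //; exact: cst_continuous. Qed.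

Lemma ccontinuous_cst (T : topologicalType) (c : R[i]) : ccontinuous (fun _ : T => c).
Proof. by split; exact: cst_continuous. Qed.

Lemma mulr_continuous (c : R) : continuous (fun t : R => t * c).
Proof. by move=> t; apply: cvgM; [exact: cvg_id|exact: cvg_cst]. Qed.

Lemma affine_continuous (c e : R) : continuous (fun t : R => c * t + e).
Proof.
by move=> t; apply: cvgD; [apply: cvgM; [exact: cvg_cst|exact: cvg_id]|exact: cvg_cst].
Qed.

Lemma cintegrable_affine (c e : R) (h : R -> R[i]) : c != 0 -> cintegrable leb h ->
  cintegrable leb (fun t => h (c * t + e)).
Proof.
move=> c0 [h1 h2]; split; first exact: (integrable_affine e c0 h1).
exact: (integrable_affine e c0 h2).
Qed.

Section Inversion1.
Variables (f : R -> R[i]) (C D : R).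
Hypothesis cf : ccontinuous f.
Hypothesis fC : forall t, normc (f t) <= C * weight t.

Let g (xi : R) := complex_integral leb (fun t => f t * expi (t * xi)).

Hypothesis cg : ccontinuous g.
Hypothesis gD : forall t, normc (g t) <= D * weight t.

Let C0 : 0 <= C.
Proof. by have := le_trans (normc_ge0 _) (fC 0); rewrite pmulr_lge0 ?weight_gt0. Qed.

Let fi (xi : R) : cintegrable leb (fun t => f t * expi (t * xi)).
Proof.
apply: (@cintegrable_dominated _ _ (measurableTypeR R) leb _ (fun t => C * weight t)).
- apply: cmeasurable_R; apply: ccontinuousM => //.
  by apply: ccontinuous_expi; exact: mulr_continuous.
- exact: integrable_weightZ.
- by move=> t; rewrite Normc.normcM normc_expi mulr1.
Qed.

(** The factor exp(-a |xi|) makes the double integral absolutely convergent. Fubini then leaves the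
    Poisson kernel at t + tau, and the substitution t = a u - tau moves a out of the kernel and into
    f. *)
Let regularized (a tau : R) : 0 < a ->
  complex_integral leb (fun xi => (abs_exp a xi)%:C * (g xi * expi (xi * tau))) =
  complex_integral leb (fun u => (2 * weight u)%:C * f (a * u - tau)).
Proof.
move=> a0.
pose F (p : measurableTypeR R * measurableTypeR R) : R[i] :=
  f p.2 * ((abs_exp a p.1)%:C * expi (p.1 * (p.2 + tau))).
have Fi : cintegrable (leb \x leb)%E F.
  apply: (@cintegrable_dominated _ _ _ _ _
    (fun p : measurableTypeR R * measurableTypeR R => abs_exp a p.1 * (C * weight p.2))).
  - apply: cmeasurable_caratheodory => [t|x].
      apply: cmeasurable_R; apply: ccontinuousM; first exact: (@ccontinuous_cst _ (f t)).
      apply: ccontinuousM; first by apply: ccontinuous_real; exact: abs_exp_continuous.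
      by apply: ccontinuous_expi; exact: (@mulr_continuous (t + tau)).
    apply: ccontinuousM => //; apply: ccontinuousM.
      exact: (@ccontinuous_cst _ (abs_exp a x)%:C).
    apply: ccontinuous_expi.
    have -> : (fun t : R => x * (t + tau)) = (fun t => x * t + x * tau).
      by apply/funext => t; rewrite mulrDr.
    exact: affine_continuous.
  - exact: (integrable_prodM (abs_exp_integrable a0) (integrable_weightZ C)).
  - move=> p; rewrite !Normc.normcM normc_expi mulr1 normc_real ger0_norm ?expR_ge0//.
    by rewrite mulrC ler_wpM2l ?expR_ge0.
transitivity (complex_integral leb (fun xi => complex_integral leb (fun t => F (xi, t)))).
  apply: eq_cint => xi.
  rewrite [g xi * _]mulrC mulrA -cintZ; last exact: fi.
  by apply: eq_cint => t; rewrite /F/= mulrDr expiD [xi * t]mulrC; ring.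
rewrite -(cint_fubini1 Fi) (cint_fubini2 Fi).
transitivity (complex_integral leb (fun t => f t * (2 * a / (a ^+ 2 + (t + tau) ^+ 2))%:C)).
  apply: eq_cint => t; rewrite /F/= -poisson_kernel//.
  by rewrite -cintZ//; exact: phase_integrable.
(* The kernel is at most 2 / a, its value at t = - tau. *)
have Ki : cintegrable leb (fun t => f t * (2 * a / (a ^+ 2 + (t + tau) ^+ 2))%:C).
  apply: (@cintegrable_dominated _ _ (measurableTypeR R) leb _
    (fun t => (C * (2 / a)) * weight t)).
  - apply: cmeasurable_R; apply: ccontinuousM => //; apply: ccontinuous_real => t.
    apply: cvgM; first exact: cvg_cst.
    apply: cvgV; first by rewrite gt_eqF// ltr_pwDl ?sqr_ge0 ?exprn_gt0.
    apply: cvgD; first exact: cvg_cst.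
    by rewrite expr2; apply: cvgM; apply: cvgD; by [exact: cvg_id|exact: cvg_cst].
  - exact: integrable_weightZ.
  - move=> t; rewrite Normc.normcM normc_real [leRHS]mulrAC ler_pM ?normc_ge0//.
    have D0 : 0 < a ^+ 2 + (t + tau) ^+ 2 by rewrite ltr_pwDl ?sqr_ge0 ?exprn_gt0.
    rewrite ger0_norm ?divr_ge0 ?mulr_ge0 ?(ltW a0) ?(ltW D0)//.
    rewrite ler_pdivrMr// mulrAC ler_pdivlMr// -mulrA ler_wpM2l//.
    by rewrite -expr2 lerDl sqr_ge0.
have an0 : a != 0 by rewrite gt_eqF.
rewrite (cint_affine (- tau) an0 Ki) -cintZ; last exact: (cintegrable_affine (- tau) an0 Ki).
apply: eq_cint => u.
rewrite subrK exprMn (gtr0_norm a0) mulrCA mulrC -rmorphM /=; congr (_%:C * _).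
rewrite /weight /oneDsqr; field.
by rewrite !gt_eqF// ltr_pwDl ?sqr_ge0 ?exprn_gt0.
Qed.

(* The outer integral is regularized by exp(-a |xi|), a -> 0, which turns the
   inner one into a convolution with the Poisson kernel. *)
Lemma fourier_inversion_line (tau : R) :
  complex_integral leb (fun xi => g xi * expi (xi * tau)) = (2 * pi)%:C * f (- tau).
Proof.
pose a (k : nat) : R := k.+1%:R^-1.
have a0 k : 0 < a k by rewrite invr_gt0.
have a_to0 : a k @[k --> \oo] --> (0 : R) by exact: cvg_harmonic.
have cmul (c : R) (u : nat -> R) l : u k @[k --> \oo] --> l ->
    c * u k @[k --> \oo] --> c * l.
  by move=> ul; apply: cvgM => //; exact: cvg_cst.
have cphase : ccontinuous (fun xi => g xi * expi (xi * tau)).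
  by apply: ccontinuousM => //; apply: ccontinuous_expi; exact: mulr_continuous.
pose G k xi : R[i] := (abs_exp (a k) xi)%:C * (g xi * expi (xi * tau)).
(* As a tends to 0 the factor exp(-a |xi|) tends to 1; it is at most 1, so the bound on g
   dominates. *)
have [L1 L2] : Re (complex_integral leb (G k)) @[k --> \oo] -->
     Re (complex_integral leb (fun xi => g xi * expi (xi * tau))) /\
   Im (complex_integral leb (G k)) @[k --> \oo] -->
     Im (complex_integral leb (fun xi => g xi * expi (xi * tau))).
  have ex xi : abs_exp (a k) xi @[k --> \oo] --> (1 : R).
    rewrite -expR0 /abs_exp.
    apply: (@cvg_comp _ _ _ (fun k => - (a k * `|xi|)) expR _ (nbhs (0 : R))).
      rewrite -oppr0 -(mul0r `|xi|); apply: cvgN; apply: cvgM => //; exact: cvg_cst.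
    exact: continuous_expR.
  apply: (@cint_dominated_cvg _ _ (measurableTypeR R) leb _ _ (fun t => D * weight t)).
  - move=> k; apply: cmeasurable_R; apply: ccontinuousM => //.
    by apply: ccontinuous_real; exact: abs_exp_continuous.
  - exact: cmeasurable_R.
  - exact: integrable_weightZ.
  - move=> k xi; rewrite !Normc.normcM normc_expi mulr1 normc_real.
    rewrite ger0_norm ?expR_ge0// (le_trans _ (gD xi))// ler_piMl ?normc_ge0//.
    exact: abs_exp_le1.
  - move=> xi; rewrite (_ : (fun k => _) = fun k =>
        Re (g xi * expi (xi * tau)) * abs_exp (a k) xi).
      by have := cmul (Re (g xi * expi (xi * tau))) _ _ (ex xi); rewrite mulr1.
    by apply/funext => k; rewrite /G [LHS]ReM/= mul0r subr0 mulrC.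
  - move=> xi; rewrite (_ : (fun k => _) = fun k =>
        Im (g xi * expi (xi * tau)) * abs_exp (a k) xi).
      by have := cmul (Im (g xi * expi (xi * tau))) _ _ (ex xi); rewrite mulr1.
    by apply/funext => k; rewrite /G [LHS]ImM/= mul0r addr0 mulrC.
pose H k u : R[i] := (2 * weight u)%:C * f (a k * u - tau).
(* On the other side f(a u - tau) tends to f(- tau); f is bounded, so a multiple of [weight]
   dominates. *)
have [M1 M2] : Re (complex_integral leb (H k)) @[k --> \oo] -->
     Re (complex_integral leb (fun u => (2 * weight u)%:C * f (- tau))) /\
   Im (complex_integral leb (H k)) @[k --> \oo] -->
     Im (complex_integral leb (fun u => (2 * weight u)%:C * f (- tau))).
  have au u : a k * u - tau @[k --> \oo] --> - tau.
    rewrite -[X in _ --> X]add0r -[X in _ --> X + _](mul0r u).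
    apply: cvgB; last exact: cvg_cst.
    by apply: cvgM => //; exact: cvg_cst.
  have c2w : ccontinuous (fun u : R => (2 * weight u)%:C).
    by apply: ccontinuous_real; apply: continuousZr; exact: weight_continuous.
  apply: (@cint_dominated_cvg _ _ (measurableTypeR R) leb _ _ (fun t => (2 * C) * weight t)).
  - move=> k; apply: cmeasurable_R; apply: ccontinuousM => //.
    by apply: (ccontinuous_comp (g := fun u => a k * u - tau)) => //; exact: affine_continuous.
  - by apply: cmeasurable_R; apply: ccontinuousM => //; exact: ccontinuous_cst.
  - exact: integrable_weightZ.
  - move=> k u; rewrite Normc.normcM normc_real ger0_norm ?mulr_ge0 ?(ltW (weight_gt0 _))//.
    rewrite [leRHS]mulrAC ler_wpM2l ?mulr_ge0 ?(ltW (weight_gt0 _))//.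
    by rewrite (le_trans (fC _))// ler_piMr// weight_le1.
  - move=> u; rewrite (_ : (fun k => _) = fun k => 2 * weight u * Re (f (a k * u - tau))).
      rewrite ReM /= mul0r subr0; apply: cmul.
      exact: (cvg_comp _ _ (au u) (cf.1 (- tau))).
    by apply/funext => k; rewrite /H [LHS]ReM/= mul0r subr0.
  - move=> u; rewrite (_ : (fun k => _) = fun k => 2 * weight u * Im (f (a k * u - tau))).
      rewrite ImM /= mul0r addr0; apply: cmul.
      exact: (cvg_comp _ _ (au u) (cf.2 (- tau))).
    by apply/funext => k; rewrite /H [LHS]ImM/= mul0r addr0.
have GH : (fun k => complex_integral leb (G k)) = fun k => complex_integral leb (H k).
  by apply/funext => k; exact: regularized.
have E (h : R[i] -> R) :
    (fun k => h (complex_integral leb (G k))) = fun k => h (complex_integral leb (H k)).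
  by apply/funext => k; rewrite (congr1 (@^~ k) GH).
transitivity (complex_integral leb (fun u => (2 * weight u)%:C * f (- tau))).
  apply: complex_ext.
    by apply: (cvg_unique _ L1); rewrite ?E.
  by apply: (cvg_unique _ L2); rewrite ?E.
(* The mass pi of [weight] is the source of the constant 2 pi. *)
have W : complex_integral leb (fun u => (weight u)%:C) = pi%:C.
  apply: complex_ext => /=; last by rewrite /Rintegral integral0.
  by rewrite /Rintegral integral_weight.
have wi : cintegrable leb (fun u => (weight u)%:C).
  by split; [exact: integrable_weight|exact: integrable0].
have -> : (2 * pi)%:C = 2%:C * pi%:C :> R[i] by rewrite -rmorphM.
rewrite -W mulrAC -cintZ//.
apply: eq_cint => u; have -> : (2 * weight u)%:C = 2%:C * (weight u)%:C by rewrite -rmorphM.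
by ring.
Qed.

End Inversion1.

Section InversionRow.
Variable n : nat.
Local Notation E := ('rV[R]_n * R)%type.

Lemma fourier_last_last (f : E -> R[i]) v t : sclass false f ->
  fourier_last (fourier_last f) (v, t) = (2 * pi)%:C * f (v, - t).
Proof.
move=> Sf; have Sg := sclass_fourier_last Sf.
have [C _ fC] := tame_bound (sclass_tame Sf).
have [D _ gD] := tame_bound (sclass_tame Sg).
apply: (@fourier_inversion_line (fun t => f (v, t)) C D).
- exact: (ccontinuous_comp (@slice_continuous2 _ _ v) (sclass_continuous Sf)).
- by move=> s; have [] := fC (v, s).
- exact: (ccontinuous_comp (@slice_continuous2 _ _ v) (sclass_continuous Sg)).
- by move=> s; have [] := gD (v, s).
Qed.

End InversionRow.

End Inversion.

Section RowInversion.
Context {R : realType}.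

Lemma sclass_fourier n (f : 'rV[R]_n * R -> R[i]) :
  sclass false f -> sclass false (fourier f).
Proof.
move=> Sf; rewrite fourier_last_row//.
exact/sclass_fourier_last/sclass_fourier_row.
Qed.

(* [fourier_row_row] in dimension n gives inversion for F in dimension n + 1,
   which after slicing gives [fourier_row_row] in dimension n + 1. *)
Lemma fourier_fourier_of_row n (g : 'rV[R]_n * R -> R[i]) v t : sclass false g ->
  (forall (f : 'rV[R]_n * R -> R[i]) w s, sclass false f ->
    fourier_row (fourier_row f) (w, s) = ((2 * pi) ^+ n)%:C * f (- w, s)) ->
  fourier (fourier g) (v, t) = ((2 * pi) ^+ n.+1)%:C * g (- v, - t).
Proof.
move=> Sg row_row; have Sl := sclass_fourier_last Sg.
rewrite (fourier_last_row (sclass_fourier Sg)) (fourier_row_last Sg).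
rewrite {1}/fourier_last/= exprSr rmorphM -mulrA -fourier_last_last//.
have Sl2 := sclass_mod_last t Sl.
rewrite {3}/fourier_last/= -cintZ; last exact: (tame_integrable_R (- v) (sclass_tame Sl2)).
by apply: eq_cint => s; rewrite row_row// mulrA.
Qed.

(** With one coordinate of R^(n+1) taken as the last variable, Q in dimension n + 1 is the full
    transform F on R^n x R. *)
Lemma fourier_row_cons n (f : 'rV[R]_n.+1 * R -> R[i]) s : sclass false f ->
  (fun p : 'rV[R]_n * R => fourier_row f (consrow p.2 p.1, s)) =
  fourier (fun p : 'rV[R]_n * R => f (consrow p.2 p.1, s)).
Proof.
move=> Sf; apply/funext => -[v t].
have Sg := sclass_mod_row (consrow t v) Sf.
rewrite /fourier_row/= (integral_rV_cons s (sclass_tame Sg)).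
by apply: eq_cint => p; rewrite /dot/= dotv_consrow addrC.
Qed.

Lemma fourier_row_row n (f : 'rV[R]_n * R -> R[i]) v s : sclass false f ->
  fourier_row (fourier_row f) (v, s) = ((2 * pi) ^+ n)%:C * f (- v, s).
Proof.
elim: n f v s => [|n ih] f v s Sf.
  (* R^0 is a point of mass 1, so Q is the identity in dimension 0. *)
  have row0 (g : 'rV[R]_0 * R -> R[i]) w : fourier_row g (w, s) = g (w, s).
    have -> : fourier_row g (w, s) = complex_integral (lebesgue_tuple 0) (fun=> g (w, s)).
      apply: eq_cint => u; rewrite /dotv big_ord0 expi0 mulr1.
      by congr (g (_, _)); apply/rowP => -[].
    have m1 : fine (lebesgue_tuple 0 [set: 0.-tuple (measurableTypeR R)]) = 1.
      by rewrite -[lebesgue_tuple 0]/(\d_ [tuple] : set _ -> \bar R) diracT.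
    by apply: complex_ext; rewrite /complex_integral/= Rintegral_cst// m1 mulr1.
  rewrite !row0 expr0 mul1r; congr (f (_, _)).
  by apply/rowP => -[].
rewrite {1}[v]consrow_rV.
have := fourier_row_cons s (sclass_fourier_row Sf).
rewrite (fourier_row_cons s Sf).
move=> /(congr1 (@^~ (\row_j v 0 (lift ord0 j), v 0 ord0))) /= ->.
rewrite fourier_fourier_of_row//; last exact: sclass_slice.
congr (_ * f (_, _)); apply/rowP => i; case: (unliftP ord0 i) => [j|] ->.
  by rewrite consrow_lift !mxE.
by rewrite consrow0 mxE.
Qed.

Lemma fourier_fourier n (g : 'rV[R]_n * R -> R[i]) x : sclass false g ->
  fourier (fourier g) x = ((2 * pi) ^+ n.+1)%:C * g (- x).
Proof.
case: x => v t Sg; apply: fourier_fourier_of_row => // f w s.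
exact: fourier_row_row.
Qed.

End RowInversion.

(** * Psi as an invariant class *)

Section Flat.
Context {R : realType} (n : nat).
Local Notation E := ('rV[R]_n * R)%type.
Implicit Types f : E -> R[i].

Lemma twopi_neq0 : (2 * pi : R) != 0.
Proof. by rewrite mulf_neq0 ?gt_eqF ?pi_gt0. Qed.

Lemma twopiX_neq0 k : ((2 * pi : R) ^+ k)%:C != 0.
Proof. by rewrite fmorph_eq0 expf_neq0 ?twopi_neq0. Qed.

Lemma fourier_last_inj f g : sclass false f -> sclass false g ->
  fourier_last f = fourier_last g -> f = g.
Proof.
move=> Sf Sg fg; apply/funext => -[v t].
have := fourier_last_last v (- t) Sf; rewrite fg fourier_last_last// opprK.
by move=> /mulfI-> //; have := twopiX_neq0 1; rewrite expr1.
Qed.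

Lemma hasd_crd_mul o o' f x l : hasd (basis o') f x l ->
  hasd (basis o') (fun y => (crd o y)%:C * f y) x ((o == o')%:R * f x + (crd o x)%:C * l).
Proof.
move=> fl; have := hasdM (hasd_real (is_derive_crd o o' x)) fl.
by rewrite rmorph_nat.
Qed.

(* P intertwines the last derivative with a multiplication that commutes with
   the other derivatives, and P is injective. *)
Lemma partialC f i : sclass false f ->
  partial (Some i) (partial None f) = partial None (partial (Some i) f).
Proof.
move=> Sf; apply: fourier_last_inj; [exact/sclass_partial/sclass_partial..|].
have SN := sclass_partial None Sf; have Si := sclass_partial (Some i) Sf.
transitivity (partial (Some i) (fourier_last (partial None f))).
  exact: esym (partial_fourier_last i SN).
apply/funext => x.
have Sl := sclass_fourier_last Sf.
transitivity (- ('i * (x.2)%:C * partial (Some i) (fourier_last f) x)); last first.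
  by rewrite (partial_fourier_last i Sf); exact: esym (fourier_last_by_parts x Si).
apply: hasd_partial.
have -> : fourier_last (partial None f) =
    fun y => - 'i * ((crd None y)%:C * fourier_last f y).
  by apply/funext => y; rewrite (fourier_last_by_parts y Sf) mulNr mulrA.
have := hasdZ (- 'i) (hasd_crd_mul None (sclass_hasd (Some i) x Sl)).
by congr (hasd _ _ _ _); rewrite /= mul0r add0r; ring.
Qed.

(** Psi prescribes only the pure derivatives in the last variable. The invariant set therefore keeps
    with each function the whole sequence of these derivatives, all in the Schwartz class and zero
    on the hyperplane, and stability is checked on sequences. *)
Lemma PsiP f : Psi f <-> sclass true f.
Proof.
split=> [[Sf flat]|Sf]; last first.
  split=> [|k v]; first exact: sclass_schwartz Sf.
  by apply: sclass_vanish; elim: k => //= k; exact: sclass_partial.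
pose K := [set g : E -> R[i] | exists F : nat -> E -> R[i],
  [/\ F 0%N = g, forall k, sclass false (F k), forall k, partial None (F k) = F k.+1 &
    forall k v, F k (v, 0) = 0]].
exists K; last first.
  exists (fun k => partials (nseq k None) f); split => // k.
  by elim: k => /= [|k]; [exact: schwartz_sclass|exact: sclass_partial].
move=> _ [F [<- SF dF F0]]; split.
- exact: sclass_bounded (SF 0%N).
- case=> [i|]; last first.
    exists (F 1%N); first by exists (fun k => F k.+1); split.
    by move=> x; rewrite -dF; exact: sclass_hasd (SF 0%N).
  exists (partial (Some i) (F 0%N)); last by move=> x; exact: sclass_hasd (SF 0%N).
  exists (fun k => partial (Some i) (F k)); split => // [k|k|k v].
  + exact: sclass_partial.
  + by rewrite -partialC// dF.
  (* A derivative along the hyperplane of a function that vanishes on it. *)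
  + apply: hasd_partial.
    apply: (hasd_transfer (w := basis (Some i)) (y := (v, 0)))
      (hasd_cst (basis (Some i)) (0 : R[i]) ((v, 0) : E)) => s /=.
    have -> : (v, 0) + s *: (delta_mx 0 i, 0) = (v + s *: delta_mx 0 i, 0) :> E.
      by apply: (congr2 pair) => //=; rewrite scaler0 addr0.
    exact: F0.
- case=> [i|].
    exists (fun k x => (crd (Some i) x)%:C * F k x); split => // [k|k|k v].
    + exact: sclass_crd.
    + apply/funext => x; apply: hasd_partial.
      have := hasd_crd_mul (Some i) (sclass_hasd None x (SF k)).
      by rewrite /= mul0r add0r dF.
    + by rewrite F0 mulr0.
  (* Leibniz rule for the k-th derivative of the last coordinate times [F 0]. At k = 0 the truncated
     index [k.-1] carries the coefficient 0. *)
  exists (fun k x => k%:R * F k.-1 x + (crd None x)%:C * F k x); split => // [|k|k|k v].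
  + by apply/funext => x; rewrite mul0r add0r.
  + by apply: sclass_comb => //; exact: sclass_crd.
  + apply/funext => x; apply: hasd_partial.
    have := hasdD (hasdZ k%:R (sclass_hasd None x (SF k.-1)))
      (hasd_crd_mul None (sclass_hasd None x (SF k))).
    rewrite !dF; congr (hasd _ _ _ _).
    case: k => [|k] /=; first by rewrite mul0r add0r.
    by rewrite addrA -mulrDl -(natrD _ _ 1) addn1.
  + by rewrite !F0 !mulr0 addr0.
- by move=> _ v; exact: F0.
Qed.

End Flat.

(** * Powers of the last variable and dilations on Psi *)

Section DirectionalDerivative.
Context {R : realType} (V : normedModType R).
Local Notation normc := Normc.normc.

Lemma is_deriveP (f : V -> R) (x v : V) l :
  (f (x + h *: v) - f x) / h @[h --> 0^'] --> l -> is_derive x v f l.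
Proof.
move=> fl.
have fl' : (fun h => h^-1 *: ((f \o shift x) (h *: v) - f x)) @ 0^' --> l.
  by under eq_fun do rewrite /= [_ + x]addrC /GRing.scale/= mulrC.
split; first by apply/cvg_ex; exists l.
exact: (cvg_lim _ fl').
Qed.

Lemma is_derive_lim (f : V -> R) (x v : V) l : is_derive x v f l ->
  (f (x + h *: v) - f x) / h @[h --> 0^'] --> l.
Proof.
move=> [d <-].
by under eq_fun do rewrite [x + _]addrC mulrC; exact: d.
Qed.

(** The increment along v + w is split at x + h w. The part from x to x + h w is the derivative
    along w; the other is treated by the mean value theorem along v and the continuity of [gv]. *)
Lemma is_derive_dirD (f gv gw : V -> R) (v w x : V) :
  (forall z, is_derive z v f (gv z)) -> is_derive x w f (gw x) ->
  continuous gv -> is_derive x (v + w) f (gv x + gw x).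
Proof.
move=> fv fw cg; apply: is_deriveP.
rewrite (_ : (fun h => _) = fun h : R =>
  (f (x + h *: (v + w)) - f (x + h *: w)) / h + (f (x + h *: w) - f x) / h); last first.
  by apply/funext => h; rewrite -mulrDl; congr (_ / _); ring.
apply: cvgD; last exact: is_derive_lim fw.
apply/cvgrPdist_le => e e0.
have /cvgrPdist_le/(_ _ e0)/nbhs_ballP[d /= d0 gd] := cg x.
(* The added 1 keeps the divisor positive even when v = w = 0. *)
have M0 : 0 < `|v| + `|w| + 1 by rewrite ltr_wpDl// addr_ge0.
near=> h.
have h0 : h != 0 by near: h; exact: nbhs_dnbhs_neq.
have hd : `|h| < d / (`|v| + `|w| + 1).
  near: h; apply: dnbhs0_lt; exact: divr_gt0.
have [c c1 c2] := @MVT_line R (fun s => f (x + h *: w + s *: v))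
  (fun s => gv (x + h *: w + s *: v)) 0 h (fun t => (is_derive_line _ _ _ _ _).2 (fv _)).
have -> : x + h *: (v + w) = x + h *: w + h *: v by rewrite scalerDr addrAC addrA.
move: c2; rewrite scale0r addr0 !subr0 => ->; rewrite mulfK//.
apply: gd; rewrite -ball_normE /= -addrA opprD addNKr normrN.
rewrite (le_lt_trans (ler_normD _ _))// !normrZ.
rewrite !subr0 in c1.
rewrite (@le_lt_trans _ _ (`|h| * (`|v| + `|w| + 1)))//; last by rewrite -ltr_pdivlMr.
rewrite !mulrDr mulr1 [X in _ <= X + _]addrC -[leLHS]addr0 lerD// lerD//.
by rewrite ler_wpM2r.
Unshelve. all: by end_near. Qed.

Lemma hasd_dirD (f gv : V -> R[i]) (v w x : V) l :
  (forall z, hasd v f z (gv z)) -> hasd w f x l -> ccontinuous gv ->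
  hasd (v + w) f x (gv x + l).
Proof.
move=> fv [w1 w2] [c1 c2]; split; rewrite ?ReD ?ImD.
  apply: (is_derive_dirD (gw := fun=> complex.Re l) _ w1 c1) => z.
  by case: (fv z).
apply: (is_derive_dirD (gw := fun=> complex.Im l) _ w2 c2) => z.
by case: (fv z).
Qed.

Lemma hasd_dirZ (f : V -> R[i]) (v x : V) l (c : R) :
  hasd v f x l -> hasd (c *: v) f x (c%:C * l).
Proof.
move=> fl.
have x0 : x + 0 *: (c *: v) = x by rewrite scale0r addr0.
rewrite -{1}x0; apply/hasd_line.
have d : is_derive (0 : R) 1 (fun s : R => s * c) c.
  by apply: is_derive_affine => s; rewrite /GRing.scale/=; ring.
have [h1 h2] : hasd (1 : R^o) (fun s : R => f (x + s *: v)) (0 * c) l.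
  by apply/hasd_line; rewrite mul0r scale0r addr0.
split; rewrite reimE/= ?mul0r ?subr0 ?addr0.
  have := is_derive1_comp d h1; congr (is_derive _ _ _ _).
  by apply/funext => s; rewrite scalerA.
have := is_derive1_comp d h2; congr (is_derive _ _ _ _).
by apply/funext => s; rewrite scalerA.
Qed.

(** Serves on the hyperplane, where the powers of the last coordinate cannot be differentiated but
    flatness provides a quadratic bound. *)
Lemma hasd_quadratic (f : V -> R[i]) (v x : V) (C : R) :
  f x = 0 -> (forall s : R, normc (f (x + s *: v)) <= C * s ^+ 2) ->
  hasd v f x 0.
Proof.
move=> fx0 fC.
have H (g : V -> R) : g x = 0 -> (forall s : R, `|g (x + s *: v)| <= C * s ^+ 2) ->
    is_derive x v g 0.
  move=> gx0 gC; apply: is_deriveP; rewrite gx0.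
  have cv : C * `|h| @[h --> (0 : R)^'] --> (0 : R).
    have ch : continuous (fun h : R => C * `|h|).
      by apply: continuousZr; exact: norm_continuous.
    have := ch 0; rewrite /continuous_at normr0 mulr0; apply: cvg_trans.
    by apply: cvg_app; exact: nbhs_dnbhs.
  apply: norm_cvg0; apply: (@squeeze_cvgr _ _ _ _ (cst 0)) cv; last exact: cvg_cst.
  near=> h; rewrite normr_ge0/= subr0 normrM normfV ler_pdivrMr; last first.
    by rewrite normr_gt0; near: h; exact: nbhs_dnbhs_neq.
  by rewrite -mulrA -expr2 real_normK ?num_real.
split; apply: H => [|s]; rewrite ?fx0//.
  exact: le_trans (normc_Re _) (fC s).
exact: le_trans (normc_Im _) (fC s).
Unshelve. all: by end_near. Qed.

End DirectionalDerivative.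

Section FlatFunctions.
Context {R : realType} (n : nat).
Local Notation E := ('rV[R]_n * R)%type.
Local Notation normc := Normc.normc.
Implicit Types f : E -> R[i].

(** Continuity of the partial derivatives makes the derivative linear in the direction. Used for
    [dilate], whose derivative in s is taken along (- a, 1). *)
Lemma sclass_hasd_dir b f w x : sclass b f ->
  hasd w f x (\sum_o (crd o w)%:C * partial o f x).
Proof.
move=> Sf; rewrite {1}[w]crd_sum.
elim: (index_enum _) => [|o r ih].
  rewrite !big_nil; apply: (hasd_transfer (w := 0 : E) (y := x)) (hasd_cst 0 (f x) x) => s.
  by rewrite scaler0 addr0.
rewrite !big_cons.
apply: (@hasd_dirD _ _ _ (fun z => (crd o w)%:C * partial o f z)) => //.
- by move=> z; apply: hasd_dirZ; exact: sclass_hasd Sf.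
- apply: ccontinuousM; first exact: ccontinuous_cst.
  exact: sclass_continuous (sclass_partial o Sf).
Qed.

(** Each power comes from the mean value theorem along the last direction, starting on the
    hyperplane where f vanishes, with the previous bound applied to the last derivative. The
    constant doubles because real and imaginary parts are bounded separately. *)
Lemma sclass_flat f k : sclass true f ->
  exists C : R, forall x, normc (f x) <= C * `|x.2| ^+ k.
Proof.
elim: k f => [|k ih] f Sf.
  by have [C fC] := sclass_bounded Sf; exists C => x; rewrite expr0 mulr1.
have [C fC] := ih _ (sclass_partial None Sf); exists (2 * C) => -[v s] /=.
have C0 : 0 <= C.
  by have := le_trans (normc_ge0 _) (fC (0, 1)); rewrite normr1 expr1n mulr1.
have d t : hasd (1 : R^o) (fun t : R => f (v, t)) t (partial None f (v, t)).
  apply: (hasd_transfer _ (sclass_hasd None (v, t) Sf)) => u.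
  by congr (f _); apply: (congr2 pair); rewrite /= ?scaler0 ?addr0.
have H (h dh : R -> R) : (forall t : R, is_derive t 1 h (dh t)) -> h 0 = 0 ->
    (forall t, `|dh t| <= C * `|t| ^+ k) -> `|h s| <= C * `|s| ^+ k.+1.
  move=> hd h0 dhC; have [c + +] := MVT_line 0 s hd.
  rewrite !subr0 h0 subr0 => cs ->; rewrite normrM exprSr mulrA ler_wpM2r//.
  by rewrite (le_trans (dhC c))// ler_wpM2l// lerXn2r ?nnegrE.
rewrite (le_trans (normc_le _))// -mulrA mulr_natl mulr2n lerD//.
  apply: (H (fun t => complex.Re (f (v, t)))
            (fun t => complex.Re (partial None f (v, t)))) => [t||t].
  - by case: (d t).
  - by rewrite sclass_vanish.
  - exact: le_trans (normc_Re _) (fC (v, t)).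
apply: (H (fun t => complex.Im (f (v, t)))
          (fun t => complex.Im (partial None f (v, t)))) => [t||t].
- by case: (d t).
- by rewrite sclass_vanish.
- exact: le_trans (normc_Im _) (fC (v, t)).
Qed.

End FlatFunctions.

Section Cpow.
Context {R : realType}.
Local Notation normc := Normc.normc.

Lemma cpowRD (t : R) z w : cpowR t (z + w) = cpowR t z * cpowR t w.
Proof.
by rewrite /cpowR ReD ImD !mulrDl expRD rmorphM expiD mulrACA.
Qed.

Lemma cpowR0 (t : R) : cpowR t 0 = 1.
Proof. by rewrite /cpowR/= !mul0r expR0 expi0 mulr1. Qed.

Lemma cpowRn (t : R) n : 0 < t -> cpowR t n%:R = (t ^+ n)%:C.
Proof.
move=> t0; have -> : n%:R = (n%:R : R)%:C :> R[i] by rewrite rmorph_nat.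
by rewrite /cpowR/= mul0r expi0 mulr1 expRM_natl lnK.
Qed.

Lemma normc_cpowR (t : R) z : normc (cpowR t z) = expR (complex.Re z * ln t).
Proof. by rewrite Normc.normcM normc_expi mulr1 normc_real ger0_norm ?expR_ge0. Qed.

(** The modulus lies below t^N or t^-N according to the side of 1 on which t lies; the sum covers
    both. *)
Lemma normc_cpowR_le (t : R) z N : 0 < t -> `|complex.Re z| <= N%:R ->
  normc (cpowR t z) <= t ^+ N + t ^- N.
Proof.
move=> t0 zN; rewrite normc_cpowR.
have tN : t ^+ N = expR (N%:R * ln t) by rewrite expRM_natl lnK.
have tN' : t ^- N = expR (- (N%:R * ln t)) by rewrite expRN -tN.
apply: (@le_trans _ _ (expR (`|N%:R * ln t|))).
  rewrite ler_expR (le_trans (ler_norm _))// !normrM ler_wpM2r//.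
  by rewrite [leRHS]ger0_norm.
rewrite tN' tN; case: (ger0P (N%:R * ln t)) => _.
  by rewrite lerDl expR_ge0.
by rewrite lerDr expR_ge0.
Qed.

Lemma ln_norm_derive (t : R) : t != 0 -> is_derive t 1 (fun s : R => ln `|s|) t^-1.
Proof.
move=> t0.
(* Half the logarithm of the square avoids differentiating the absolute value; at s = 0 both sides
   are 0 by the default value of [ln]. *)
have E : (fun s : R => ln `|s|) = fun s => ln (s * s) * 2^-1.
  apply/funext => s; have [->|s0] := eqVneq s 0; first by rewrite normr0 mulr0 ln0 ?mul0r.
  rewrite -expr2 -real_normK ?num_real// lnXn ?normr_gt0//.
  by rewrite mulr2n; field.
have t2 : 0 < t * t by rewrite -expr2 exprn_even_gt0.
have d1 : is_derive t 1 (fun s => s * s) (t + t).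
  by apply: is_derive_eq; rewrite /GRing.scale/= !mulr1.
have d := is_derive1_comp d1 (is_derive1_ln t2).
have d2 : is_derive (ln (t * t)) 1 (fun s => s * 2^-1 : R) 2^-1.
  by apply: is_derive_affine => s; rewrite /GRing.scale/=; ring.
rewrite E.
have := is_derive1_comp d d2; congr (is_derive _ _ _ _).
by field.
Qed.

Lemma cpowR_derive (t : R) z : t != 0 ->
  hasd (1 : R^o) (fun s : R => cpowR `|s| z) t (z * (t^-1)%:C * cpowR `|t| z).
Proof.
move=> t0; have d := ln_norm_derive t0.
have dl (c : R) : is_derive t 1 (fun s : R => c * ln `|s|) (c * t^-1).
  have l : is_derive (ln `|t|) 1 (fun s => c * s : R) c.
    by apply: is_derive_affine => s; rewrite /GRing.scale/=; ring.
  by have := is_derive1_comp d l; rewrite mulrC.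
have e := is_derive1_comp (dl (complex.Re z)) (is_derive_expR _).
have := hasdM (hasd_real e) (hasd_expi (dl (complex.Im z))).
congr (hasd _ _ _ _); rewrite /cpowR !rmorphM/=.
rewrite [X in _ = X * _ * _](complexE z).
rewrite complexiE; ring.
Qed.

End Cpow.

Section MulPow.
Context {R : realType} (n : nat).
Local Notation E := ('rV[R]_n * R)%type.
Local Notation normc := Normc.normc.
Implicit Types f : E -> R[i].

(* [cpowR 0 z = 1] and [0^-1 = 0], so that this is a junk multiple of f on the
   hyperplane x.2 = 0, where the elements of Psi vanish. *)
Definition mulpow (z : R[i]) (k : nat) f (x : E) : R[i] :=
  cpowR `|x.2| z * (x.2^-1 ^+ k)%:C * f x.

Lemma mulpow_vanish z k f v : sclass true f -> mulpow z k f (v, 0) = 0.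
Proof. by move=> Sf; rewrite /mulpow sclass_vanish// mulr0. Qed.

Lemma sclass_crdX b f o j : sclass b f -> sclass b (fun x => (crd o x ^+ j)%:C * f x).
Proof.
move=> Sf; elim: j => [|j ih].
  by rewrite (_ : (fun x => _) = f)//; apply/funext => x; rewrite mul1r.
rewrite (_ : (fun x => _) = fun x => (crd o x)%:C * ((crd o x ^+ j)%:C * f x)).
  exact: sclass_crd.
by apply/funext => x; rewrite exprS rmorphM mulrA.
Qed.

(** The modulus of |s|^z is at most |s|^N + |s|^-N. Against s^-k, the first term is absorbed by
    flatness of s^N f to order k, the second by flatness of f to order N + k. *)
Lemma mulpow_bounded z k f : sclass true f ->
  exists C : R, forall x, normc (mulpow z k f x) <= C.
Proof.
move=> Sf.
have [N zN] : exists N, `|complex.Re z| <= N%:R.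
  exists (Num.bound `|complex.Re z|); apply: ltW; exact: archi_boundP.
have [C fC] := sclass_flat (N + k) Sf.
have [D gD] := sclass_flat k (sclass_crdX None N Sf).
have C0 : 0 <= C.
  by have := le_trans (normc_ge0 _) (fC (0, 1)); rewrite normr1 expr1n mulr1.
have D0 : 0 <= D.
  by have := le_trans (normc_ge0 _) (gD (0, 1)); rewrite normr1 expr1n mulr1.
exists (D + C) => -[v s]; have [->|s0] := eqVneq s 0.
  by rewrite mulpow_vanish// Normc.normc0 addr_ge0.
have t0 : 0 < `|s| by rewrite normr_gt0.
rewrite /mulpow/= (Normc.normcM (cpowR _ _ * _)) (Normc.normcM (cpowR _ _)).
rewrite normc_real normrX normfV -mulrA.
have Z := normc_cpowR_le t0 zN.
apply: (@le_trans _ _ ((`|s| ^+ N + `|s| ^- N) * (`|s|^-1 ^+ k * normc (f (v, s))))).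
  by rewrite ler_wpM2r ?mulr_ge0 ?exprn_ge0 ?invr_ge0 ?normc_ge0.
rewrite mulrDl lerD//.
  have := gD (v, s); rewrite /= Normc.normcM normc_real normrX => h.
  by rewrite mulrCA exprVn mulrC ler_pdivrMr ?exprn_gt0.
have := fC (v, s); rewrite /= => h.
by rewrite mulrA exprVn -invfM -exprD mulrC ler_pdivrMr ?exprn_gt0.
Qed.

(** Dividing j more times by s and multiplying back by s^j: the quotient is still bounded. *)
Lemma mulpow_flat z k j f : sclass true f ->
  exists C : R, forall x, normc (mulpow z k f x) <= C * `|x.2| ^+ j.
Proof.
move=> Sf; have [C fC] := mulpow_bounded z (k + j) Sf; exists C => -[v s].
have C0 : 0 <= C by exact: le_trans (normc_ge0 _) (fC 0).
have [->|s0] := eqVneq s 0.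
  by rewrite mulpow_vanish// Normc.normc0 mulr_ge0.
have -> : mulpow z k f (v, s) = (s ^+ j)%:C * mulpow z (k + j) f (v, s).
  rewrite /mulpow/= exprD [(_ * _)%:C]rmorphM.
  have E : (s ^+ j)%:C * (s^-1 ^+ j)%:C = 1 :> R[i].
    by rewrite -rmorphM -exprMn mulfV// expr1n.
  by rewrite -[LHS]mulr1 -E; ring.
by rewrite Normc.normcM normc_real normrX mulrC ler_wpM2r.
Qed.

(** The derivative of |s|^z s^-k is (z - k) |s|^z s^(-k-1); writing the remaining term with one
    further division by s puts everything in the form [mulpow z k.+1] of an element of Psi. *)
Lemma hasd_mulpow_last z k f x : sclass true f ->
  hasd (basis None) (mulpow z k f) x
    (mulpow z k.+1 (fun y => (z - k%:R) * f y + (crd None y)%:C * partial None f y) x).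
Proof.
move=> Sf; case: x => v s; have [->|s0] := eqVneq s 0.
  rewrite mulpow_vanish; last first.
    apply: sclass_comb => //; apply: sclass_crd; exact: sclass_partial.
  (* On the hyperplane flatness of order 2 gives derivative 0, which is the value claimed there. *)
  have [C fC] := mulpow_flat z k 2 Sf.
  apply: (@hasd_quadratic _ _ _ _ _ C); first exact: mulpow_vanish.
  move=> t; rewrite (le_trans (fC _))//= add0r real_normK ?num_real//.
  by rewrite [t *: 1]mulr1.
have c : hasd (basis None) (fun x : E => cpowR `|x.2| z) (v, s)
    (z * (s^-1)%:C * cpowR `|s| z).
  apply: (hasd_transfer _ (cpowR_derive z s0)) => u.
  by [].
have i : hasd (basis None) (fun x : E => (x.2^-1 ^+ k)%:C) (v, s)
    (- (k%:R * s^-1 ^+ k.+1))%:C.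
  have d : is_derive s 1 (fun t : R => t^-1 ^+ k) (- (k%:R * s^-1 ^+ k.+1)).
    have d0 : is_derive s 1 (fun t : R => t^-1) (- s ^- 2).
      by have := is_deriveV s0 (is_derive_id s 1); rewrite scaler1.
    have := @is_deriveX _ _ (fun t : R => t^-1) k s 1 _ d0; congr (is_derive _ _ _ _).
      by apply/funext => t; rewrite fctE.
    rewrite /GRing.scale/=; case: (k) => [|j]; first by rewrite !mul0r oppr0.
    by rewrite /= !exprS; field.
  by apply: (hasd_transfer _ (hasd_real d)) => u.
have := hasdM (hasdM c i) (sclass_hasd None (v, s) Sf).
congr (hasd _ _ _ _); rewrite /mulpow/= exprS.
have E : s%:C * (s^-1)%:C = 1 :> R[i] by rewrite -rmorphM mulfV.
have -> : (- (k%:R * (s^-1 * s^-1 ^+ k)))%:C = - (k%:R * ((s^-1)%:C * (s^-1 ^+ k)%:C)) :> R[i].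
  by rewrite rmorphN !rmorphM rmorph_nat.
have -> : (s^-1 * s^-1 ^+ k)%:C = (s^-1)%:C * (s^-1 ^+ k)%:C by rewrite rmorphM.
set P := cpowR _ _; set q := (_ ^+ k)%:C; set r := (s^-1)%:C; set F := f _; set G := partial _ _ _.
rewrite [X in _ + X](_ : _ = P * q * G * (s%:C * r)); last by rewrite E mulr1.
by rewrite /r; ring.
Qed.

Lemma hasd_mulpow_row z k f x i b : sclass b f ->
  hasd (basis (Some i)) (mulpow z k f) x (mulpow z k (partial (Some i) f) x).
Proof.
move=> Sf; pose c := cpowR `|x.2| z * (x.2^-1 ^+ k)%:C.
apply: (hasd_transfer (w := basis (Some i)) (y := x) (g := fun y => c * f y)) => [s|].
  by rewrite /mulpow /= scaler0 addr0.
exact/hasdZ/(sclass_hasd _ _ Sf).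
Qed.

(** k varies over the invariant set because each derivative in the last variable raises it by
    one. *)
Lemma sclass_mulpow z k f : sclass true f -> sclass true (mulpow z k f).
Proof.
move=> Sf; exists [set g | exists k f, sclass true f /\ g = mulpow z k f]; last by exists k, f.
move=> _ {k f Sf} [k [f [Sf ->]]]; split.
- exact: mulpow_bounded.
- case=> [i|].
    exists (mulpow z k (partial (Some i) f)); last by move=> x; exact: hasd_mulpow_row Sf.
    by exists k, (partial (Some i) f); split => //; exact: sclass_partial.
  exists (mulpow z k.+1 (fun y => (z - k%:R) * f y + (crd None y)%:C * partial None f y)).
    exists k.+1, (fun y => (z - k%:R) * f y + (crd None y)%:C * partial None f y).
    split => //; apply: sclass_comb => //; apply: sclass_crd; exact: sclass_partial.
  by move=> x; exact: hasd_mulpow_last.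
- move=> o; exists k, (fun x => (crd o x)%:C * f x); split; first exact: sclass_crd.
  by apply/funext => x; rewrite /mulpow mulrCA.
- by move=> _ v; exact: mulpow_vanish.
Qed.

(** The operator D. Its stability on Psi uses [mulpow 0 1], which is division by the last
    variable. *)
Definition dilate f (x : E) : R[i] := f (- x.2 *: x.1, x.2).

Lemma mulpow01 f v s : s != 0 -> mulpow 0 1 f (v, s) = (s^-1)%:C * f (v, s).
Proof. by move=> s0; rewrite /mulpow/= cpowR0 mul1r. Qed.

Lemma sum_option (F : option 'I_n -> R[i]) :
  \sum_o F o = F None + \sum_i F (Some i).
Proof.
rewrite (bigD1 None)//=; congr (_ + _).
rewrite (reindex_omap (@Some _) id); last by case.
by apply: eq_bigl => i; rewrite eqxx.
Qed.

Lemma sclass_dilate f : sclass true f -> sclass true (dilate f).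
Proof.
move=> Sf; exists [set g | exists2 f, sclass true f & g = dilate f]; last by exists f.
move=> _ {f Sf} [f Sf ->]; split.
- by have [C fC] := sclass_bounded Sf; exists C => x; exact: fC.
- case=> [i|].
    have Si := sclass_partial (Some i) Sf.
    exists (dilate (fun x => -1 * ((crd None x)%:C * partial (Some i) f x))).
      exists (fun x => -1 * ((crd None x)%:C * partial (Some i) f x)) => //.
      exact/sclassZ/sclass_crd.
    move=> [a s].
    apply: (hasd_transfer (w := - s *: basis (Some i)) (y := (- s *: a, s)) (g := f)) => [u|].
      rewrite /dilate /=; congr (f _); apply: (congr2 pair); rewrite /= ?scaler0 ?addr0//.
      by rewrite scalerDr scalerA mulrC -scalerA.
    have := hasd_dirZ (- s) (sclass_hasd (Some i) (- s *: a, s) Sf).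
    by congr (hasd _ _ _ _); rewrite /dilate /= rmorphN mulN1r mulNr.
  (* Chain rule in the direction (- a, 1), with - a_i = x_i / s at x' = - s a. *)
  pose g x := partial None f x + \sum_i (crd (Some i) x)%:C * mulpow 0 1 (partial (Some i) f) x.
  have Sg : sclass true g.
    apply: sclassD; first exact: sclass_partial.
    by apply: sclass_sum => i; apply/sclass_crd/sclass_mulpow/sclass_partial.
  exists (dilate g); first by exists g.
  move=> [a s].
  apply: (hasd_transfer (w := (- a, 1)) (y := (- s *: a, s)) (g := f)) => [u|].
    rewrite /dilate /=; congr (f _); apply: (congr2 pair); rewrite /= ?scaler0 ?addr0//.
    by rewrite [u%:A]mulr1 opprD scalerDl scalerN -scaleNr.
  have := sclass_hasd_dir (- a, 1) (- s *: a, s) Sf.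
  congr (hasd _ _ _ _); rewrite /dilate /g /=.
  rewrite sum_option/= mul1r; congr (_ + _); apply: eq_bigr => i _.
  rewrite !mxE; have Si := sclass_partial (Some i) Sf.
  have [->|s0] := eqVneq s 0.
    by rewrite mulpow_vanish// sclass_vanish// !mulr0.
  rewrite mulpow01// mulrA -rmorphM; congr (_%:C * _).
  by field.
- case=> [i|].
    (* The coordinate a_i is - x_i / s at x' = - s a. *)
    exists (fun x => -1 * ((crd (Some i) x)%:C * mulpow 0 1 f x)).
      exact/sclassZ/sclass_crd/sclass_mulpow.
    apply/funext => -[a s]; rewrite /dilate/= mxE.
    have [->|s0] := eqVneq s 0; first by rewrite mulpow_vanish// sclass_vanish// !mulr0.
    rewrite mulpow01// mulN1r mulrA -mulNr -rmorphM -rmorphN; congr (_%:C * _).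
    by field.
  by exists (fun x => (crd None x)%:C * f x) => //; exact: sclass_crd.
- by move=> _ v; rewrite /dilate/= sclass_vanish.
Qed.

End MulPow.

(** * The Radon transform and the Riesz potentials *)

Section Radon.
Context {R : realType} (n : nat).
Local Notation E := ('rV[R]_n * R)%type.
Implicit Types f psi : E -> R[i].

Lemma fourierZ f c : sclass false f -> fourier (fun x => c * f x) = fun y => c * fourier f y.
Proof.
move=> Sf; apply/funext => y.
have Sg := sclass_mod y Sf.
rewrite /fourier /integral_space -cintZ.
  by apply: eq_cint => p; rewrite mulrA.
have := tame_integrable_space (sclass_tame Sg).
rewrite (_ : (fun p => _) = fun p =>
  f (rV_of_tuple p.1, p.2) * expi (dot (rV_of_tuple p.1, p.2) y))//.
by apply/funext => p; rewrite dotC.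
Qed.

Lemma fourier_rowM f (c : R -> R[i]) : sclass false f ->
  fourier_row (fun x => c x.2 * f x) = fun x => c x.2 * fourier_row f x.
Proof.
move=> Sf; apply/funext => x; have Sg := sclass_mod_row x.1 Sf.
rewrite {2}/fourier_row /integral_rV -cintZ; last exact: (tame_integrable_rV x.2 (sclass_tame Sg)).
by apply: eq_cint => v; rewrite mulrA.
Qed.

Lemma fourier_lastZ f c : sclass false f ->
  fourier_last (fun x => c * f x) = fun x => c * fourier_last f x.
Proof.
move=> Sf; apply/funext => x; have Sg := sclass_mod_last x.2 Sf.
rewrite {2}/fourier_last -cintZ; last exact: (tame_integrable_R x.1 (sclass_tame Sg)).
by apply: eq_cint => v; rewrite mulrA.
Qed.

Lemma mulpow_comp z w c psi :
  mulpow z 0 (fun x => c * mulpow w 0 psi x) = fun x => c * mulpow (z + w) 0 psi x.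
Proof. by apply/funext => x; rewrite /mulpow cpowRD !expr0; ring. Qed.

(** F F is (2 pi)^(n+1) times the reflection, so an element of Phi is determined by its transform
    and the choice made by [xget] is unique. The reflection is invisible to the even multiplier
    |s|^(-alpha). *)
Lemma riesz2_fourier alpha psi : sclass true psi ->
  riesz2 alpha (fourier psi) = fourier (mulpow (- alpha) 0 psi).
Proof.
move=> Sp; have Sp0 := sclassW Sp; have Sm := sclass_mulpow (- alpha) 0 Sp.
apply: xget_unique.
  split; first by exists (mulpow (- alpha) 0 psi) => //; exact/PsiP.
  move=> y; rewrite (fourier_fourier y (sclassW Sm)) (fourier_fourier y Sp0).
  by rewrite /mulpow/= expr0 mulr1 normrN mulrCA.
move=> _ [[phi /PsiP/sclassW Sphi <-] E]; congr fourier; apply/funext => y.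
have := E (- y); rewrite (fourier_fourier _ Sphi) (fourier_fourier _ Sp0) opprK.
rewrite mulrCA => /(mulfI (twopiX_neq0 _)) ->.
by rewrite /mulpow/= expr0 mulr1 normrN.
Qed.

Lemma radon_fourier psi : sclass true psi ->
  radon_T (fourier psi) =
  fun p => ((2 * pi) ^+ n)%:C * fourier_last (dilate psi) p.
Proof.
move=> Sp; have Sp0 := sclassW Sp; apply/funext => -[a b].
have Sr := sclass_fourier_row Sp0; have Sd := sclass_dilate Sp.
pose h (x : E) : R := x.2 * (dot (a, 0) x + b).
have ch : continuous h.
  move=> x; apply: cvgM; first exact: cvg_snd.
  by apply: cvgD; [exact: dot_continuous|exact: cvg_cst].
have tG := tame_expi ch (sclass_tame Sr).
transitivity (integral_space (fun x => fourier_row psi x * expi (h x))).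
  rewrite (integral_space_rV tG); apply: eq_cint => v.
  rewrite fourier_last_row//; apply: eq_cint => t.
  by rewrite /h /dot/= mul0r addr0.
rewrite (integral_space_R tG) -(congr1 (@^~ (a, b)) (fourier_lastZ _ (sclassW Sd))).
(* The phase t (a.v + b) separates as v.(t a) + t b, so the integral over v is Q (Q psi) at (t a,
   t). *)
apply: eq_cint => t; rewrite /dilate/= scaleNr -fourier_row_row//.
have Sg := sclass_mod_row (t *: a) Sr.
rewrite mulrC {2}/fourier_row /integral_rV -cintZ; last first.
  exact: (tame_integrable_rV t (sclass_tame Sg)).
apply: eq_cint => v.
rewrite /h /dot/= mul0r addr0 mulrDr expiD dotvZr [dotv a _]dotvC.
by ring.
Qed.

Lemma dotvNl (u v : 'rV[R]_n) : dotv (- u) v = - dotv u v.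
Proof. by rewrite -scaleN1r dotvC dotvZr mulN1r dotvC. Qed.

(* The symbol of R_T (F psi): [fourier_row ^ 4] is multiplication by
   (2 pi)^(2 n), so three transforms and one factor (2 pi)^(-n) play the role
   of (2 pi)^n times the inverse of [fourier_row]. *)
Definition radon_symbol psi (x : E) : R[i] :=
  ((2 * pi) ^+ n)%:C^-1 * fourier_row (fourier_row (fourier_row (dilate psi))) x.

Lemma sclass_radon_symbol psi : sclass true psi -> sclass true (radon_symbol psi).
Proof. by move=> Sp; apply: sclassZ; do 3 apply: sclass_fourier_row; exact: sclass_dilate. Qed.

Lemma radon_symbolE psi v t : sclass true psi ->
  radon_symbol psi (v, t) = fourier_row (dilate psi) (- v, t).
Proof.
move=> Sp; have /sclassW Sd := sclass_dilate Sp.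
rewrite /radon_symbol fourier_row_row; last exact: sclass_fourier_row.
by rewrite mulKf ?twopiX_neq0.
Qed.

Lemma radon_fourier_symbol psi : sclass true psi ->
  radon_T (fourier psi) = fourier (radon_symbol psi).
Proof.
move=> Sp; have /sclassW Sd := sclass_dilate Sp.
have S1 := sclass_fourier_row Sd; have S2 := sclass_fourier_row S1.
have S3 := sclass_fourier_row S2.
rewrite radon_fourier// fourier_last_row; last exact: sclassW (sclass_radon_symbol Sp).
rewrite (fourier_rowM (fun=> ((2 * pi) ^+ n)%:C^-1) S3) -fourier_lastZ//; congr fourier_last.
apply/funext => -[v t]; rewrite (fourier_row_row _ _ S2) (fourier_row_row _ _ Sd) opprK.
by rewrite mulKf ?twopiX_neq0.
Qed.

Lemma dilated_fourier_row psi v t : sclass true psi -> t != 0 ->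
  fourier_row (dilate psi) (- (t *: v), t) = (`|t| ^+ n)%:C^-1 * fourier_row psi (v, t).
Proof.
move=> Sp t0; have Sg := sclass_mod_row v (sclassW Sp).
have nt0 : - t != 0 by rewrite oppr_eq0.
rewrite {2}/fourier_row/= (integral_rV_scale t nt0 (sclass_tame Sg)) normrN mulKf; last first.
  by rewrite fmorph_eq0 expf_neq0 ?normr_eq0.
apply: eq_cint => w; rewrite /dilate/=; congr (_ * expi _).
by rewrite -scaleNr dotvZr [RHS]dotvC dotvZr dotvC.
Qed.

Lemma backproj_fourier beta psi : sclass true psi ->
  backproj_T (fourier (mulpow (- beta) 0 (radon_symbol psi))) =
  fourier (fun x => ((2 * pi) ^+ n)%:C * mulpow (- beta - n%:R) 0 psi x).
Proof.
move=> Sp; have Sm := sclass_mulpow (- beta) 0 (sclass_radon_symbol Sp).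
have Sw := sclass_mulpow (- beta - n%:R) 0 Sp.
apply/funext => -[v s].
rewrite (fourierZ _ (sclassW Sw)) (fourier_last_row (sclassW Sw)).
transitivity (radon_T (fourier (mulpow (- beta) 0 (radon_symbol psi))) (- v, s)).
  by apply: eq_cint => w /=; rewrite dotvNl.
rewrite radon_fourier//; congr (_ * _); apply: eq_cint => t; congr (_ * _) => /=.
(* The trivial power [^+ 0] keeps [c] convertible to the factor in [mulpow], as the next rewrite
   requires. *)
pose c t : R[i] := cpowR `|t| (- beta - n%:R) * (t^-1 ^+ 0)%:C.
rewrite -[mulpow (- beta - n%:R) 0 psi]/(fun x => c x.2 * psi x).
rewrite (fourier_rowM c (sclassW Sp)) /dilate/= /c scalerN scaleNr opprK.
(* At t = 0 the powers take default values, but each side carries a factor that vanishes on the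
   hyperplane. *)
have [->|t0] := eqVneq t 0.
  rewrite mulpow_vanish; last exact: sclass_radon_symbol.
  by rewrite sclass_vanish ?mulr0//; exact: sclass_fourier_row.
rewrite /mulpow radon_symbolE// dilated_fourier_row//= !expr0 !mulr1 mulrA.
have tn0 : (`|t| ^+ n)%:C != 0 :> R[i] by rewrite fmorph_eq0 expf_neq0 ?normr_eq0.
(* The Jacobian factor is cleared by |t|^(-beta - n) |t|^n = |t|^(-beta). *)
congr (_ * _); apply: (mulIf tn0); rewrite mulfVK//.
by rewrite -cpowRn ?normr_gt0// -cpowRD subrK.
Qed.

End Radon.

Unset Implicit Arguments.

Theorem theorem5p5 (R : realType) (m : nat) (hm : (2 <= m)%N)
    (f : 'rV[R]_m.-1 * R -> R[i]) (hf : Phi f) (alpha beta : R[i])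
    (x : 'rV[R]_m.-1 * R) :
  riesz2 alpha (backproj_T (riesz2 beta (radon_T f))) x =
  ((2 * pi) ^+ m.-1)%:C * riesz2 (alpha + beta + m.-1%:R) f x.
Proof.
case: hf => psi /PsiP Sp <-.
have Sw z := sclass_mulpow z 0 Sp.
rewrite radon_fourier_symbol// riesz2_fourier; last exact: sclass_radon_symbol.
rewrite backproj_fourier// riesz2_fourier; last exact: sclassZ.
rewrite riesz2_fourier// mulpow_comp fourierZ; last exact: sclassW (Sw _).
by rewrite addrA -!opprD.
Qed.
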